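(* Let $a\in\mathbb{Z}$, $a\neq-1$. For the resolved conifold with one outer brane in framing $a$, the genus $0$ one-point function is $$\Psi^{(a)}_{0,1}(t;x)=-\sum_{n=1}^\infty\frac{x^n}{n}\sum_{j=0}^n\frac{\prod_{k=1}^{n-1}(na+j+k)}{j!\,(n-j)!}\,Q^j .$$
   Context: Notation: $i=\sqrt{-1}$, $q=e^{i\lambda}$, $q^{1/2}=e^{i\lambda/2}$, $Q=-e^{-t}$. $\mathbf p=(p_1,p_2,\dots)$ are commuting formal variables and $p_\eta=\prod_j p_{\eta_j}$. For a partition $\mu$: $|\mu|$ is its size, $l(\mu)$ its length, $\mu^t$ its transpose, $\kappa_\mu=\sum_j\mu_j(\mu_j-2j+1)$, $z_\mu=\prod_{j}j^{m_j(\mu)}m_j(\mu)!$ with $m_j(\mu)$ the multiplicity of $j$ in $\mu$; $\chi_\mu(\eta)$ is the value of the irreducible character of $S_{|\mu|}$ indexed by $\mu$ on the class of cycle type $\eta$ (taken to be $0$ if $|\mu|\ne|\eta|$). $W_{\mu,\nu}(q)$ is the rational function of $q^{1/2}$ given by $W_{\mu,\nu}(q)=s_\mu(q^{\rho})\,s_\nu(q^{\mu+\rho})$, where $s$ denotes Schur functions, $q^\rho=(q^{-1/2},q^{-3/2},\dots)$ and $q^{\mu+\rho}=(q^{\mu_j-j+1/2})_{j\ge1}$ (sums convergent for $|q|>1$), and $W_\nu(q)=s_\nu(q^\rho)$. The open string amplitude of the resolved conifold with one outer brane and framing $a$ is $$Z^{(a)}(\lambda;t;\mathbf p)=\sum_{\mu,\nu,\eta}q^{a\kappa_\mu/2}W_{\mu,\nu}(q)\,Q^{|\nu|}\,W_{\nu^t}(q)\,\frac{\chi_\mu(\eta)}{z_\eta\,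 i^{\,l(\eta)}}\,p_\eta$$ (sum over all partitions, a formal power series in $Q$ and the $p_n$). Put $\hat Z^{(a)}(\lambda;t;\mathbf p)=Z^{(a)}(\lambda;t;\mathbf p)/Z^{(a)}(\lambda;t;0)$ and $F^{(a)}=\log\hat Z^{(a)}$. The one-point function $F^{(a)}_n(\lambda;t)$ is the coefficient of the linear monomial $p_n$ in $F^{(a)}$; it is expanded as $F^{(a)}_n(\lambda;t)=\sum_{g\ge0}\lambda^{2g-1}F^{(a)}_{g;n}(t)$, and $\Psi^{(a)}_{g,1}(t;x)=\sum_{n\ge1}F^{(a)}_{g;n}(t)\,x^n$. Empty products equal $1$. *)

(* Defs.v *)
From HB Require Import structures.
From mathcomp Require Import all_boot all_order all_algebra.
From mathcomp Require Import all_fingroup mxrepresentation complex.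
From mathcomp Require Import all_classical all_reals all_analysis.
Import Order.TTheory GRing.Theory Num.Theory.
Import numFieldNormedType.Exports.
Set Implicit Arguments.
Unset Strict Implicit.
Unset Printing Implicit Defensive.

Local Open Scope ring_scope.
Local Notation "x %:F" := (FracField.tofrac x) : ring_scope.

(** * Partitions *)

(* A partition is a weakly decreasing sequence of positive integers: its size
   is [sumn mu] and its length is [size mu]. *)
Definition is_part (mu : seq nat) : bool :=
  sorted geq mu && all (leq 1) mu.

(* A partition of n has at most n parts, each of them at most n. *)
Definition parts (n : nat) : seq (seq nat) :=
  [seq mu <- [seq map val (bseqval b) | b <- enum {: n.-bseq 'I_n.+1}]
     | is_part mu && (sumn mu == n)].

Lemma mem_parts (n : nat) (mu : seq nat) :
  (mu \in parts n) = is_part mu && (sumn mu == n).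
Proof.
rewrite mem_filter andb_idr // => /andP[/andP[_ pos_mu] /eqP sum_mu].
have le_size : (size mu <= n)%N.
  rewrite -sum_mu; elim: mu pos_mu {sum_mu} => //= m s IH /andP[m_gt0 /IH].
  by rewrite -add1n; apply: leq_add.
have le_parts : {in mu, forall m, (m < n.+1)%N}.
  move=> m mu_m; rewrite ltnS -sum_mu sumnE (big_rem m) //=.
  exact: leq_addr.
apply/mapP; have sz : (size (map (@inord n) mu) <= n)%N by rewrite size_map.
exists (Bseq sz); first by rewrite mem_enum.
rewrite /= -map_comp -[LHS]map_id; apply/eq_in_map => m /le_parts lt_m.
by rewrite /= inordK.
Qed.

Lemma parts_uniq (n : nat) : uniq (parts n).
Proof.
apply: filter_uniq; rewrite map_inj_uniq ?enum_uniq // => b c.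
by move/(inj_map val_inj)/val_inj.
Qed.

Definition conj_part (mu : seq nat) : seq nat :=
  [seq count (leq j) mu | j <- iota 1 (head 0%N mu)].

Definition kappa (mu : seq nat) : int :=
  \sum_(j < size mu)
    (nth 0%N mu j)%:Z * ((nth 0%N mu j)%:Z - 2 * (j.+1)%:Z + 1).

Definition zpart (mu : seq nat) : nat :=
  (\prod_(1 <= j < (sumn mu).+1) (j ^ count_mem j mu * (count_mem j mu)`!))%N.

(** * Irreducible characters of the symmetric groups *)

Section Characters.
Variable F : fieldType.

(* The boxes of the diagram of mu are numbered by 'I_(sumn mu) in reading order:
   box k lies in row [reshape_index mu k] and column [reshape_offset mu k]. *)
Definition row_stab (mu : seq nat) : {set 'S_(sumn mu)} :=
  [set s : 'S_(sumn mu) | [forall k : 'I_(sumn mu),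
              reshape_index mu (s k) == reshape_index mu k]].

Definition col_stab (mu : seq nat) : {set 'S_(sumn mu)} :=
  [set s : 'S_(sumn mu) | [forall k : 'I_(sumn mu),
              reshape_offset mu (s k) == reshape_offset mu k]].

(* The Young symmetrizer, as a vector of the regular representation. *)
Definition young_symmetrizer (mu : seq nat) : 'rV[F]_#|[set: 'S_(sumn mu)]| :=
  \sum_(p in row_stab mu) \sum_(s in col_stab mu)
    (-1) ^+ odd_perm s *:
      gring_row (regular_repr F [set: 'S_(sumn mu)]%G (p * s)%g).

(* The irreducible representation of the symmetric group indexed by mu is the
   ideal of the group algebra generated by the Young symmetrizer. The partition
   with one row gives the trivial representation. *)
Definition irr_repr (mu : seq nat) :=
  submod_repr (cyclic_mx_module (regular_repr F [set: 'S_(sumn mu)]%G)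
                                (young_symmetrizer mu)).

Definition cycle_type (n : nat) (s : 'S_n) : seq nat :=
  sort geq [seq #|(c : {set 'I_n})| | c <- enum (porbits s)].

(* The value is 0 if no permutation in the symmetric group of degree |mu| has
   cycle type eta, in particular if |mu| <> |eta|. *)
Definition chi (mu eta : seq nat) : F :=
  if [pick s : 'S_(sumn mu) | cycle_type s == eta] is Some s
  then \tr (irr_repr mu s) else 0.

End Characters.

(** * Schur polynomials *)

(* s_nu(x_0, ..., x_(N-1)) as a quotient of alternants; only meaningful for
   size nu <= N and pairwise distinct x_i. *)
Definition schur (F : fieldType) (nu : seq nat) (N : nat) (x : nat -> F) : F :=
  \det (\matrix_(i < N, j < N) x i ^+ (nth 0%N nu j + (N - j.+1))) /
  \det (\matrix_(i < N, j < N) x i ^+ (N - j.+1)).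

(** * Formal power series in Q and p_1, p_2, ... *)

(* [f d eta] is the coefficient of Q^d p_eta in f, for eta a partition; the
   values of f on sequences that are not partitions are irrelevant. *)
Definition series (F : Type) := nat -> seq nat -> F.

Section Series.
Variable F : fieldType.
Implicit Types f g : series F.

Definition series1 : series F :=
  fun d eta => ((d == 0%N) && (eta == [::]))%:R.

Definition series_mul f g : series F := fun d eta =>
  \sum_(i < d.+1) \sum_(k < (sumn eta).+1)
    \sum_(al <- parts k)
      \sum_(be <- parts (sumn eta - k) | perm_eq (al ++ be) eta)
        f i al * g (d - i)%N be.

Definition series_exp f (k : nat) : series F := iter k (series_mul f) series1.

(* For a series h without constant term, h^k has no monomial Q^d p_eta with
   d + |eta| < k: the sums over k defining 1/f and log f are finite. *)

(* 1/f, for f with constant term c <> 0: sum of c^-1 (1 - f/c)^k over k >= 0. *)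
Definition series_inv f : series F := fun d eta =>
  let c := f 0%N [::] in
  \sum_(k < (d + sumn eta).+1)
    c^-1 * series_exp (fun e al => series1 e al - c^-1 * f e al) k d eta.

(* log f, for f with constant term 1: sum of (-1)^(k-1) (f - 1)^k / k over
   k >= 1. *)
Definition series_log f : series F := fun d eta =>
  \sum_(1 <= k < (d + sumn eta).+1)
    (-1) ^+ k.-1 / k%:R * series_exp (fun e al => f e al - series1 e al) k d eta.

(* The substitution p_1 = p_2 = ... = 0. *)
Definition series_p0 f : series F :=
  fun d eta => if eta == [::] then f d [::] else 0.

End Series.

(** * The open string amplitude of the resolved conifold *)

Section Conifold.
Variable R : realType.

Definition C : numClosedFieldType := R[i].

(* Rational functions in v = q^(1/2). *)
Definition ratC : fieldType := {fraction {poly C}}.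

Definition constC (c : C) : ratC := (c%:P)%:F.

Definition qhalf : ratC := ('X : {poly C})%:F.

(* q^(mu + rho) at q^(1/2) = v: for the 1-based index j + 1, the exponent of q
   is mu_(j+1) - (j+1) + 1/2, hence that of v is 2 (mu_(j+1) - j) - 1. *)
Definition qrho (mu : seq nat) (v : C) (j : nat) : C :=
  v ^ (2 * ((nth 0%N mu j)%:Z - j%:Z) - 1).

(* w is the rational function equal to s_nu(q^(mu + rho)) for |q| > 1, where
   the Schur function of infinitely many variables is the limit of the Schur
   polynomials. *)
Definition is_schur_q (mu nu : seq nat) (w : ratC) : Prop :=
  exists P D : {poly C}, w = P%:F / D%:F /\
    forall v : C, 1 < `|v| -> D.[v] != 0 /\
      (schur nu N (qrho mu v) @[N --> \oo] --> P.[v] / D.[v])%classic.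

Definition schur_q (mu nu : seq nat) : ratC :=
  xget 0 [set w | is_schur_q mu nu w]%classic.

(* q^rho = q^(mu + rho) for mu the empty partition. *)
Definition W2 (mu nu : seq nat) : ratC := schur_q [::] mu * schur_q mu nu.

Definition W1 (nu : seq nat) : ratC := schur_q [::] nu.

(* chi_mu(eta) = 0 unless |mu| = |eta|, so only these mu are summed over. *)
Definition Zopen (a : int) : series ratC := fun d eta =>
  \sum_(mu <- parts (sumn eta)) \sum_(nu <- parts d)
    qhalf ^ (a * kappa mu) * W2 mu nu * W1 (conj_part nu) *
    constC (chi C mu eta / ((zpart eta)%:R * 'i ^+ size eta)).

Definition Zhat (a : int) : series ratC :=
  series_mul (Zopen a) (series_inv (series_p0 (Zopen a))).

Definition Fopen (a : int) : series ratC := series_log (Zhat a).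

(* The coefficient of Q^d in the one-point function F_n. *)
Definition Fone (a : int) (n d : nat) : ratC := Fopen a d [:: n].

(** * Expansion in lambda *)

(* q^(1/2) = exp(i lambda / 2) *)
Definition expi_half (lam : R) : C := (cos (lam / 2) +i* sin (lam / 2))%C.

(* w, as a function of lambda via q^(1/2) = exp(i lambda / 2), is the sum over
   g >= 0 of lambda^(2g-1) c_g for lambda <> 0 near 0. *)
Definition genus_expansion (w : ratC) (c : nat -> C) : Prop :=
  exists P D : {poly C}, w = P%:F / D%:F /\
    exists2 r : R, 0 < r & forall lam : R, 0 < `|lam| < r ->
      D.[expi_half lam] != 0 /\
      ((\sum_(g < N) (lam%:C%C : C) ^ (2 * g%:Z - 1) * c g) @[N --> \oo] -->
         P.[expi_half lam] / D.[expi_half lam])%classic.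

(* The coefficient of Q^d in F_(g;n)(t). *)
Definition Fgn (a : int) (g n d : nat) : C :=
  xget (fun=> 0) [set c | genus_expansion (Fone a n d) c]%classic g.

(* The coefficient of x^n Q^d in Psi_(g,1)(t;x). *)
Definition Psi (a : int) (g n d : nat) : C :=
  if n == 0%N then 0 else Fgn a g n d.

End Conifold.

(* Main.v *)
Require Import Defs.
From HB Require Import structures.
From mathcomp Require Import all_boot all_order all_algebra.
From mathcomp Require Import all_fingroup mxrepresentation complex.
From mathcomp Require Import all_classical all_reals all_analysis.
From mathcomp Require Import zify ring lra.
Import Order.TTheory GRing.Theory Num.Theory.
Import numFieldNormedType.Exports.
Set Implicit Arguments.
Unset Strict Implicit.
Unset Printing Implicit Defensive.
Local Open Scope ring_scope.

(* Only mu |- n occurs in the coefficient of p_n, and chi_mu of an n-cycle is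
   (-1)^b on the hook (a | b) and 0 elsewhere: the sum of all n-cycles is the
   product of the nonzero Jucys-Murphy elements, which acts on the Young
   symmetrizer by the product of the contents of the boxes other than the corner.
   By Jacobi-Trudi W_(mu,nu) is a rational function, and by the dual Cauchy
   identity the sum over nu of W_(mu,nu) Q^|nu| W_(nu^t) is its value at mu = 0
   times s_mu(q^rho) times the product of (1 + q^(content) Q) over the boxes of mu.
   Hence the closed string part cancels in the quotient, and the logarithm keeps
   the coefficient of p_n. Expanding the products for hooks by the Gauss binomial
   theorem and summing over hooks by the same theorem gives, for v = q^(1/2) and
   [m] = v^m - v^(-m),
     F_n = sum_j Q^j (prod_(0 < k < n) [na+j+k]) / (i n [1]...[j] [1]...[n-j]).
   At v = exp(i lambda / 2), [m] = 2i sin(m lambda / 2) is i lambda times an even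
   power series with constant term m, whence the coefficient of 1 / lambda.
   Power series are multiplied and inverted with geometric control of the
   remainders, which gives the expansion; its constant term is unique. *)

(** * Characters of a cycle *)

(** The amplitude is defined by limits that exist for |v| > 1, whereas the expansion in lambda takes
    place on |v| = 1. The bridge is an identity in the fraction field: the closed form of F_n is
    obtained by comparing values at infinitely many points with |v| > 1, and only this fraction is
    then evaluated near v = 1. Dimensions enter the characters as follows: if the Young symmetrizer
    satisfies Y^2 = k Y, a trace gives n! = k dim, and for the hook (a | b) a direct computation
    gives k = n a! b!. The content product (-1)^b a! b! then leaves exactly (-1)^b. In the dual
    Cauchy identity the factor attached to nu is a determinant in the elementary functions of q^rho.
    It becomes s_(nu^t)(q^rho) because both determinants have closed forms with the same hook
    product and the same power of q: conjugation preserves hook lengths and, with i and j from 0,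
    the sum of nu_i^2 is that of (2j+1) nu^t_j. On the unit circle F_n takes real values, so the
    analysis is done with real power series in lambda^2. *)

Section GroupSums.
Variables (n : nat) (A : pzRingType).
Implicit Types (rho : 'S_n -> A) (H : {set 'S_n}).

(** The target is an arbitrary ring: the regular representation yields characters, and the constant
    map 1 into the integers counts cycles. *)
Definition grp_hom rho := rho 1%g = 1 /\ {morph rho : g h / (g * h)%g >-> g * h}.

Definition grp_sum rho H := \sum_(p in H) rho p.

(** Twisting by the sign makes the alternating sum over a column group an ordinary [grp_sum]. *)
Definition sgn_hom rho (p : 'S_n) := (-1) ^+ odd_perm p * rho p.

Lemma sgn_homP rho : grp_hom rho -> grp_hom (sgn_hom rho).
Proof.
move=> [r1 rM]; split=> [|g h]; rewrite /sgn_hom ?odd_perm1 ?r1 ?mul1r //.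
rewrite odd_permM signr_addb rM -!mulrA; congr (_ * _); rewrite !mulrA.
by rewrite commr_sign.
Qed.

Lemma grp_sumMr rho (H : {group 'S_n}) h : grp_hom rho -> h \in H ->
  grp_sum rho H * rho h = grp_sum rho H.
Proof.
move=> [_ rM] Hh; rewrite /grp_sum mulr_suml.
rewrite [RHS](reindex_inj (mulIg h)) /=.
by apply: eq_big => [p|p _]; rewrite ?groupMr ?rM.
Qed.

Lemma grp_sumMl rho (H : {group 'S_n}) h : grp_hom rho -> h \in H ->
  rho h * grp_sum rho H = grp_sum rho H.
Proof.
move=> [_ rM] Hh; rewrite /grp_sum mulr_sumr.
rewrite [RHS](reindex_inj (mulgI h)) /=.
by apply: eq_big => [p|p _]; rewrite ?groupMl ?rM.
Qed.

Lemma grp_sumSr rho (H G : {group 'S_n}) : grp_hom rho -> H \subset G ->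
  grp_sum rho G * grp_sum rho H = grp_sum rho G *+ #|H|.
Proof.
move=> hr sHG; rewrite {2}/grp_sum mulr_sumr -sumr_const.
by apply: eq_bigr => h /(fintype.subsetP sHG) Gh; rewrite grp_sumMr.
Qed.

Lemma grp_sumSl rho (H G : {group 'S_n}) : grp_hom rho -> H \subset G ->
  grp_sum rho H * grp_sum rho G = grp_sum rho G *+ #|H|.
Proof.
move=> hr sHG; rewrite {1}/grp_sum mulr_suml -sumr_const.
by apply: eq_bigr => h /(fintype.subsetP sHG) Gh; rewrite grp_sumMl.
Qed.

(* The factor [tperm x o] moves x = p^-1 o back to o. *)
Lemma grp_sum_stabl rho (H : {group 'S_n}) (o : 'I_n) (P : pred 'I_n) :
  grp_hom rho -> (forall x, P x -> tperm x o \in H) ->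
  (forall p x, p \in H -> p x = o -> P x) ->
  grp_sum rho H = (\sum_(x | P x) rho (tperm x o)) *
                  grp_sum rho [set p in H | p o == o].
Proof.
move=> [_ rM] HP PH; rewrite /grp_sum (partition_big (fun p : 'S_n => (p^-1 : 'S_n)%g o) P) /=.
  rewrite mulr_suml; apply: eq_bigr => x Px.
  rewrite mulr_sumr (reindex_inj (mulgI (tperm x o))) /=.
  apply: eq_big => [p|p _]; last by rewrite rM.
  rewrite inE groupMl ?HP //; congr (_ && _).
  rewrite invMg permM tpermV (can2_eq (tpermK x o) (tpermK x o)) tpermL.
  by rewrite (can2_eq (permKV p) (permK p)) eq_sym.
by move=> p Hp; apply: (PH p) => //; rewrite permKV.
Qed.

(** Mirror image of the preceding factorization: p is sorted by x = p o, and [tperm x o] on the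
    right brings x back to o. *)
Lemma grp_sum_stabr rho (H : {group 'S_n}) (o : 'I_n) (P : pred 'I_n) :
  grp_hom rho -> (forall x, P x -> tperm x o \in H) ->
  (forall p x, p \in H -> p o = x -> P x) ->
  grp_sum rho H = grp_sum rho [set p in H | p o == o] *
                  (\sum_(x | P x) rho (tperm x o)).
Proof.
move=> [_ rM] HP PH; rewrite /grp_sum (partition_big (fun p : 'S_n => p o) P) /=.
  rewrite mulr_sumr; apply: eq_bigr => x Px.
  rewrite mulr_suml (reindex_inj (mulIg (tperm x o))) /=.
  apply: eq_big => [p|p _]; last by rewrite rM.
  rewrite inE groupMr ?HP //; congr (_ && _).
  by rewrite permM (can2_eq (tpermK x o) (tpermK x o)) tpermL.
by move=> p Hp; apply: (PH p) => //.
Qed.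

End GroupSums.

(** * Row and column sums of a diagram, and Jucys-Murphy elements *)

Section DiagramSums.
Variables (n : nat) (row col : 'I_n -> nat).
Hypothesis box_inj : forall x y, row x = row y -> col x = col y -> x = y.
Hypothesis box_lt : forall x y : 'I_n,
  (x < y)%N = (row x < row y)%N || (row x == row y) && (col x < col y)%N.
Hypothesis box_closed : forall (x : 'I_n) r c, (r <= row x)%N -> (c <= col x)%N ->
  exists y, row y = r /\ col y = c.

(** Fixing the points k >= m leaves the row or column group of the first m boxes in reading order,
    the shape on which the induction over m runs. *)
Definition fiber_stab (f : 'I_n -> nat) (m : nat) : {set 'S_n} :=
  [set p : 'S_n | [forall k, (f (p k) == f k) && ((m <= k)%N ==> (p k == k))]].

Lemma fiber_stabP f m (p : 'S_n) :
  reflect (forall k, f (p k) = f k /\ ((m <= k)%N -> p k = k)) (p \in fiber_stab f m).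
Proof.
rewrite inE; apply: (iffP forallP) => [H k|H k]; have := H k.
  by case/andP => /eqP-> /implyP h; split=> // /h/eqP.
by case=> -> h; rewrite eqxx; apply/implyP => /h ->.
Qed.

Lemma fiber_stab_group_set f m : group_set (fiber_stab f m).
Proof.
apply/group_setP; split=> [|g h /fiber_stabP Hg /fiber_stabP Hh]; apply/fiber_stabP => k.
  by rewrite perm1.
rewrite permM; have [e1 e2] := Hg k; have [e3 e4] := Hh (g k); split; first by rewrite e3.
by move=> mk; rewrite e2 //; have [_] := Hh k; apply.
Qed.
Canonical fiber_stab_group f m := Group (fiber_stab_group_set f m).

Lemma fiber_stabS f m m' : (m <= m')%N -> fiber_stab f m \subset fiber_stab f m'.
Proof.
move=> mm'; apply/fintype.subsetP => p /fiber_stabP H; apply/fiber_stabP => k.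
by have [e1 e2] := H k; split=> // /(leq_trans mm').
Qed.

Lemma fiber_stab_tperm (f : 'I_n -> nat) m x y : f x = f y -> (x < m)%N -> (y < m)%N ->
  tperm x y \in fiber_stab f m.
Proof.
move=> fxy xm ym; apply/fiber_stabP => k; split; first by case: tpermP => // ->.
by move=> mk; rewrite tpermD //; apply/eqP => e; move: mk; rewrite -e leqNgt ?xm ?ym.
Qed.

Variables (A : pzRingType) (rho : 'S_n -> A).
Hypothesis rhoP : grp_hom rho.
Hypothesis torsion_free : forall (k : nat) (x : A), (0 < k)%N -> x *+ k = 0 -> x = 0.

Let rhoM : {morph rho : g h / (g * h)%g >-> g * h} := rhoP.2.
Let sgnP := sgn_homP rhoP.

Definition row_sum m := grp_sum rho (fiber_stab row m).
Definition col_sum m := grp_sum (sgn_hom rho) (fiber_stab col m).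

Lemma row_sum_absorb m p : p \in fiber_stab row m -> row_sum m * rho p = row_sum m.
Proof. exact: grp_sumMr. Qed.

Lemma col_sum_absorb m s : s \in fiber_stab col m ->
  rho s * col_sum m = (-1) ^+ odd_perm s * col_sum m.
Proof.
move=> Cs; have E : sgn_hom rho s * col_sum m = col_sum m := grp_sumMl sgnP Cs.
rewrite -[in RHS]E /sgn_hom !mulrA -signr_addb.
by rewrite addbb mul1r.
Qed.

(** With t = (x y), t g = g t' where t' exchanges g x and g y. The row sum absorbs t and the column
    sum turns t' into -1, so the product is its own negative. *)
Lemma row_col_vanish m x y (g : 'S_n) : x != y -> tperm x y \in fiber_stab row m ->
  tperm (g x) (g y) \in fiber_stab col m -> row_sum m * rho g * col_sum m = 0.
Proof.
move=> xy Rt Ct; apply: (torsion_free (k := 2)) => //; rewrite mulr2n.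
rewrite -{1}(row_sum_absorb Rt) -(mulrA (row_sum m)) -rhoM conjgC tpermJ rhoM !mulrA.
rewrite -mulrA col_sum_absorb // odd_tperm (inj_eq perm_inj) xy expr1.
by rewrite mulN1r mulrN addNr.
Qed.

(** The inner sum has the single term k = m, and none when m >= n; this indexes the element by a
    natural number, on which [jm_prod] can recurse. *)
Definition jucys_murphy (m : nat) : A :=
  \sum_(j : 'I_n | (j < m)%N) \sum_(k : 'I_n | k == m :> nat) rho (tperm j k).

Lemma jucys_murphyE (m : 'I_n) :
  jucys_murphy m = \sum_(j : 'I_n | (j < m)%N) rho (tperm j m).
Proof.
apply: eq_bigr => j _; rewrite (eq_bigl (pred1 m)) ?big_pred1_eq //.
Qed.

(** In the same row the transposition is absorbed, in the same column it gives -1. Otherwise a third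
    corner of the rectangle spanned by j and m is an earlier box of the diagram, and yields two
    boxes of one row that the transposition carries into one column. *)
Lemma row_col_tperm (j m : 'I_n) : (j < m)%N ->
  row_sum m.+1 * rho (tperm j m) * col_sum m.+1 =
  (row_sum m.+1 * col_sum m.+1) *~ ((row j == row m)%:Z - (col j == col m)%:Z).
Proof.
move=> jm; have jm' : (j < m.+1)%N by exact: ltnW.
have nejm : j != m by rewrite neq_ltn jm.
case: (eqVneq (row j) (row m)) => [er|nr].
  rewrite row_sum_absorb ?fiber_stab_tperm //.
  case: (eqVneq (col j) (col m)) => [ec|_]; last by rewrite subr0.
  by move/eqP: nejm; case; apply: box_inj.
case: (eqVneq (col j) (col m)) => [ec|nc].
  rewrite -mulrA col_sum_absorb ?fiber_stab_tperm // odd_tperm nejm expr1.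
  by rewrite mulN1r mulrN sub0r mulrNz.
rewrite subr0 mulr0z.
have rjm : (row j < row m)%N by move: jm; rewrite box_lt (negPf nr) orbF.
case: (ltngtP (col j) (col m)) nc => // cjm _.
  (* u lies in the row of m and the column of j; the pair u, m is carried to u, j. *)
  have [u [ru cu]] := box_closed (leqnn (row m)) (ltnW cjm).
  have um : (u < m)%N by rewrite box_lt ru cu eqxx cjm orbT.
  have uj : u != j by apply: contra nr => /eqP <-; rewrite ru.
  have nu : u != m by rewrite neq_ltn um.
  have um' : (u < m.+1)%N by exact: ltnW.
  apply: (@row_col_vanish _ u m) => //; first exact: fiber_stab_tperm.
  by rewrite tpermR (tpermD (z := u)) 1?eq_sym // fiber_stab_tperm.
(* w lies in the row of j and the column of m; the pair w, j is carried to w, m. *)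
have [w [rw cw]] := box_closed (ltnW rjm) (leqnn (col m)).
have wj : (w < j)%N by rewrite box_lt rw cw eqxx cjm orbT.
have wm := ltn_trans wj jm.
have nwj : w != j by rewrite neq_ltn wj.
have nwm : w != m by rewrite neq_ltn wm.
have wm' : (w < m.+1)%N by exact: ltnW.
apply: (@row_col_vanish _ w j) => //; first exact: fiber_stab_tperm.
by rewrite tpermL tpermD 1?eq_sym // fiber_stab_tperm.
Qed.

Definition box_content (m : 'I_n) : int := (col m)%:Z - (row m)%:Z.

Lemma card_row_below (m : 'I_n) :
  (\sum_(j : 'I_n | (j < m)%N) (row j == row m))%N = col m.
Proof.
pose f (c : 'I_(col m)) : 'I_n :=
  xget m [set y | row y = row m /\ col y = c]%classic.
have fP c : row (f c) = row m /\ col (f c) = c.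
  rewrite /f; case: xgetP => [y -> //|H].
  have [y Hy] := box_closed (leqnn (row m)) (ltnW (ltn_ord c)).
  by case: (H y Hy).
rewrite -big_mkcondr /= sum1_card -[RHS]card_ord -(card_imset (f := f)).
  apply: eq_card => j; rewrite [LHS]unfold_in; apply/andP/imsetP => [[jm /eqP rjm]|[c _ ->]].
    have cj : (col j < col m)%N by move: jm; rewrite box_lt rjm ltnn eqxx.
    exists (Ordinal cj) => //; have [e1 e2] := fP (Ordinal cj).
    by apply: box_inj; rewrite ?e1 ?e2.
  by have [e1 e2] := fP c; rewrite box_lt e1 e2 eqxx ltnn ltn_ord.
by move=> c d e; apply: val_inj => /=; rewrite -(fP c).2 e (fP d).2.
Qed.

Lemma card_col_below (m : 'I_n) :
  (\sum_(j : 'I_n | (j < m)%N) (col j == col m))%N = row m.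
Proof.
pose f (r : 'I_(row m)) : 'I_n :=
  xget m [set y | row y = r :> nat /\ col y = col m]%classic.
have fP r : row (f r) = r /\ col (f r) = col m.
  rewrite /f; case: xgetP => [y -> //|H].
  have [y Hy] := box_closed (ltnW (ltn_ord r)) (leqnn (col m)).
  by case: (H y Hy).
rewrite -big_mkcondr /= sum1_card -[RHS]card_ord -(card_imset (f := f)).
  apply: eq_card => j; rewrite [LHS]unfold_in; apply/andP/imsetP => [[jm /eqP cjm]|[r _ ->]].
    have rj : (row j < row m)%N by move: jm; rewrite box_lt cjm ltnn andbF orbF.
    exists (Ordinal rj) => //; have [e1 e2] := fP (Ordinal rj).
    by apply: box_inj; rewrite ?e1 ?e2.
  by have [e1 e2] := fP r; rewrite box_lt e1 e2 eqxx ltn_ord.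
by move=> c d e; apply: val_inj => /=; rewrite -(fP c).1 e (fP d).1.
Qed.

(** The boxes before m in its row are those to its left, and those in its column are the ones above
    it, so the signs add up to the content. *)
Lemma row_jucys_murphy_col (m : 'I_n) :
  row_sum m.+1 * jucys_murphy m * col_sum m.+1 =
  (row_sum m.+1 * col_sum m.+1) *~ box_content m.
Proof.
have D a b (P : pred 'I_n) (G : 'I_n -> A) :
    a * (\sum_(j | P j) G j) * b = \sum_(j | P j) a * G j * b.
  by rewrite mulr_sumr mulr_suml.
rewrite jucys_murphyE D.
rewrite (eq_bigr _ (fun j => @row_col_tperm j m)) -mulrz_sumr; congr (_ *~ _).
rewrite sumrB /box_content; congr (_ - _).
  by rewrite -[in RHS](card_row_below m) (big_morph Posz PoszD (erefl 0%:Z)).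
by rewrite -[in RHS](card_col_below m) (big_morph Posz PoszD (erefl 0%:Z)).
Qed.

(** Conjugation by g permutes the points below m and fixes m, hence permutes the transpositions of
    the sum. *)
Lemma jucys_murphy_comm (m : 'I_n) (g : 'S_n) : (forall k : 'I_n, (m <= k)%N -> g k = k) ->
  GRing.comm (jucys_murphy m) (rho g).
Proof.
move=> Hg; rewrite /GRing.comm jucys_murphyE mulr_sumr mulr_suml.
have Hg' k : (g k < m)%N = (k < m)%N.
  rewrite !ltnNge; congr (~~ _); case: (leqP m k) => mk; first by rewrite Hg.
  apply: contraTF mk => mgk; rewrite -leqNgt.
  by have /perm_inj E := Hg _ mgk; rewrite -E.
rewrite [RHS](reindex_inj (@perm_inj _ g)) /=.
apply: eq_big => [j|j jm]; first by rewrite Hg'.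
by rewrite -!rhoM conjgC tpermJ (Hg m).
Qed.

(** For k = 0 the Jucys-Murphy element is an empty sum and is replaced by 1; [content_prod] omits
    the corner box accordingly. *)
Fixpoint jm_prod (m : nat) : A :=
  if m is k.+1 then (if k == 0%N then 1 else jucys_murphy k) * jm_prod k else 1.

Definition content_prod (m : nat) : int :=
  \prod_(k : 'I_n | (0 < k < m)%N) box_content k.

Lemma torsion_freeI (k : nat) (x y : A) : (0 < k)%N -> x *+ k = y *+ k -> x = y.
Proof.
move=> k0 e; apply/eqP; rewrite -subr_eq0; apply/eqP; apply: torsion_free k0 _.
by rewrite mulrnBl e subrr.
Qed.

Lemma content_prodS (m : 'I_n) : content_prod m.+1 =
  (if m == 0%N :> nat then 1 else box_content m) * content_prod m.
Proof.
rewrite /content_prod; case: eqP => [m0|/eqP m0].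
  by rewrite mul1r; apply: eq_bigl => k; rewrite m0; case: (val k).
rewrite (bigD1 m) /=; last by rewrite ltnSn lt0n m0.
congr (_ * _); apply: eq_bigl => k; rewrite ltnS [in RHS]ltn_neqAle.
by rewrite -val_eqE lt0n /=; lia.
Qed.

(** The sum over a larger group absorbs the sum over a smaller one up to its order, so the smaller
    row and column sums can be inserted around [jm_prod m]. The new factor commutes with the smaller
    row sum, and the two orders are cancelled by torsion-freeness. *)
Lemma row_jm_prod_col m : (m <= n)%N ->
  row_sum m * jm_prod m * col_sum m = (row_sum m * col_sum m) *~ content_prod m.
Proof.
elim: m => [_|m IH mn].
  rewrite mulr1 /content_prod big1 ?mulr1z // => k; by rewrite andbF.
pose mo : 'I_n := Ordinal mn; have {IH} IH := IH (ltnW mn).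
have -> : jm_prod m.+1 = (if m == 0%N then 1 else jucys_murphy m) * jm_prod m by [].
set X := if _ then _ else _.
have aXb : row_sum m.+1 * X * col_sum m.+1 =
    (row_sum m.+1 * col_sum m.+1) *~ (if m == 0%N then 1 else box_content mo).
  rewrite /X; case: eqP => _; first by rewrite mulr1 mulr1z.
  exact: (row_jucys_murphy_col mo).
have Xa : X * row_sum m = row_sum m * X.
  rewrite /X; case: eqP => _; first by rewrite mulr1 mul1r.
  rewrite /row_sum /grp_sum big_distrr big_distrl; apply: eq_bigr => /= p /fiber_stabP Hp.
  by apply: (@jucys_murphy_comm mo) => k mk; have [_] := Hp k; apply.
have aa : row_sum m.+1 * row_sum m = row_sum m.+1 *+ #|fiber_stab row m|.
  by apply: grp_sumSr => //; apply: fiber_stabS.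
have bb : col_sum m * col_sum m.+1 = col_sum m.+1 *+ #|fiber_stab col m|.
  by apply: grp_sumSl => //; apply: fiber_stabS.
apply: (@torsion_freeI #|fiber_stab row m|); first exact: cardG_gt0.
apply: (@torsion_freeI #|fiber_stab col m|); first exact: cardG_gt0.
transitivity (row_sum m.+1 * X * (row_sum m * jm_prod m * col_sum m) * col_sum m.+1).
  rewrite -!mulrA bb !mulrnAr; congr (_ *+ _); rewrite !mulrA.
  by rewrite -(mulrA _ X (row_sum m)) Xa !mulrA aa !mulrnAl.
rewrite IH (content_prodS mo).
have -> : row_sum m.+1 * X * (row_sum m * col_sum m *~ content_prod m) * col_sum m.+1 =
    (row_sum m.+1 * row_sum m * X * (col_sum m * col_sum m.+1)) *~ content_prod m.
  by rewrite mulrzAr mulrzAl -!mulrA (mulrA X) Xa !mulrA.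
rewrite aa bb mulrnAr !mulrnAl aXb !pmulrn -!mulrzA; congr (_ *~ _).
by rewrite [mo : nat]/=; ring.
Qed.

End DiagramSums.

(** * Cycles on the first m points, counted by orbits *)

Section Cycles.
Variable n : nat.
Implicit Types w s : 'S_n.

(** For 0 < m <= n, a permutation fixing all k >= m has at least n - m + 1 orbits, and equality
    means that the first m points form a single one. *)
Definition long_cycle (m : nat) : {set 'S_n} :=
  [set w : 'S_n | [forall k : 'I_n, (m <= k)%N ==> (w k == k)] &
                  #|porbits w| == (n - m).+1].

Lemma porbit_fix w x y : w y = y -> x \in porbit w y -> x = y.
Proof.
move=> wy /porbitP [i ->]; elim: i => [|i IH]; first by rewrite expg0 perm1.
by rewrite expgSr permM IH.
Qed.

Lemma card_porbits1 : #|porbits (1%g : 'S_n)| = n.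
Proof.
rewrite /porbits card_imset ?card_ord // => x y e.
apply: (@porbit_fix 1%g); first by rewrite perm1.
by rewrite -e porbit_id.
Qed.

(** The points m - 1, m, ..., n - 1 lie in distinct orbits, since all but the first of them are
    fixed. *)
Lemma card_porbits_fix m w : (0 < m <= n)%N ->
  (forall k : 'I_n, (m <= k)%N -> w k = k) -> ((n - m).+1 <= #|porbits w|)%N.
Proof.
move=> /andP[m0 mn] Hw.
have -> : (n - m).+1 = #|[set x : 'I_n | (m.-1 <= x)%N]|.
  have := cardsC [set x : 'I_n | (m.-1 <= x)%N]; rewrite card_ord.
  have -> : #|~: [set x : 'I_n | (m.-1 <= x)%N]| = m.-1.
    have le : (m.-1 <= n)%N by lia.
    rewrite -[RHS]card_ord -(card_imset (f := widen_ord le)) => [|x y /(congr1 val) /= /val_inj //].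
    apply: eq_card => x; rewrite !inE -ltnNge; apply/idP/imsetP => [xm|[y _ ->]] /=.
      by exists (Ordinal xm) => //; apply: val_inj.
    exact: ltn_ord.
  by lia.
rewrite -(card_in_imset (f := porbit w)) => [|x y].
  by apply: subset_leq_card; apply/fintype.subsetP => c /imsetP[x _ ->]; apply: imset_f.
rewrite !inE => mx my e.
case: (leqP m y) => my'; first by apply: (porbit_fix (Hw _ my')); rewrite -e porbit_id.
case: (leqP m x) => mx'; last by apply: ord_inj; lia.
by apply/esym/(porbit_fix (Hw _ mx')); rewrite e porbit_id.
Qed.

Lemma long_cycle1 : (0 < n)%N -> long_cycle 1 = [set 1%g].
Proof.
move=> n0; apply/setP => w; rewrite !inE; apply/andP/eqP => [[/forallP H _]|->].
  apply/permP => k; rewrite perm1; case: (posnP k) => k0; last first.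
    by have /implyP /(_ k0) /eqP := H k.
  case: (posnP (w k)) => wk; first by apply: val_inj; rewrite /= wk k0.
  by have /implyP /(_ wk) /eqP /perm_inj := H (w k).
split; first by apply/forallP => k; rewrite perm1 eqxx implybT.
by rewrite card_porbits1; apply/eqP; lia.
Qed.

(** When w fixes m, the factor (j m) inserts m into the orbit of j and lowers the number of orbits
    by one. The point j is recovered as the preimage of m, and conversely that condition forces w m
    = m. *)
Lemma long_cycle_mul (m j : 'I_n) w : (j < m)%N ->
  (tperm j m * w \in long_cycle m.+1)%g && (((tperm j m * w)^-1)%g m == j)
  = (w \in long_cycle m).
Proof.
move=> jm; rewrite (can2_eq (permKV _) (permK _)) permM tpermL eq_sym.
have njm : j != m by rewrite neq_ltn jm.
case: (eqVneq (w m) m) => [wm|wm]; last first.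
  rewrite andbF inE; apply/esym/negbTE; rewrite negb_and; apply/orP; left.
  by apply/forallPn; exists m; rewrite leqnn.
have mw : m \notin porbit w j.
  rewrite porbit_sym; apply: contra njm => H; apply/eqP; exact: (porbit_fix wm).
have := porbits_mul_tperm w m j; rewrite mw eq_sym njm tpermC /= => E.
rewrite !inE andbT; congr (_ && _).
  apply: eq_forallb => k; case: (ltngtP m k) => [mk|km|/val_inj<-] //=.
    by rewrite permM tpermD // neq_ltn ?mk ?(ltn_trans jm mk).
  by rewrite wm eqxx.
have := ltn_ord m; move: E; set a := #|_|; set b := #|_|; rewrite /= => E mn.
by apply/eqP/eqP; lia.
Qed.

(** If w fixed m, it would fix all k >= m and have one orbit too many. *)
Lemma long_cycle_move (m : 'I_n) w : (0 < m)%N -> w \in long_cycle m.+1 ->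
  ((w^-1)%g m < m)%N.
Proof.
move=> m0; rewrite inE => /andP[/forallP H /eqP E].
have wle : ((w^-1)%g m <= m)%N.
  rewrite leqNgt; apply/negP => lt; have /implyP /(_ lt) /eqP := H ((w^-1)%g m).
  by rewrite permKV => e; move: lt; rewrite -e ltnn.
rewrite ltn_neqAle wle andbT; apply/negP => /eqP/val_inj e.
have wm : w m = m by rewrite -{1}e permKV.
have := @card_porbits_fix m w; rewrite m0 ltnW // E => /(_ isT) F.
have : (n - m < n - m.+1 + 1)%N; last by have := ltn_ord m; lia.
rewrite addn1; apply: F => k; rewrite leq_eqVlt => /orP[/eqP/val_inj <- //|mk].
by apply/eqP; have /implyP := H k; apply.
Qed.

Lemma long_cycleJ m (w g : 'S_n) : m = n -> (w ^ g \in long_cycle m)%g = (w \in long_cycle m).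
Proof.
move=> ->; rewrite !inE; congr (_ && _).
  by apply: eq_forallb => k; rewrite leqNgt ltn_ord.
suff -> : porbits (w ^ g)%g = [set g @: (c : {set 'I_n}) | c in porbits w].
  by rewrite card_imset //; apply: imset_inj; apply: perm_inj.
have E x : porbit (w ^ g)%g (g x) = g @: porbit w x.
  apply/setP => y; apply/porbitP/imsetP => [[i ->]|[z /porbitP[i ->] ->]].
    exists ((w ^+ i)%g x); first exact: mem_porbit.
    by rewrite -conjXg /conjg !permM permK.
  by exists i; rewrite -conjXg /conjg !permM permK.
apply/setP => c; apply/imsetP/imsetP => [[x _ ->]|[d /imsetP[x _ ->] ->]].
  exists (porbit w ((g^-1)%g x)); first exact: imset_f.
  by rewrite -E permKV.
by exists (g x) => //; rewrite E.
Qed.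

(* Two full cycles are conjugate by matching the iterates of a point. *)
Lemma long_cycle_conj (w w' : 'S_n) : w \in long_cycle n -> w' \in long_cycle n ->
  exists g, w' = (w ^ g)%g.
Proof.
move=> Cw Cw'; case: (posnP n) => n0.
  exists 1%g; apply/permP => k; have := ltn_ord k; rewrite {2}n0; lia.
pose o : 'I_n := Ordinal n0.
have full s x : s \in long_cycle n -> exists i, x = (s ^+ i)%g o.
  rewrite inE subnn => /andP[_ /cards1P [c E]].
  apply/porbitP; have: porbit s x = porbit s o.
    have /set1P -> : porbit s x \in [set c] by rewrite -E imset_f.
    by have /set1P -> : porbit s o \in [set c] by rewrite -E imset_f.
  by move=> <-; rewrite porbit_id.
have card s : s \in long_cycle n -> #|porbit s o| = n.
  move=> Cs; rewrite -[RHS]card_ord; apply: eq_card => x; rewrite !inE.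
  by have [i ->] := full s x Cs; rewrite mem_porbit.
have per s : s \in long_cycle n -> (s ^+ n)%g o = o.
  by move=> Cs; rewrite -{2}(iter_porbit s o) (card s Cs) -permX.
have inj s (i j : nat) : s \in long_cycle n -> (i < n)%N -> (j < n)%N ->
    (s ^+ i)%g o = (s ^+ j)%g o -> i = j.
  move=> Cs ni nj; have := uniq_traject_porbit s o; rewrite (card s Cs) => U.
  rewrite !permX -(nth_traject s ni) -(nth_traject s nj) => /eqP.
  by rewrite nth_uniq ?size_traject // => /eqP.
have ind s x : s \in long_cycle n -> exists2 i, (i < n)%N & x = (s ^+ i)%g o.
  move=> Cs; have [i ->] := full s x Cs; exists (i %% n)%N; first by rewrite ltn_mod.
  rewrite {1}(divn_eq i n) expgD permM mulnC expgM; congr (_ _).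
  by elim: (i %/ n)%N => [|k IH]; rewrite ?expg0 ?perm1 // expgS permM per.
have ex x : exists i : 'I_n, x == (w ^+ i)%g o.
  by have [i ni ->] := ind w x Cw; exists (Ordinal ni).
pose idx x := xchoose (ex x).
have idxP x : x = (w ^+ idx x)%g o by apply/eqP/(xchooseP (ex x)).
have ginj : injective (fun x => (w' ^+ idx x)%g o).
  move=> x y /inj e; rewrite (idxP x) (idxP y) e //.
exists (perm ginj); apply/permP => y.
have [x ->] : exists x, y = perm ginj x by exists ((perm ginj)^-1%g y); rewrite permKV.
rewrite permJ !permE /=.
rewrite -permM -expgSr.
case: (ltnP (idx x).+1 n) => [lt|ge].
  suff -> : idx (w x) = (idx x).+1 :> nat by [].
  apply: (inj w) => //; rewrite -idxP {1}(idxP x).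
  by rewrite -permM expgSr.
have e : (idx x).+1 = n by apply/eqP; rewrite eqn_leq ge ltn_ord.
rewrite e per //.
suff -> : idx (w x) = 0%N :> nat by rewrite expg0 perm1.
apply: (inj w) => //; rewrite -idxP {1}(idxP x) -permM -expgSr e per //.
by rewrite expg0 perm1.
Qed.

End Cycles.

Section JMCycles.
Variables (n : nat) (A : pzRingType) (rho : 'S_n -> A).
Hypothesis rhoP : grp_hom rho.

(** A cycle w on the first m + 1 points factors uniquely as [tperm j m] times a cycle on the first
    m, where j is the preimage of m under w. *)
Lemma jm_prod_cycles m : (0 < m <= n)%N ->
  jm_prod rho m = \sum_(w in long_cycle n m) rho w.
Proof.
elim: m => // m IH /= mn; case: eqP => [->|/eqP m0].
  by rewrite mulr1 long_cycle1 ?big_set1 ?rhoP.1 //; lia.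
pose mo : 'I_n := Ordinal mn; rewrite IH; last by lia.
rewrite -[m]/(mo : nat) jucys_murphyE big_distrlr /=.
rewrite [RHS](partition_big (fun w : 'S_n => (w^-1 : 'S_n)%g mo) (fun j : 'I_n => j < mo)%N) /=; last first.
  by move=> w; apply: (long_cycle_move (m := mo)); rewrite lt0n.
apply: eq_bigr => j jm; rewrite [RHS](reindex_inj (mulgI (tperm j mo))) /=.
apply: eq_big => w; first by rewrite (long_cycle_mul (m := mo)).
by rewrite rhoP.2.
Qed.

End JMCycles.

(** Under the constant map 1 the k-th Jucys-Murphy element becomes the integer k. *)
Lemma card_long_cycle n : (0 < n)%N -> #|long_cycle n n| = (n.-1)`!.
Proof.
move=> n0; pose r (_ : 'S_n) : int := 1.
have rP : grp_hom r by split=> // g h; rewrite mulr1.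
have := @jm_prod_cycles n _ r rP n; rewrite n0 leqnn => /(_ isT).
rewrite sumr_const => E; apply/eqP; rewrite -eqz_nat -natz -E {E}; apply/eqP.
suff: forall m, (m < n)%N -> jm_prod r m.+1 = (m`!)%:Z.
  by move/(_ n.-1); rewrite prednK //; apply; lia.
elim=> [|m IH] mn; first by rewrite /= mulr1.
rewrite [LHS]/= -/(jm_prod r m.+1) IH ?(ltnW mn) // factS PoszM; congr (_ * _).
pose mo : 'I_n := Ordinal mn; rewrite -[m.+1]/(mo : nat) jucys_murphyE.
rewrite sumr_const natz; congr Posz.
rewrite -[RHS]card_ord -(card_imset (f := widen_ord (ltnW mn))) => [|x y /(congr1 val) /= /val_inj //].
apply: eq_card => x; rewrite [LHS]unfold_in; apply/idP/imsetP => [xm|[y _ ->] /=].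
  by exists (Ordinal xm) => //; apply: val_inj.
exact: ltn_ord.
Qed.

Lemma perm_disjointC n (p s : 'S_n) : (forall x, p x = x \/ s x = x) -> (p * s = s * p)%g.
Proof.
have aux (a b : 'S_n) : (forall x, a x = x \/ b x = x) -> forall x, a x = x -> a (b x) = b x.
  by move=> H x ax; case: (H (b x)) => // /perm_inj ->.
move=> H; apply/permP => x; rewrite !permM; case: (H x) => e.
  by rewrite e aux.
by rewrite e (aux s p) // => y; case: (H y); [right|left].
Qed.

(** In a hook the other fibers of f have one box each, so the stabilizer of the corner is the full
    symmetric group on the rest of the zero fiber. Rows and columns are both covered by exchanging f
    and g. *)
Lemma card_hook_stab n (f g : 'I_n -> nat) (o : 'I_n) :
  (forall x y, f x = f y -> g x = g y -> x = y) ->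
  (forall x, f x = 0%N \/ g x = 0%N) -> f o = 0%N -> g o = 0%N ->
  #|[set p in fiber_stab f n | p o == o]| = (#|[set x | f x == 0%N]|.-1)`!.
Proof.
move=> inj hook fo go.
have -> : #|[set x | f x == 0%N]|.-1 = #|[set x | f x == 0%N & x != o]|.
  rewrite (cardsD1 o) inE fo eqxx /=; apply: eq_card => x; rewrite !inE andbC //.
rewrite -card_perm; apply: eq_card => p; rewrite inE [RHS]unfold_in.
apply/andP/fintype.subsetP => [[/fiber_stabP H /eqP po] x|H].
  rewrite !inE => px; apply/andP; split; last by apply: contraNneq px => ->; rewrite po.
  apply: contraNeq px => fx; apply/eqP; have [e _] := H x; apply: inj => //.
  have [h|->] := hook x; first by rewrite h eqxx in fx.
  by have [h|] := hook (p x); first by rewrite -e h eqxx in fx.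
have Hf x : p x != x -> f x = 0%N.
  by move=> px; have := H x; rewrite !inE => /(_ px) /andP[/eqP].
split; last by case: (eqVneq (p o) o) => // po; have := H o; rewrite !inE po => /(_ isT); rewrite eqxx andbF.
apply/fiber_stabP => x; split; last by rewrite leqNgt ltn_ord.
case: (eqVneq (p x) x) => [-> //|px]; rewrite (Hf x) // (Hf (p x)) //.
by rewrite inj_eq //; apply: perm_inj.
Qed.

(** * The square of the Young symmetrizer of a hook *)

Section HookSums.
Variables (n : nat) (row col : 'I_n -> nat).
Hypothesis box_inj : forall x y, row x = row y -> col x = col y -> x = y.
Hypothesis hook : forall x, row x = 0%N \/ col x = 0%N.
Variable o : 'I_n.
Hypotheses (row_o : row o = 0%N) (col_o : col o = 0%N).
Variables (A : pzRingType) (rho : 'S_n -> A).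
Hypothesis rhoP : grp_hom rho.
Hypothesis torsion_free : forall (k : nat) (x : A), (0 < k)%N -> x *+ k = 0 -> x = 0.

Let rhoM : {morph rho : g h / (g * h)%g >-> g * h} := rhoP.2.
Let sgnP := sgn_homP rhoP.

Let arm := #|[set x | row x == 0%N]|.
Let leg := #|[set x | col x == 0%N]|.

Lemma stab_point_group (G : {group 'S_n}) : group_set [set p in G | p o == o].
Proof.
apply/group_setP; split=> [|g h]; first by rewrite inE group1 perm1 eqxx.
by rewrite !inE permM => /andP[Gg /eqP ->] /andP[Gh ->]; rewrite groupM.
Qed.

(* Only the corner o is moved by both groups: splitting the two sums along the
   stabilizers of o leaves products with the transpositions (x o). *)
Lemma hook_sum_sq :
  (row_sum row rho n * col_sum col rho n) * (row_sum row rho n * col_sum col rho n) =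
  row_sum row rho n * col_sum col rho n *+ (n * (arm.-1)`! * (leg.-1)`!).
Proof.
set a := row_sum _ _ _; set b := col_sum _ _ _.
pose G0 := Group (stab_point_group (fiber_stab_group row n)).
pose H0 := Group (stab_point_group (fiber_stab_group col n)).
pose a0 := grp_sum rho G0; pose b0 := grp_sum (sgn_hom rho) H0.
pose X := \sum_(x | row x == 0%N) rho (tperm x o).
pose Y := \sum_(y | col y == 0%N) sgn_hom rho (tperm y o).
have Ea : a = a0 * X.
  apply: grp_sum_stabr => // [x /eqP rx|p x /fiber_stabP H <-].
    by apply: fiber_stab_tperm; rewrite ?rx.
  by have [-> _] := H o; rewrite row_o.
have Eb : b = Y * b0.
  apply: (grp_sum_stabl sgnP) => [x /eqP rx|p x /fiber_stabP H px].
    by apply: fiber_stab_tperm; rewrite ?rx.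
  by have [<- _] := H x; rewrite px col_o.
have aa0 : a * a0 = a *+ #|G0|.
  by apply: grp_sumSr => //; apply/fintype.subsetP => p; rewrite inE => /andP[].
have bb0 : b0 * b = b *+ #|H0|.
  by apply: (grp_sumSl sgnP); apply/fintype.subsetP => p; rewrite inE => /andP[].
have G0fix p x : p \in G0 -> col x = 0%N -> p x = x.
  rewrite inE => /andP[/fiber_stabP H /eqP po] cx.
  case: (eqVneq (row x) 0%N) => rx.
    by have -> : x = o by apply: box_inj; rewrite ?rx ?cx.
  have [e _] := H x; apply: box_inj => //; have [h|->//] := hook (p x).
  by rewrite -e h eqxx in rx.
have H0fix p x : p \in H0 -> row x = 0%N -> p x = x.
  rewrite inE => /andP[/fiber_stabP H /eqP po] cx.
  case: (eqVneq (col x) 0%N) => rx.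
    by have -> : x = o by apply: box_inj; rewrite ?rx ?cx.
  have [e _] := H x; apply: box_inj => //; have [->//|h] := hook (p x).
  by rewrite -e h eqxx in rx.
have rhoC (p s : 'S_n) : (forall x, p x = x \/ s x = x) -> rho p * rho s = rho s * rho p.
  by move=> H; rewrite -!rhoM perm_disjointC.
have sgnC (c : A) p : c * sgn_hom rho p = (-1) ^+ odd_perm p * (c * rho p).
  by rewrite /sgn_hom !mulrA commr_sign.
have ab0 : b0 * a0 = a0 * b0.
  rewrite /a0 /b0 /grp_sum big_distrlr [RHS]big_distrlr [RHS]exchange_big /=.
  apply: eq_bigr => s Hs; apply: eq_bigr => p Hp.
  rewrite sgnC /sgn_hom -mulrA; congr (_ * _); apply: rhoC => x.
  by case: (hook x) => e; [left; apply: H0fix | right; apply: G0fix].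
have Ya0 : Y * a0 = a0 * Y.
  rewrite /a0 /Y /grp_sum big_distrlr [RHS]big_distrlr [RHS]exchange_big /=.
  apply: eq_bigr => y /eqP cy; apply: eq_bigr => p Hp.
  rewrite sgnC /sgn_hom -mulrA; congr (_ * _); apply: rhoC => x.
  case: (tpermP y o x) => [->|->|_ _]; [right; exact: G0fix|right; exact: G0fix|by left].
have Xb0 : b0 * X = X * b0.
  rewrite /b0 /X /grp_sum big_distrlr [RHS]big_distrlr [RHS]exchange_big /=.
  apply: eq_bigr => s Hs; apply: eq_bigr => y /eqP cy.
  rewrite sgnC /sgn_hom -mulrA; congr (_ * _); apply: rhoC => x.
  case: (tpermP y o x) => [->|->|_ _]; [left; exact: H0fix|left; exact: H0fix|by right].
(* The inner factor b a becomes a0 Y X b0 because permutations with disjoint supports commute; a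
   absorbs a0 and b absorbs b0, up to the orders of the stabilizers. *)
have T : a * b * (a * b) = (a * (Y * X) * b) *+ #|G0| *+ #|H0|.
  transitivity (a * a0 * (Y * X) * (b0 * b)); last by rewrite aa0 bb0 mulrnAr !mulrnAl.
  have ba : b * a = a0 * (Y * X) * b0.
    by rewrite Ea Eb -!mulrA (mulrA b0) ab0 -!mulrA Xb0 !mulrA Ya0.
  by rewrite -(mulrA a b) (mulrA b a) ba !mulrA.
rewrite T {T} -!mulrnA.
have -> : #|G0| = (arm.-1)`! by apply: (card_hook_stab (g := col)).
have -> : #|H0| = (leg.-1)`!.
  apply: (card_hook_stab (g := row)) => // [x y e1 e2|x]; first exact: box_inj.
  by case: (hook x); [right|left].
suff -> : a * (Y * X) * b = a * b *+ n by rewrite -mulrnA mulnA.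
(* If x = o or y = o, the remaining transposition is absorbed with total sign +1. Otherwise o and x
   share a row and are carried to y and o, which share a column, so the product vanishes. *)
have term x y : row x = 0%N -> col y = 0%N ->
    a * (sgn_hom rho (tperm y o) * rho (tperm x o)) * b =
    a * b *+ ((x == o) || (y == o)).
  move=> rx cy.
  have -> : sgn_hom rho (tperm y o) * rho (tperm x o) =
      (-1) ^+ (y != o) * rho (tperm y o * tperm x o)%g.
    by rewrite /sgn_hom odd_tperm rhoM mulrA.
  case: (eqVneq y o) => [->|yo].
    rewrite expr0 mul1r tperm1 mul1g orbT; congr (_ * _).
    by apply: row_sum_absorb => //; apply: fiber_stab_tperm; rewrite ?rx.
  case: (eqVneq x o) => [->|xo] /=.
    rewrite tperm1 mulg1 expr1 mulN1r mulrN mulNr -mulrA.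
    rewrite col_sum_absorb //; last by apply: fiber_stab_tperm; rewrite ?cy.
    by rewrite odd_tperm yo expr1 mulN1r mulrN opprK.
  rewrite expr1 mulN1r mulrN mulNr.
  rewrite (@row_col_vanish _ row col _ _ rhoP torsion_free n o x) ?oppr0 // 1?eq_sym //.
    by apply: fiber_stab_tperm; rewrite ?rx.
  have xy : x != y by apply: contraNneq xo => e; apply/eqP/box_inj; rewrite ?rx ?e ?cy.
  have ox : o != x by rewrite eq_sym.
  have oy : o != y by rewrite eq_sym.
  have yx : y != x by rewrite eq_sym.
  rewrite !permM tpermR (tpermD xy oy) (tpermD yx ox) tpermL.
  by apply: fiber_stab_tperm; rewrite ?cy.
have -> : a * (Y * X) * b =
    \sum_(y | col y == 0%N) \sum_(x | row x == 0%N) a * b *+ ((x == o) || (y == o)).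
  have D c1 c2 (P Q : pred 'I_n) (F G : 'I_n -> A) :
      c1 * ((\sum_(y | P y) F y) * (\sum_(x | Q x) G x)) * c2 =
      \sum_(y | P y) \sum_(x | Q x) c1 * (F y * G x) * c2.
    rewrite big_distrlr /= mulr_sumr mulr_suml; apply: eq_bigr => y _.
    by rewrite mulr_sumr mulr_suml.
  rewrite D; apply: eq_bigr => y /eqP cy; apply: eq_bigr => x /eqP rx; exact: term.
under eq_bigr => y _ do rewrite sumrMnr.
rewrite sumrMnr; congr (_ *+ _).
(* There are arm + leg - 1 = n pairs with x = o or y = o: y = o allows every x of the first row, any
   other y only x = o. *)
rewrite (bigD1 o) ?col_o //= (eq_bigr (fun=> 1%N)) => [|x _]; last by rewrite eqxx orbT.
rewrite sum1_card (eq_bigr (fun=> 1%N)) => [|y /andP[_ yo]]; last first.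
  by rewrite (bigD1 o) ?row_o //= eqxx big1 // => x /andP[_ xo]; rewrite (negPf xo) (negPf yo).
rewrite sum1_card -[RHS]card_ord -(cardID (fun x => row x == 0%N) 'I_n); congr (_ + _)%N.
apply: eq_card => x; rewrite !inE andbT [LHS]unfold_in.
apply/andP/idP => [[/eqP cx xo]|rx].
  by apply: contraNneq xo => rx; apply/eqP; apply: box_inj; rewrite ?rx ?cx.
have {}rx : row x != 0%N by [].
split; last by apply: contraNneq rx => ->; rewrite row_o.
by have [h|->] := hook x; first by rewrite h in rx.
Qed.

End HookSums.

(** With the rank factorization E = C R, idempotency gives R C = 1, and C R has the trace of R C. *)
Lemma mxtrace_idempotent (F : fieldType) n (E : 'M[F]_n) :
  E *m E = E -> \tr E = (\rank E)%:R.
Proof.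
move=> EE; have RC : row_base E *m col_base E = 1%:M.
  apply: (row_free_inj (row_base_free E)); apply: (row_full_inj (col_base_full E)).
  have CR := mulmx_base E.
  rewrite /= mul1mx; transitivity (col_base E *m row_base E *m (col_base E *m row_base E)).
    by rewrite !mulmxA.
  by rewrite CR EE.
by rewrite -{1}(mulmx_base E) mxtrace_mulC RC mxtrace1.
Qed.

(** * Traces on the ideal generated by a Young symmetrizer *)

Section YoungModule.
Variables (F : numFieldType) (mu : seq nat).
Local Notation n := (sumn mu).
Local Notation G := [set: 'S_n]%G.
Local Notation aG := (regular_repr F G).
Local Notation u := (young_symmetrizer F mu).
Let rw (k : 'I_n) := reshape_index mu k.
Let cl (k : 'I_n) := reshape_offset mu k.
Let rho (g : 'S_n) : 'M[F]_(gcard G) := aG g.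

Lemma regular_homP : grp_hom rho.
Proof.
split; first exact: repr_mx1.
by move=> g h; rewrite /rho repr_mxM ?inE // mulmxE.
Qed.

Lemma regular_torsion_free (k : nat) (x : 'M[F]_(gcard G)) :
  (0 < k)%N -> x *+ k = 0 -> x = 0.
Proof.
move=> k0; rewrite -scaler_nat => /eqP; rewrite scaler_eq0 => /orP[|/eqP //].
by rewrite pnatr_eq0; case: k k0.
Qed.

Let Y := row_sum rw rho n *m col_sum cl rho n.

(** Carries the computations with matrices of the regular representation over to the vector that
    generates the ideal. *)
Lemma young_symmetrizerE : u = gring_row Y.
Proof.
have E (m : 'M[F]_(gcard G)) (b : bool) : (-1) ^+ b * m = ((-1) ^+ b : F) *: m.
  by case: b; rewrite ?expr0 ?mul1r ?scale1r // !expr1 mulN1r scaleN1r.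
have Estab f : [set s : 'S_n | [forall k, f (s k) == f k]] = fiber_stab f n.
  apply/setP => p; rewrite !inE; apply: eq_forallb => k.
  by rewrite (leqNgt n k) ltn_ord andbT.
rewrite /young_symmetrizer /Y /row_sum /col_sum /grp_sum mulmx_suml linear_sum /=.
rewrite /row_stab (Estab rw); apply: eq_bigr => p _.
rewrite mulmx_sumr linear_sum /= /col_stab (Estab cl); apply: eq_bigr => s _.
rewrite /sgn_hom E -scalemxAr linearZ /=; congr (_ *: gring_row _).
by rewrite repr_mxM ?inE.
Qed.

Lemma envelop_row_sum : (Y \in enveloping_algebra_mx aG)%MS.
Proof.
rewrite envelop_mxM // /row_sum /col_sum /grp_sum linear_sum; apply: summx_sub => p _.
  by rewrite envelop_mx_id ?inE.
rewrite /sgn_hom; case: (odd_perm p); rewrite ?expr0 ?mul1r ?expr1 ?mulN1r ?linearN ?eqmx_opp.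
  by rewrite envelop_mx_id ?inE.
by rewrite envelop_mx_id ?inE.
Qed.

Let K := \sum_(w in long_cycle n n) rho w.

Lemma cycle_sum_central g : K *m rho g = rho g *m K.
Proof.
rewrite /K mulmx_suml mulmx_sumr [RHS](reindex_inj (@conjg_inj _ g)) /=.
apply: eq_big => w; first by rewrite long_cycleJ.
by move=> _; rewrite /rho -!repr_mxM ?inE // conjgC.
Qed.

Lemma cycle_sum_envelop A : (A \in enveloping_algebra_mx aG)%MS -> K *m A = A *m K.
Proof.
have comm (B : 'M[F]_(gcard G)) a : (forall g, B *m rho g = rho g *m B) ->
    B *m (\sum_(g in G) a g *: rho g) = (\sum_(g in G) a g *: rho g) *m B.
  move=> H; rewrite mulmx_suml mulmx_sumr; apply: eq_bigr => g _.
  by rewrite -scalemxAl -scalemxAr H.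
by case/envelop_mxP => a ->; apply: comm => g; apply: cycle_sum_central.
Qed.

(* K is central, hence acts by s on the whole ideal generated by Y. *)
Lemma irr_cycle_sum (s : F) : Y *m K = s *: Y ->
  \sum_(w in long_cycle n n) \tr (Defs.irr_repr F mu w) = s * (\rank (cyclic_mx aG u))%:R.
Proof.
move=> YK; rewrite -raddf_sum /= -[in RHS](mxtrace1 F) -mxtraceZ; congr (\tr _).
set V := cyclic_mx aG u.
have VK m (W : 'M[F]_(m, gcard G)) : (W <= V)%MS -> W *m K = s *: W.
  move=> WV; apply/row_matrixP => i; rewrite row_mul linearZ /=.
  have /cyclic_mxP [A EA ->] := row_subP WV i.
  rewrite -mulmxA -cycle_sum_envelop // mulmxA young_symmetrizerE -gring_row_mul YK.
  by rewrite linearZ -scalemxAl.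
transitivity (in_submod V (val_submod (1%:M : 'M[F]_(\rank V)) *m K)).
  rewrite /K mulmx_sumr linear_sum /=; apply: eq_bigr => w _; by [].
by rewrite VK ?val_submodP // linearZ /= val_submodK.
Qed.

(** Makes the permutation picked in [chi] immaterial, full cycles being conjugate. *)
Lemma irr_repr_conj w w' : w \in long_cycle n n -> w' \in long_cycle n n ->
  \tr (Defs.irr_repr F mu w) = \tr (Defs.irr_repr F mu w').
Proof.
move=> Cw Cw'; have [g ->] := long_cycle_conj Cw Cw'.
have gg : Defs.irr_repr F mu g *m Defs.irr_repr F mu (g^-1)%g = 1%:M.
  by rewrite -repr_mxM ?inE // mulgV repr_mx1.
transitivity (\tr (Defs.irr_repr F mu (g^-1)%g *m (Defs.irr_repr F mu w *m Defs.irr_repr F mu g))).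
  by rewrite [RHS]mxtrace_mulC -(mulmxA (Defs.irr_repr F mu w)) gg mulmx1.
by rewrite -!repr_mxM ?inE.
Qed.

Lemma cycle_type_long w : (0 < n)%N -> (cycle_type w == [:: n]) = (w \in long_cycle n n).
Proof.
move=> n0; apply/idP/idP => [/eqP E|].
  rewrite inE; apply/andP; split; first by apply/forallP => k; rewrite leqNgt ltn_ord.
  by have := congr1 size E; rewrite /cycle_type size_sort size_map -cardE subnn => ->.
rewrite inE => /andP[_]; rewrite subnn => /cards1P [c Ec].
rewrite /cycle_type Ec enum_set1 /=; apply/eqP; congr [:: _].
have -> : c = [set: 'I_n]; last by rewrite cardsT card_ord.
apply/setP => y; rewrite inE; have : porbit w y \in porbits w by rewrite imset_f.
by rewrite Ec => /set1P <-; rewrite porbit_id.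
Qed.

Lemma chi_long w : (0 < n)%N -> w \in long_cycle n n ->
  chi F mu [:: n] = \tr (Defs.irr_repr F mu w).
Proof.
move=> n0 Cw; rewrite /chi; case: pickP => [s|/(_ w)]; rewrite cycle_type_long //.
  by move=> Cs; apply: irr_repr_conj.
by rewrite Cw.
Qed.

(** All (n-1)! full cycles have the same trace, so the trace of their sum determines it. *)
Lemma chi_cycle (s : F) : (0 < n)%N -> Y *m K = s *: Y ->
  chi F mu [:: n] * ((n.-1)`!)%:R = s * (\rank (cyclic_mx aG u))%:R.
Proof.
move=> n0 YK; rewrite -irr_cycle_sum //.
have /card_gt0P [w Cw] : (0 < #|long_cycle n n|)%N by rewrite card_long_cycle ?fact_gt0.
rewrite (eq_bigr (fun=> chi F mu [:: n])) => [|s' Cs]; last exact/esym/chi_long.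
by rewrite sumr_const card_long_cycle // mulr_natr.
Qed.

Hypothesis box_inj : forall x y, rw x = rw y -> cl x = cl y -> x = y.

(* The matrix L of y |-> u y satisfies L^2 = k L, so that k times its rank is its
   trace, which is n! since rows and columns share no permutation but 1. *)
Lemma rank_young (k : nat) : (0 < k)%N -> Y *m Y = k%:R *: Y ->
  (\rank (cyclic_mx aG u) * k)%N = n`!.
Proof.
move=> k0 YY; set L := enveloping_algebra_mx aG *m lin_mul_row u.
have rowL i : row i L = u *m aG (enum_val i).
  by rewrite /L row_mul rowK mul_rV_lin1 /= mxvecK.
have k1 : (k%:R : F) != 0 by rewrite pnatr_eq0 -lt0n.
have LL : L *m L = k%:R *: L.
  (* Reading row vectors as elements of the group algebra, L multiplies u by y, and u is represented
     by the matrix Y. *)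
  have actL y : y *m L = gring_row (Y *m gring_mx aG y).
    rewrite gring_row_mul -young_symmetrizerE /gring_mx /= /L mulmxA.
    by rewrite mul_rV_lin1 /=.
  apply/row_matrixP => i; rewrite row_mul actL rowL gring_mxJ ?enum_valP //.
  rewrite young_symmetrizerE gring_rowK ?envelop_row_sum // mulmxA YY.
  by rewrite linearZ /= rowL young_symmetrizerE -scalemxAl linearZ /= gring_row_mul.
(* Each of the n! diagonal entries is the coefficient of the identity in u, to which only p = s = 1
   contributes. *)
have trL : \tr L = (n`!)%:R.
  rewrite /mxtrace (eq_bigr (fun=> 1)) => [|i _].
    by rewrite sumr_const /gcard card_ord cardsT card_Sn.
  have -> : L i i = row i L 0 i by rewrite [RHS]mxE.
  rewrite rowL /young_symmetrizer mulmx_suml summxE (bigD1 1%g) /=; last first.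
    by rewrite inE; apply/forallP => k'; rewrite perm1.
  rewrite mulmx_suml summxE (bigD1 1%g) /=; last first.
    by rewrite inE; apply/forallP => k'; rewrite perm1.
  have entry (p s : 'S_n) :
      (((-1) ^+ odd_perm s *: gring_row (aG (p * s)%g)) *m aG (enum_val i)) 0 i =
      ((-1) ^+ odd_perm s * (p * s == 1)%g%:R : F).
    rewrite -scalemxAl mxE; congr (_ * _).
    rewrite /gring_row rowK -rowE rowK gring_indexK ?inE // mxE eqxx /= gring_indexK ?inE // mul1g.
    rewrite -(inj_eq (can_inj gring_valK)) gring_indexK ?inE // eq_sym.
    by rewrite -{2}[enum_val i]mul1g (inj_eq (@mulIg _ _)).
  rewrite entry odd_perm1 mulg1 eqxx mulr1 expr0 -[RHS]addr0 -addrA; congr (_ + _).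
  have van (p s : 'S_n) : p \in row_stab mu -> s \in col_stab mu -> (p * s == 1)%g -> p = 1%g.
    rewrite !inE => /forallP Hp /forallP Hs /eqP ps; apply/permP => x; rewrite perm1.
    apply: box_inj; first exact/eqP/Hp.
    have := Hs (p x); rewrite -permM ps perm1 => /eqP e; exact/esym.
  rewrite big1 ?add0r; last first.
    move=> s /andP[Cs s1]; rewrite entry mul1g (negPf s1) mulr0 //.
  rewrite big1 // => p /andP[Rp p1]; rewrite mulmx_suml summxE big1 // => s Cs.
  rewrite entry; case: eqP => [/eqP ps|_]; last by rewrite mulr0.
  by rewrite (van p s Rp Cs ps) eqxx in p1.
(* L / k is idempotent and has the rank of L. *)
have := @mxtrace_idempotent _ _ (k%:R^-1 *: L).
rewrite -scalemxAl -scalemxAr LL (scalerA _ k%:R) mulVf // scale1r => /(_ erefl).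
rewrite mxtraceZ trL mxrank_scale_nz ?invr_eq0 //.
rewrite /cyclic_mx mxrank_gen -/L => e; apply/eqP.
by rewrite -(eqr_nat F) natrM -e mulrAC mulVf ?mul1r.
Qed.

End YoungModule.

Lemma part_nth_le mu i j : is_part mu -> (i <= j)%N -> (nth 0 mu j <= nth 0 mu i)%N.
Proof.
move=> /andP[smu _] ij; case: (ltnP j (size mu)) => jm; last by rewrite nth_default.
have tr : transitive geq by move=> x y z /= h1 h2; apply: leq_trans h2 h1.
exact: (sorted_leq_nth tr (leqnn) 0%N smu i j (leq_ltn_trans ij jm) jm ij).
Qed.

(** * The character of a full cycle in terms of contents *)

Section Boxes.
Variable mu : seq nat.
Hypothesis mu_part : is_part mu.
Local Notation n := (sumn mu).
Let row (k : 'I_n) := reshape_index mu k.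
Let col (k : 'I_n) := reshape_offset mu k.

Lemma young_box_inj x y : row x = row y -> col x = col y -> x = y.
Proof.
move=> er ec; apply: ord_inj.
by rewrite -(reshape_indexK mu x) -(reshape_indexK mu y) -/(row x) er -/(col x) ec.
Qed.

Lemma young_box_lt (x y : 'I_n) :
  (x < y)%N = (row x < row y)%N || (row x == row y) && (col x < col y)%N.
Proof. by rewrite ltnNge (reshape_leq mu) -/(row x) -/(col x) -/(row y) -/(col y); lia. Qed.

Lemma young_box_closed (x : 'I_n) r c : (r <= row x)%N -> (c <= col x)%N ->
  exists y, row y = r /\ col y = c.
Proof.
move=> rx cx; have H : (c < nth 0 mu r)%N.
  apply: leq_ltn_trans cx (leq_trans (reshape_offsetP (ltn_ord x)) _).
  exact: part_nth_le.
by exists (Ordinal (flatten_indexP H)); rewrite /row /col /= flatten_indexKl ?flatten_indexKr.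
Qed.

Variable F : numFieldType.

(** The sum K of full cycles is the product of Jucys-Murphy elements. Being central, it moves from
    the right of the column sum into the middle, where it acts by the content product. *)
Lemma chi_cycle_content : (0 < n)%N ->
  chi F mu [:: n] * ((n.-1)`!)%:R =
  (content_prod row col n)%:~R *
    (\rank (cyclic_mx (regular_repr F [set: 'S_n]%G) (young_symmetrizer F mu)))%:R.
Proof.
move=> n0; apply: chi_cycle => //.
have := @row_jm_prod_col n row col young_box_inj young_box_lt young_box_closed _ _
  (regular_homP F mu) (@regular_torsion_free F mu) n (leqnn n).
rewrite (jm_prod_cycles (regular_homP F mu)) ?n0 ?leqnn // => E.
rewrite scaler_int -E -!mulmxE -!mulmxA; congr (_ *m _).
rewrite /col_sum /grp_sum mulmx_suml [RHS]mulmx_sumr; apply: eq_bigr => s _.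
have Es (A B : 'M[F]_(gcard [set: 'S_n])) (b : bool) :
    A *m B = B *m A -> ((-1) ^+ b * A) *m B = B *m ((-1) ^+ b * A).
  move=> AB; case: b; rewrite ?expr0 ?mul1r // expr1 mulN1r mulNmx mulmxN AB //.
by rewrite /sgn_hom; apply: Es; rewrite cycle_sum_central.
Qed.

(** A second row with two boxes puts the box in row 1 and column 1, of content 0, into the
    diagram. *)
Lemma chi_cycle_nonhook : (1 < nth 0 mu 1)%N -> chi F mu [:: n] = 0.
Proof.
move=> H; pose k : 'I_n := Ordinal (flatten_indexP H).
have rk : row k = 1%N by rewrite /row /= flatten_indexKl.
have ck : col k = 1%N by rewrite /col /= flatten_indexKr.
have k0 : (0 < k)%N by rewrite /= /flatten_index addn1.
have n0 : (0 < n)%N by apply: leq_ltn_trans (ltn_ord k).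
have := chi_cycle_content n0; rewrite /content_prod (bigD1 k) ?k0 ?ltn_ord //=.
have -> : box_content row col k = 0 by rewrite /box_content rk ck subrr.
rewrite !mul0r => /eqP; rewrite mulf_eq0 pnatr_eq0.
by rewrite (gtn_eqF (fact_gt0 _)) orbF => /eqP.
Qed.

End Boxes.

(** Frobenius notation (a | b): arm a, leg b, size a + b + 1. *)
Definition hook_part (a b : nat) := a.+1 :: nseq b 1%N.

Section HookChar.
Variables (a b : nat).
Local Notation mu := (hook_part a b).
Local Notation n := (sumn mu).

Lemma sumn_hook : n = (a + b).+1.
Proof. by rewrite /= sumn_nseq mul1n. Qed.

Lemma hook_is_part : is_part mu.
Proof.
rewrite /is_part /= all_nseq orbT andbT.
suff H x k : (0 < x)%N -> path geq x (nseq k 1%N) by exact: H.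
by elim: k x => //= k IH x ->; rewrite IH.
Qed.

Lemma hook_box k : (k < n)%N ->
  reshape_index mu k = (k - a)%N /\ reshape_offset mu k = (if (k <= a)%N then k else 0%N).
Proof.
rewrite sumn_hook => kn; case: (leqP k a) => ka.
  have H : (k < nth 0 mu 0)%N by rewrite /= ltnS.
  have e : flatten_index mu 0 k = k by rewrite /flatten_index take0.
  by rewrite -{1 3}e flatten_indexKl // flatten_indexKr //; split=> //; lia.
have H : (0 < nth 0 mu (k - a))%N.
  have E : (k - a = (k - a).-1.+1)%N by lia.
  by rewrite E /= nth_nseq ifT //; lia.
have e : flatten_index mu (k - a) 0 = k.
  have -> : (k - a = (k - a).-1.+1)%N by lia.
  rewrite /flatten_index /= take_nseq ?sumn_nseq; lia.
by rewrite -{1 3}e flatten_indexKl // flatten_indexKr.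
Qed.

(** The contents are 1, ..., a along the arm and -1, ..., -b down the leg. *)
Lemma hook_content_prod :
  content_prod (fun k : 'I_n => reshape_index mu k) (fun k : 'I_n => reshape_offset mu k) n
  = (-1) ^+ b * (a`! * b`!)%:Z.
Proof.
rewrite /content_prod.
transitivity (\prod_(0 <= k < n | (0 < k)%N)
   ((if (k <= a)%N then k else 0%N)%:Z - (k - a)%:Z)).
  rewrite big_mkord; apply: eq_big => [k|k _]; first by rewrite ltn_ord andbT.
  by have [e1 e2] := hook_box (ltn_ord k); rewrite /box_content; congr (_%:Z - _%:Z).
rewrite sumn_hook big_ltn_cond // ltnn.
rewrite (@big_cat_nat _ _ _ a.+1) //= ?ltnS ?leq_addr // PoszM mulrCA; congr (_ * _).
  rewrite big_nat_cond (eq_bigr (fun k : nat => k%:Z)) => [|k]; last first.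
    by move=> /andP[/andP[_ ka] _]; rewrite -ltnS ka (eqP (ka : (k - a == 0)%N)) subr0.
  rewrite fact_prod (big_morph Posz PoszM (erefl 1%:Z)) [RHS]big_nat_cond.
  by apply: eq_bigl => k; lia.
rewrite big_nat_cond -big_nat_cond -{1}[a.+1]add1n big_addn.
have -> : ((a + b).+1 - a = b.+1)%N by lia.
transitivity (\prod_(1 <= i < b.+1) ((-1) * i%:Z)).
  rewrite big_nat_cond [RHS]big_nat_cond; apply: eq_big => [k|k]; first by lia.
  by move=> /andP[/andP[k1 _] _]; rewrite addnK ifN ?sub0r ?mulN1r //; lia.
rewrite big_split /= prodr_const_nat subn1; congr (_ * _).
by rewrite fact_prod (big_morph Posz PoszM (erefl 1%:Z)).
Qed.

Variable F : numFieldType.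

(** Since Y^2 = n a! b! Y, the dimension d satisfies d a! b! = (n-1)!. The content product times d
    is therefore (-1)^b (n-1)!. *)
Lemma chi_cycle_hook : chi F mu [:: n] = (-1) ^+ b.
Proof.
have n0 : (0 < n)%N by rewrite sumn_hook.
have E := chi_cycle_content hook_is_part F n0.
pose rw (k : 'I_n) := reshape_index mu k; pose cl (k : 'I_n) := reshape_offset mu k.
pose o : 'I_n := Ordinal n0.
have inj := young_box_inj (mu := mu).
have box (k : 'I_n) := hook_box (ltn_ord k).
have hook k : rw k = 0%N \/ cl k = 0%N.
  by have [e1 e2] := box k; rewrite /rw /cl e1 e2; case: leqP => ka; [left; lia|right].
have ro : rw o = 0%N by have [e _] := box o; rewrite /rw e.
have co : cl o = 0%N by have [_ e] := box o; rewrite /cl e.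
have := hook_sum_sq inj hook ro co (regular_homP F mu) (@regular_torsion_free F mu).
set A := #|_|; set B := #|_|.
have An : A = a.+1.
  rewrite /A -[RHS]card_ord.
  have le : (a.+1 <= n)%N by rewrite sumn_hook; lia.
  rewrite -(card_imset (f := widen_ord le)) => [|x y /(congr1 val) /= /val_inj //].
  apply: eq_card => k; rewrite inE; have [e _] := box k.
  rewrite /rw e; apply/idP/imsetP => [ka|[y _ ->] /=].
    have ka' : (k < a.+1)%N by lia.
    by exists (Ordinal ka') => //; apply: ord_inj.
  by have := ltn_ord y; lia.
have Bn : B = b.+1.
  have := cardsCs [set x | cl x == 0%N]; rewrite -/B card_ord => ->.
  suff -> : #|~: [set x | cl x == 0%N]| = a by rewrite sumn_hook; lia.
  rewrite -[RHS]card_ord.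
  have H (i : 'I_a) : (i.+1 < n)%N by have := ltn_ord i; rewrite sumn_hook; lia.
  rewrite -(card_imset (f := fun i => Ordinal (H i))) => [|x y /(congr1 val) /= [] /val_inj //].
  apply: eq_card => k; rewrite !inE; have [_ e] := box k.
  rewrite /cl e; apply/idP/imsetP => [ka|[y _ ->] /=].
    have [k0 k1] : (0 < k)%N /\ (k <= a)%N.
      by move: ka; case: (leqP k a) => // ka; rewrite lt0n.
    have ka' : (k.-1 < a)%N by lia.
    by exists (Ordinal ka') => //; apply: ord_inj; rewrite /= prednK.
  by rewrite ltn_ord.
rewrite An Bn /= -scaler_nat => YY.
have k0 : (0 < n * a`! * b`!)%N by rewrite !muln_gt0 n0 !fact_gt0.
have rk := rank_young inj k0 YY.
move: E; rewrite hook_content_prod => E.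
have nf : (n.-1)`! != 0%N by rewrite -lt0n fact_gt0.
have nn : n`! = (n * (n.-1)`!)%N by rewrite -{1}(prednK n0) factS prednK.
set d := \rank _ in E rk.
have rk' : (d * (a`! * b`!) = (n.-1)`!)%N.
  by apply/eqP; rewrite -(eqn_pmul2l n0) -nn -rk; apply/eqP; ring.
apply: (@mulIf _ ((n.-1)`!)%:R); first by rewrite pnatr_eq0.
rewrite E -rk' [in RHS]mulnC natrM mulrA rmorphM rmorphXn /= rmorphN1; congr (_ * _).
Qed.

End HookChar.

Lemma chi_nil (F : numFieldType) : chi F [::] [::] = 1.
Proof.
have one (s : 'S_(sumn [::])) : s = 1%g by apply/permP => k; case: (k).
pose f (k : 'I_(sumn [::])) := reshape_index [::] k.
have sum1 (h : 'I_(sumn [::]) -> nat) rho : grp_hom rho -> grp_sum rho (fiber_stab h (sumn [::])) = 1 :> 'M[F]_(gcard [set: 'S_(sumn [::])]%G).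
  move=> [r1 _]; rewrite /grp_sum (big_pred1 1%g) // => p /=.
  by rewrite (one p) eqxx group1.
have rk : \rank (cyclic_mx (regular_repr F [set: 'S_(sumn [::])]%G) (young_symmetrizer F [::])) = 1%N.
  have := @rank_young F [::] _ 1%N isT; rewrite muln1; apply.
    by move=> x; case: x.
  rewrite /row_sum /col_sum !sum1; first by rewrite mulmxE !mulr1 scale1r.
    exact/sgn_homP/regular_homP.
  exact: regular_homP.
rewrite /chi; case: pickP => [s _|/(_ 1%g)].
  by rewrite (one s) repr_mx1 mxtrace1 rk.
rewrite /cycle_type; have -> : porbits (1%g : 'S_(sumn [::])) = finset.set0.
  by apply/setP => c; rewrite inE; apply/imsetP => -[x]; case: x.
by rewrite enum_set0.
Qed.

(** * Jacobi-Trudi determinants *)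

Section CompleteSymmetric.
Variable F : fieldType.
Implicit Types (s t : seq F) (x y z : F).

(** Complete symmetric polynomials of a list: h_k(x, s) = h_k(s) + x h_(k-1)(x, s), the inner
    recursion being on the degree. *)
Fixpoint hsym s : nat -> F :=
  if s is x :: s' then
    fix h k := if k is k'.+1 then hsym s' k'.+1 + x * h k' else 1
  else fun k => (k == 0%N)%:R.

Lemma hsym0 s : hsym s 0 = 1.
Proof. by case: s. Qed.

Lemma hsymS x s k : hsym (x :: s) k.+1 = hsym s k.+1 + x * hsym (x :: s) k.
Proof. by []. Qed.

Lemma hsym_nil k : hsym [::] k = (k == 0%N)%:R.
Proof. by []. Qed.
Arguments hsym : simpl never.

Lemma hsym_swap x y s k : hsym (x :: y :: s) k = hsym (y :: x :: s) k.
Proof.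
elim/ltn_ind: k => -[|k] IH; first by rewrite !hsym0.
rewrite hsymS [RHS]hsymS ![hsym (_ :: s) k.+1]hsymS IH //.
case: k IH => [|k] IH; first by rewrite !hsym0; ring.
have e1 := hsymS x (y :: s) k; have e2 := hsymS y (x :: s) k.
rewrite !IH // in e1 e2 *.
have {}e1 := canRL (addrK _) (esym e1); have {}e2 := canRL (addrK _) (esym e2).
by rewrite e1 e2; ring.
Qed.

Lemma hsym_cons x s t k : hsym s =1 hsym t -> hsym (x :: s) k = hsym (x :: t) k.
Proof. by move=> e; elim: k => [|k IH]; rewrite ?hsym0 // !hsymS e IH. Qed.

Lemma hsym_rcons x s k : hsym (rcons s x) k = hsym (x :: s) k.
Proof.
elim: s k => //= y s IH k; rewrite -[RHS]/(hsym (x :: y :: s) k) hsym_swap.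
exact: hsym_cons.
Qed.

(** Complete symmetric polynomials are the divided differences of powers; this is one step of the
    difference table. *)
Lemma hsym_exchange x y s k :
  hsym (x :: s) k.+1 - hsym (y :: s) k.+1 = (x - y) * hsym (x :: y :: s) k.
Proof.
have e1 := hsymS x (y :: s) k; have e2 := hsymS y (x :: s) k.
rewrite -hsym_swap -[hsym (y :: x :: s) k]hsym_swap in e2.
have {}e1 := canRL (addrK _) (esym e1); have {}e2 := canRL (addrK _) (esym e2).
by rewrite e1 e2; ring.
Qed.

(* hsym in degree a - b, read as 0 when a < b *)
Definition hsymB s (a b : nat) : F := if (b <= a)%N then hsym s (a - b) else 0.

Fixpoint rvars (x : nat -> F) (N : nat) : seq F :=
  if N is N'.+1 then x N' :: rvars x N' else [::].

Lemma hsymB_newton z x s a b :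
  hsymB (z :: s) a b = hsymB (x :: s) a b + (z - x) * hsymB (z :: x :: s) a b.+1.
Proof.
rewrite /hsymB; case: (ltngtP b a) => [ab|ab|->]; last first.
- by rewrite subnn !hsym0 mulr0 addr0.
- by rewrite mulr0 addr0.
have -> : (a - b = (a - b.+1).+1)%N by lia.
by rewrite -hsym_exchange; ring.
Qed.

(** Newton interpolation of z^a at the nodes x_0, x_1, ..., with its remainder as the last term. *)
Lemma newton_interpolation (x : nat -> F) z a N :
  z ^+ a = \sum_(k < N) (\prod_(m < k) (z - x m)) * hsymB (rvars x k.+1) a k +
           (\prod_(m < N) (z - x m)) * hsymB (z :: rvars x N) a N.
Proof.
elim: N => [|N ->].
  rewrite !big_ord0 add0r mul1r /hsymB subn0 leq0n /=.
  elim: a => [|a IH]; first by rewrite expr0 hsym0.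
  by rewrite exprS IH hsymS hsym_nil add0r.
rewrite big_ord_recr /= -addrA; congr (_ + _).
rewrite big_ord_recr /= -mulrA -mulrDr; congr (_ * _).
exact: hsymB_newton.
Qed.

Lemma hsym_scale c s k : hsym [seq c * x | x <- s] k = c ^+ k * hsym s k.
Proof.
elim: s k => [|x s IH] k; first by case: k => [|k]; rewrite !hsym_nil ?mulr1 ?mulr0 ?expr0.
rewrite map_cons.
elim: k => [|k IHk]; first by rewrite !hsym0 expr0 mulr1.
by rewrite !hsymS IHk IH exprS; ring.
Qed.

(** The right-hand side is the Gaussian binomial coefficient of N + k - 1 over k. *)
Lemma hsym_geometric (u : F) N k : (forall i, (0 < i)%N -> u ^+ i != 1) ->
  hsym (rvars (fun i => u ^+ i) N) k =
  \prod_(i < k) ((1 - u ^+ (N + i)) / (1 - u ^+ i.+1)).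
Proof.
move=> u1; have u1' i : 1 - u ^+ i.+1 != 0 by rewrite subr_eq0 eq_sym u1.
elim: N k => [|N IHN] k.
  by case: k => [|k]; rewrite hsym_nil ?big_ord0 // big_ord_recl /= expr0 subrr !mul0r.
rewrite [rvars _ _]/=; elim: k => [|k IHk]; first by rewrite hsym0 big_ord0.
rewrite hsymS IHk IHN [in LHS]big_split [X in _ + _ * X]big_split [RHS]big_split /=.
rewrite big_ord_recl [in RHS]big_ord_recr addn0 /=.
rewrite !(big_ord_recr k) /=.
under [\prod_(i < k) (1 - u ^+ (N + bump 0 i))]eq_bigr => i _ do rewrite /bump add1n addnS -addSn.
set A := \prod_(i < k) (1 - _); set B := \prod_(i < k) (_^-1).
rewrite addSn !exprS exprD.
by have := u1' k; rewrite exprS => h; field.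
Qed.

(** Flagged Jacobi-Trudi matrix: the entry h_(nu_j + i - j) of row i uses only the first N - i
    variables, as Newton interpolation produces it. *)
Definition jt_mx (nu : seq nat) (N l : nat) (x : nat -> F) : 'M[F]_l :=
  \matrix_(i, j) hsymB (rvars x (N - i)) (nth 0%N nu j + i) j.

Lemma rev_rows_det N (A B : 'M[F]_N) : (forall i j, A i j = B (rev_ord i) j) ->
  \det A = (-1) ^+ odd_perm (perm (@rev_ord_inj N)) * \det B.
Proof.
move=> AB; have -> : A = row_perm (perm (@rev_ord_inj N)) B.
  by apply/matrixP => i j; rewrite mxE permE AB.
by rewrite row_permE det_mulmx det_perm.
Qed.

(** Newton interpolation at the x_i factors each alternant as L H with L triangular and independent
    of nu. L cancels in the quotient, and H is the flagged matrix with reversed rows, of determinant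
    1 up to the same sign when nu is empty. *)
Lemma schur_det_jt nu N (x : nat -> F) :
  (forall i j, (i < N)%N -> (j < N)%N -> x i = x j -> i = j) ->
  schur nu N x = \det (jt_mx nu N N x).
Proof.
move=> xinj.
pose L : 'M[F]_N := \matrix_(i, k) \prod_(m < k) (x i - x m).
pose H (mu : seq nat) : 'M[F]_N :=
  \matrix_(k, j) hsymB (rvars x k.+1) (nth 0%N mu j + (N - j.+1)) k.
have LH mu : \matrix_(i < N, j < N) x i ^+ (nth 0%N mu j + (N - j.+1)) = L *m H mu.
  apply/matrixP => i j; rewrite !mxE (newton_interpolation x _ _ N).
  (* The remainder vanishes because x_i is itself a node. *)
  rewrite [\prod_(m < N) _](bigD1 i) //= subrr !mul0r addr0.
  by apply: eq_bigr => k _; rewrite !mxE.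
have L0 : \det L != 0.
  rewrite det_trig; last first.
    by apply/is_trig_mxP => i j ij; rewrite mxE (bigD1 (Ordinal ij)) //= subrr mul0r.
  apply/prodf_neq0 => i _; rewrite mxE; apply/prodf_neq0 => m _.
  rewrite subr_eq0; apply/eqP => /xinj e.
  have mi := ltn_ord m; have iN := ltn_ord i.
  by have E := e iN (ltn_trans mi iN); move: mi; rewrite -E ltnn.
have HJ mu : \det (H mu) =
    (-1) ^+ odd_perm (perm (@rev_ord_inj N)) * \det (jt_mx mu N N x).
  apply: rev_rows_det => i j; rewrite !mxE /hsymB /=.
  have iN := ltn_ord i; have jN := ltn_ord j.
  have -> : (N - (N - i.+1) = i.+1)%N by lia.
  have -> : (j <= nth 0%N mu j + (N - i.+1))%N = (i <= nth 0%N mu j + (N - j.+1))%N by lia.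
  by case: ifP => // ij; congr hsym; lia.
have J0 : \det (jt_mx [::] N N x) = 1.
  rewrite det_trig; last first.
    by apply/is_trig_mxP => i j ij; rewrite mxE /hsymB nth_nil add0n leqNgt ij.
  by apply: big1 => i _; rewrite mxE /hsymB nth_nil add0n leqnn subnn hsym0.
have D0 : \matrix_(i < N, j < N) x i ^+ (N - j.+1) = L *m H [::].
  by rewrite -LH; apply/matrixP => i j; rewrite !mxE nth_nil add0n.
rewrite /schur LH D0 !det_mulmx !HJ J0 mulr1.
by rewrite mulrA mulrAC divff ?mul1r // mulf_neq0 // signr_eq0.
Qed.

(** The columns beyond the length of nu belong to zero parts: they consist of a zero block above a
    unitriangular one. *)
Lemma jt_mx_shrink nu l m (x : nat -> F) : (size nu <= l)%N ->
  \det (jt_mx nu (l + m) (l + m) x) = \det (jt_mx nu (l + m) l x).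
Proof.
move=> sl; set A := jt_mx _ _ (l + m) _.
rewrite -[A]submxK.
have -> : ursubmx A = 0.
  apply/matrixP => i j; rewrite !mxE /hsymB /= nth_default ?add0n; last by lia.
  by rewrite leqNgt (leq_trans (ltn_ord i)) ?leq_addr.
rewrite det_lblock; have -> : \det (drsubmx A) = 1.
  rewrite det_trig; last first.
    apply/is_trig_mxP => i j ij; rewrite !mxE /hsymB /= nth_default ?add0n; last by lia.
    by rewrite leq_add2l leqNgt ij.
  apply: big1 => i _; rewrite !mxE /hsymB /= nth_default ?add0n ?leqnn; last by lia.
  by rewrite subnn hsym0.
by rewrite mulr1; congr (\det _); apply/matrixP => i j; rewrite !mxE.
Qed.

Lemma schur_jacobi_trudi nu l m (x : nat -> F) : (size nu <= l)%N ->
  (forall i j, (i < l + m)%N -> (j < l + m)%N -> x i = x j -> i = j) ->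
  schur nu (l + m) x = \det (jt_mx nu (l + m) l x).
Proof. by move=> sl xinj; rewrite schur_det_jt // jt_mx_shrink. Qed.

End CompleteSymmetric.

(** * Beta numbers of a partition *)

Definition beta (nu : seq nat) (N i : nat) : nat := (nth 0 nu i + (N - i.+1))%N.
Definition betas nu N := mkseq (beta nu N) N.

Lemma size_betas nu N : size (betas nu N) = N.
Proof. by rewrite size_mkseq. Qed.

Lemma beta_lt nu N i j : is_part nu -> (i < j < N)%N -> (beta nu N j < beta nu N i)%N.
Proof.
move=> pnu /andP[ij jN]; have := part_nth_le pnu (ltnW ij); rewrite /beta; lia.
Qed.

Lemma beta_inj nu N i j : is_part nu -> (i < N)%N -> (j < N)%N ->
  beta nu N i = beta nu N j -> i = j.
Proof.
move=> pnu iN jN e; case: (ltngtP i j) => // ij.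
  by have := beta_lt pnu (N := N) (i := i) (j := j); rewrite ij jN e ltnn => /(_ isT).
by have := beta_lt pnu (N := N) (i := j) (j := i); rewrite ij iN e ltnn => /(_ isT).
Qed.

Lemma betas_sorted nu N : is_part nu -> sorted gtn (betas nu N).
Proof.
move=> pnu; apply/(sortedP 0%N) => i; rewrite size_betas => iN.
by rewrite !nth_mkseq ?(ltnW iN) // /gtn /= beta_lt // ltnSn iN.
Qed.

Lemma gtn_transitive : transitive gtn.
Proof. by move=> x y z /= h1 h2; apply: ltn_trans h2 h1. Qed.

Lemma betas_uniq nu N : is_part nu -> uniq (betas nu N).
Proof.
move=> pnu; apply: sorted_uniq (betas_sorted N pnu); first exact: gtn_transitive.
by move=> x /=; rewrite ltnn.
Qed.

Lemma part_size_le nu : is_part nu -> (size nu <= sumn nu)%N.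
Proof.
case/andP => _; elim: nu => //= m s IH /andP[m0 /IH]; lia.
Qed.

Lemma part_nth_gt0 nu i : is_part nu -> (0 < nth 0 nu i)%N = (i < size nu)%N.
Proof.
case/andP => _ /(all_nthP 0%N) H; case: (ltnP i (size nu)) => [/H //|h].
by rewrite nth_default.
Qed.

Lemma part_ext nu nu' N : is_part nu -> is_part nu' ->
  (size nu <= N)%N -> (size nu' <= N)%N ->
  (forall i, (i < N)%N -> nth 0%N nu i = nth 0%N nu' i) -> nu = nu'.
Proof.
move=> p p' s s' H; have ss : size nu = size nu'.
  apply/eqP; rewrite eqn_leq; apply/andP; split; rewrite leqNgt; apply/negP => lt.
    have := part_nth_gt0 (size nu') p; rewrite lt H ?(leq_trans lt) //.
    by rewrite part_nth_gt0 // ltnn.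
  have := part_nth_gt0 (size nu) p'; rewrite lt -H ?(leq_trans lt) //.
  by rewrite part_nth_gt0 // ltnn.
apply: (@eq_from_nth _ 0%N) => // i iN; apply: H; exact: leq_trans iN s.
Qed.

Lemma sumn_nth nu N : (size nu <= N)%N -> sumn nu = (\sum_(i < N) nth 0 nu i)%N.
Proof.
move=> s; rewrite sumnE (big_nth 0%N) big_mkord.
rewrite (big_ord_widen_cond N (fun=> true) (nth 0%N nu)) // big_mkcond /=.
by apply: eq_bigr => i _; case: ltnP => // h; rewrite nth_default.
Qed.

Lemma sum_beta nu N : (size nu <= N)%N ->
  (\sum_(i < N) beta nu N i = sumn nu + \sum_(i < N) (N - i.+1))%N.
Proof. by move=> s; rewrite big_split /= -(sumn_nth s). Qed.

(** Strict decrease forces s_i >= N - i - 1; subtracting the staircase leaves a weakly decreasing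
    sequence, and dropping its zeros gives the partition. *)
Lemma beta_of_decr (s : seq nat) (N : nat) : size s = N -> sorted gtn s ->
  exists2 nu, is_part nu /\ (size nu <= N)%N & s = betas nu N.
Proof.
move=> sN ss.
have step i : (i.+1 < N)%N -> (nth 0 s i.+1 < nth 0 s i)%N.
  by move=> h; move/(sortedP 0%N): ss; apply; rewrite sN.
have ge' k : forall i, (i < N)%N -> (N - i.+1 <= k)%N -> (N - i.+1 <= nth 0 s i)%N.
  elim: k => [|k IH] i iN h; first lia.
  case: (ltnP i.+1 N) => iN'; last lia.
  have := step i iN'; have := IH i.+1 iN'; lia.
have ge i : (i < N)%N -> (N - i.+1 <= nth 0 s i)%N by move=> iN; apply: ge'.
pose g i := (nth 0 s i - (N - i.+1))%N.
have gdec i j : (i <= j < N)%N -> (g j <= g i)%N.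
  case/andP; elim: j => [|j IH]; first by rewrite leqn0 => /eqP->.
  rewrite leq_eqVlt => /orP[/eqP-> //|ij] jN.
  apply: leq_trans (IH ij (ltnW jN)); rewrite /g.
  have := step j jN; have := ge j.+1 jN; have := ge j (ltnW jN); lia.
pose nu := [seq x <- mkseq g N | (0 < x)%N].
have smk : sorted geq (mkseq g N).
  by apply/(sortedP 0%N) => i; rewrite size_mkseq => iN; rewrite !nth_mkseq /= ?gdec //; lia.
have gt : transitive geq by move=> x y z /= h1 h2; apply: leq_trans h2 h1.
have pnu : is_part nu.
  by rewrite /is_part sorted_filter //=; apply/allP => x; rewrite mem_filter => /andP[].
have szn : (size nu <= N)%N by rewrite size_filter -[X in (_ <= X)%N](size_mkseq g N) count_size.
have filt (t : seq nat) : sorted geq t -> forall i, nth 0%N [seq x <- t | (0 < x)%N] i = nth 0%N t i.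
  elim: t => [|x t IH] //= pt; have st := path_sorted pt.
  case: (posnP x) => x0 i; last by case: i => //= i; apply: IH.
  have t0 : all (fun y => y == 0%N) t.
    apply/allP => y yt; have := order_path_min gt pt => /allP /(_ y yt) /=.
    by rewrite x0 leqn0.
  rewrite (eq_in_filter (a2 := pred0)) ?filter_pred0 ?nth_nil; last first.
    by move=> y /(allP t0) /eqP ->.
  rewrite x0; case: i => //= i; case: (ltnP i (size t)) => it; last by rewrite nth_default.
  by apply/esym/eqP; move/all_nthP: t0; apply.
exists nu => //; apply: (@eq_from_nth _ 0%N); rewrite ?size_betas // sN => i iN.
rewrite nth_mkseq // /beta /nu filt // nth_mkseq // /g subnK //; exact: ge.
Qed.

(** * The dual Cauchy identity *)

Section DualCauchy.
Variable F : fieldType.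

(** The Cauchy-Binet expansion before sorting: the sum runs over all functions f, and repeated
    columns make the non-injective terms vanish. *)
Lemma det_mul_expand (S : comNzRingType) N L (A : 'M[S]_(N, L)) (B : 'M[S]_(L, N)) :
  \det (A *m B) = \sum_(f : {ffun 'I_N -> 'I_L})
     (\prod_j B (f j) j) * \det (\matrix_(i, j) A i (f j)).
Proof.
rewrite -det_tr trmx_mul; rewrite {1}/determinant.
transitivity (\sum_(s : 'S_N) \sum_(f : {ffun 'I_N -> 'I_L})
    (-1) ^+ s * \prod_j (B (f j) j * A (s j) (f j))).
  apply: eq_bigr => s _; rewrite -mulr_sumr; congr (_ * _).
  rewrite -(bigA_distr_bigA (fun j k => B k j * A (s j) k)) /=.
  by apply: eq_bigr => j _; rewrite mxE; apply: eq_bigr => k _; rewrite !mxE.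
rewrite exchange_big /=; apply: eq_bigr => f _; rewrite -det_tr /determinant mulr_sumr.
apply: eq_bigr => s _; rewrite big_split /= mulrCA; congr (_ * (_ * _)).
by apply: eq_bigr => j _; rewrite !mxE.
Qed.

Definition seqB (e : nat -> F) (a b : nat) : F := if (b <= a)%N then e (a - b)%N else 0.

(** The entry is e_(nu_i - i + j), the Jacobi-Trudi matrix of the sequence e written with beta
    numbers. *)
Definition beta_mx (e : nat -> F) nu N : 'M[F]_N :=
  \matrix_(i, j) seqB e (beta nu N i) (N - j.+1).

Definition alternant N (x : nat -> F) (f : 'I_N -> nat) : F :=
  \det (\matrix_(i < N, j < N) x i ^+ f j).

Definition gen_poly (e : nat -> F) D y : {poly F} := \poly_(r < D.+1) (e r * y ^+ r).

(** With E the generating polynomial of e, the left side is the coefficient of T^d in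
    det(x_i^(N-j-1) E(x_i T)). This matrix is a product over an intermediate exponent s < L, and f j
    is the exponent chosen in column j. *)
Lemma alternant_gen_poly e D N d (x : nat -> F) (L := (N + D).+1) :
  alternant x (fun j : 'I_N => (N - j.+1)%N) * (\prod_(i < N) gen_poly e D (x i))`_d =
  \sum_(f : {ffun 'I_N -> 'I_L} | (\sum_j f j == d + \sum_(j < N) (N - j.+1))%N)
    (\prod_(j < N) (if (f j - (N - j.+1) <= D)%N then seqB e (f j) (N - j.+1) else 0)) *
     alternant x (fun j => f j : nat).
Proof.
pose A : 'M[{poly F}]_(N, L) := \matrix_(i, s) (x i ^+ s)%:P.
pose B : 'M[{poly F}]_(L, N) := \matrix_(s, j)
  if ((N - j.+1 <= s) && (s - (N - j.+1) <= D))%N then e (s - (N - j.+1))%N *: 'X^(s - (N - j.+1)) else 0.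
have AB : A *m B = \matrix_(i, j) (gen_poly e D (x i) * (x i ^+ (N - j.+1))%:P).
  apply/matrixP => i j; rewrite !mxE.
  rewrite /gen_poly poly_def mulr_suml.
  rewrite (eq_bigr (fun s : 'I_L => if ((N - j.+1 <= s) && (s - (N - j.+1) <= D))%N then
     (e (s - (N - j.+1))%N * x i ^+ s) *: 'X^(s - (N - j.+1)) else 0)); last first.
    move=> s _; rewrite !mxE; case: ifP => _; last by rewrite mulr0.
    by rewrite mul_polyC scalerA mulrC.
  rewrite -big_mkcond /=.
  have jN := ltn_ord j.
  have H (r : 'I_D.+1) : (r + (N - j.+1) < L)%N by have := ltn_ord r; rewrite /L; lia.
  rewrite (reindex_onto (fun r : 'I_D.+1 => Ordinal (H r))
     (fun s : 'I_L => inord (s - (N - j.+1)))) /=; last first.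
    move=> s /andP[s1 s2]; apply: ord_inj; rewrite /= inordK; lia.
  apply: eq_big => [r|r _].
    rewrite addnK leq_addl /= -ltnS ltn_ord /=; apply/eqP/ord_inj; by rewrite inordK.
  rewrite addnK [_ * (_)%:P]mulrC mul_polyC scalerA exprD; congr (_ *: _); ring.
have dAB : \det (A *m B) = (\prod_(i < N) gen_poly e D (x i)) *
    (alternant x (fun j : 'I_N => (N - j.+1)%N))%:P.
  rewrite AB; transitivity (\det (diag_mx (\row_i gen_poly e D (x i)) *m
      map_mx polyC (\matrix_(i < N, j < N) x i ^+ (N - j.+1)))).
    congr (\det _); apply/matrixP => i j; rewrite mul_diag_mx !mxE //.
  rewrite det_mulmx det_diag det_map_mx; congr (_ * _).
  by apply: eq_bigr => i _; rewrite mxE.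
have := congr1 (fun p : {poly F} => p`_d) dAB; rewrite /= mulrC coefCM => <-.
rewrite det_mul_expand coef_sum [RHS]big_mkcond /=; apply: eq_bigr => f _.
have -> : \det (\matrix_(i, j) A i (f j)) = (alternant x (fun j => f j : nat))%:P.
  rewrite /alternant -det_map_mx; congr (\det _); apply/matrixP => i j; by rewrite !mxE.
rewrite mulrC coefCM.
case: (boolP [forall j : 'I_N, (N - j.+1 <= f j)%N && (f j - (N - j.+1) <= D)%N]) => [/forallP all|].
  have -> : \prod_j B (f j) j =
     (\prod_(j < N) (if (f j - (N - j.+1) <= D)%N then seqB e (f j) (N - j.+1) else 0)) *:
     'X^(\sum_(j < N) (f j - (N - j.+1))).
    rewrite -prodrXr -scaler_prod; apply: eq_bigr => j _; rewrite mxE (all j).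
    by have /andP[a1 a2] := all j; rewrite a2 /seqB a1.
  rewrite coefZ coefXn.
  have -> : (d == \sum_(j < N) (f j - (N - j.+1)))%N = (\sum_j f j == d + \sum_(j < N) (N - j.+1))%N.
    rewrite eq_sym -(eqn_add2r (\sum_(j < N) (N - j.+1))) -big_split /=.
    congr (_ == _); apply: eq_bigr => j _; rewrite subnK //.
    by have /andP[] := all j.
  by case: ifP; rewrite ?mulr1 ?mulr0 // mulrC.
move=> /forallPn [j0 Hj0].
have -> : \prod_j B (f j) j = 0.
  by rewrite (bigD1 j0) //= mxE (negPf Hj0) mul0r.
rewrite coef0 mulr0; case: ifP => // _; rewrite (bigD1 j0) //=.
by move: Hj0; rewrite /seqB; do 2!case: (_ <= _)%N => //=; rewrite !mul0r.
Qed.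

Lemma alternant_perm N x (g : 'I_N -> nat) (s : 'S_N) :
  alternant x (fun j => g (s j)) = (-1) ^+ s * alternant x g.
Proof.
rewrite /alternant.
have -> : \matrix_(i < N, j < N) x i ^+ g (s j) = col_perm s (\matrix_(i < N, j < N) x i ^+ g j).
  by apply/matrixP => i j; rewrite !mxE.
by rewrite col_permE det_mulmx det_perm odd_permV mulrC.
Qed.

Lemma alternant_alternate N x (g : 'I_N -> nat) i j : i != j -> g i = g j -> alternant x g = 0.
Proof.
move=> ij e; rewrite /alternant -det_tr; apply: (determinant_alternate ij) => k.
by rewrite !mxE e.
Qed.

(** Only injective f survive, and each is a permutation of the beta numbers of a unique nu; the
    signed sum over permutations is the determinant of [beta_mx]. Beta numbers are at most N + d <=
    D, so truncating E at degree D changes nothing. *)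
Lemma dual_cauchy_alternant e D N d (x : nat -> F) : (d <= N)%N -> (N + d <= D)%N ->
  alternant x (fun j : 'I_N => (N - j.+1)%N) * (\prod_(i < N) gen_poly e D (x i))`_d =
  \sum_(nu <- parts d) alternant x (fun j : 'I_N => beta nu N j) * \det (beta_mx e nu N).
Proof.
move=> dN ND; rewrite alternant_gen_poly; set L := (N + D).+1.
pose G (f : {ffun 'I_N -> 'I_L}) :=
  (\prod_(j < N) (if (f j - (N - j.+1) <= D)%N then seqB e (f j) (N - j.+1) else 0)) *
     alternant x (fun j => f j : nat).
pose Phi (nu : seq nat) (s : 'S_N) : {ffun 'I_N -> 'I_L} :=
  [ffun j => inord (beta nu N (s j))].
have bL nu i : nu \in parts d -> (i < N)%N -> (beta nu N i <= N + d)%N.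
  rewrite mem_parts => /andP[pnu /eqP sd] iN; rewrite /beta.
  have : (nth 0 nu i <= d)%N; last lia.
  rewrite -sd (sumn_nth (N := maxn N (size nu))) ?leq_maxr //.
  have iM : (i < maxn N (size nu))%N by rewrite leq_max iN.
  by rewrite (bigD1 (Ordinal iM)) //= leq_addr.
have szN nu : nu \in parts d -> (size nu <= N)%N.
  by rewrite mem_parts => /andP[pnu /eqP sd]; apply: leq_trans dN; rewrite -sd part_size_le.
have PhiE nu s j : nu \in parts d -> Phi nu s j = beta nu N (s j) :> nat.
  move=> nud; rewrite ffunE inordK //; have := bL nu (s j) nud (ltn_ord _); rewrite /L; lia.
pose l := [seq Phi nu s | nu <- parts d, s <- enum {: 'S_N}].
have lP f : (f \in l) = ((\sum_j f j == d + \sum_(j < N) (N - j.+1))%N && injectiveb f).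
  apply/allpairsP/andP => [[[nu s] /= [nud _ ->]]|[/eqP Sf /injectiveP finj]].
    have := nud; rewrite mem_parts => /andP[pnu /eqP sd]; split.
      rewrite -[d in (d + _)%N]sd -(sum_beta (szN nu nud)); apply/eqP.
      rewrite [RHS](reindex_inj (@perm_inj _ s)) /=.
      by apply: eq_bigr => j _; rewrite PhiE.
    apply/injectiveP => i j /(congr1 val) /=; rewrite !PhiE // => /(beta_inj pnu (ltn_ord _) (ltn_ord _)).
    by move/ord_inj/perm_inj.
  pose t := sort geq [seq (f j : nat) | j <- enum 'I_N].
  have tperm : perm_eq t [seq (f j : nat) | j <- enum 'I_N] by rewrite perm_sort.
  have tsz : size t = N by rewrite (perm_size tperm) size_map size_enum_ord.
  have tu : uniq t.
    rewrite (perm_uniq tperm) map_inj_uniq ?enum_uniq // => i j /ord_inj.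
    exact: finj.
  have tso : sorted gtn t.
    rewrite gtn_sorted_uniq_geq tu sort_sorted // => a b /=; exact: leq_total.
  have [nu [pnu snu] tE] := beta_of_decr tsz tso.
  have fjt j : (f j : nat) \in t.
    by rewrite (perm_mem tperm); apply/mapP; exists j; rewrite ?mem_enum.
  have idx j : (index (f j : nat) t < N)%N by have := fjt j; rewrite -index_mem tsz.
  have idxE j : beta nu N (index (f j : nat) t) = f j.
    rewrite -(nth_mkseq 0%N (beta nu N) (idx j)) -/(betas nu N) -tE nth_index //.
  have sinj : injective (fun j => Ordinal (idx j)).
    by move=> i j /(congr1 val) /= E; apply: finj; apply: ord_inj; rewrite -idxE E idxE.
  have nud : nu \in parts d.
    rewrite mem_parts pnu /= -(eqn_add2r (\sum_(j < N) (N - j.+1))) -(sum_beta snu) -Sf.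
    rewrite (reindex_inj sinj) /=; apply/eqP; apply: eq_bigr => j _; exact: idxE.
  exists (nu, perm sinj); split => //=; first by rewrite mem_enum.
  by apply/ffunP => j; apply: ord_inj; rewrite PhiE // permE /= idxE.
have lu : uniq l.
  apply: allpairs_uniq; [exact: parts_uniq|exact: enum_uniq|].
  move=> [nu s] [nu' s'] /allpairsP[[a b] /= [nud _ [-> ->]]] /allpairsP[[a' b'] /= [nud' _ [-> ->]]] E.
  have := nud; rewrite mem_parts => /andP[pa /eqP sa].
  have := nud'; rewrite mem_parts => /andP[pa' /eqP sa'].
  have Eb : betas a N = betas a' N.
    apply: (irr_sorted_eq gtn_transitive _ (betas_sorted N pa) (betas_sorted N pa')).
      by move=> y /=; rewrite ltnn.
    move=> y; apply/mapP/mapP; case=> i; rewrite mem_iota add0n => /= iN ->.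
      pose io := Ordinal iN; exists (b' ((b^-1)%g io)); first by rewrite mem_iota /= add0n ltn_ord.
      have := congr1 (fun f : {ffun 'I_N -> 'I_L} => f ((b^-1)%g io) : nat) E.
      by rewrite !PhiE // permKV.
    pose io := Ordinal iN; exists (b ((b'^-1)%g io)); first by rewrite mem_iota /= add0n ltn_ord.
    have := congr1 (fun f : {ffun 'I_N -> 'I_L} => f ((b'^-1)%g io) : nat) E.
    by rewrite !PhiE // permKV.
  have Eb' i : (i < N)%N -> beta a N i = beta a' N i.
    by move=> iN; rewrite -(nth_mkseq 0%N (beta a N) iN) -/(betas a N) Eb nth_mkseq.
  have aa : a = a'.
    apply: (part_ext pa pa' (szN _ nud) (szN _ nud')) => i iN.
    by have := Eb' i iN; rewrite /beta => /addIn.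
  rewrite -aa in E *; congr pair; apply/permP => j; apply: ord_inj.
  have := congr1 (fun f : {ffun 'I_N -> 'I_L} => f j : nat) E; rewrite !PhiE //.
  exact: beta_inj.
transitivity (\sum_(f <- l) G f).
  rewrite (big_uniq _ lu) [LHS]big_mkcond [RHS]big_mkcond; apply: eq_bigr => f _.
  rewrite lP; case: eqP => //= _; case: (boolP (injectiveb f)) => // /injectivePn [i [j ij E]].
  by rewrite /G (@alternant_alternate _ _ _ j i) ?mulr0 // 1?eq_sym // E.
rewrite /l big_allpairs_dep; apply: eq_big_seq => nu nud.
rewrite big_enum /= -det_tr /determinant mulr_sumr; apply: eq_bigr => s _.
rewrite /G; have -> : alternant x (fun j => Phi nu s j : nat) = (-1) ^+ s * alternant x (fun j : 'I_N => beta nu N j).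
  rewrite -(alternant_perm x (fun j : 'I_N => beta nu N j)); congr (\det _).
  by apply/matrixP => i j; rewrite !mxE PhiE.
rewrite mulrC [_ * alternant _ _]mulrC -mulrA; congr (_ * (_ * _)).
apply: eq_bigr => j _; rewrite !mxE PhiE // ifT //.
have := bL nu (s j) nud (ltn_ord _); lia.
Qed.

Lemma alternant_delta_neq0 N (x : nat -> F) :
  (forall i j, (i < N)%N -> (j < N)%N -> x i = x j -> i = j) ->
  alternant x (fun j : 'I_N => (N - j.+1)%N) != 0.
Proof.
move=> xinj.
have -> : alternant x (fun j : 'I_N => (N - j.+1)%N) =
   (-1) ^+ odd_perm (perm (@rev_ord_inj N)) * alternant x (fun j : 'I_N => j : nat).
  rewrite -alternant_perm; congr (\det _); apply/matrixP => i j.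
  by rewrite !mxE permE.
rewrite mulf_neq0 ?signr_eq0 //.
have -> : alternant x (fun j : 'I_N => j : nat) = \det (Vandermonde N (\row_(i < N) x i)).
  by rewrite /alternant -det_tr; congr (\det _); apply/matrixP => i j; rewrite !mxE.
rewrite det_Vandermonde; apply/prodf_neq0 => i _; apply/prodf_neq0 => j ij.
rewrite !mxE subr_eq0; apply/eqP => /xinj e.
by move: ij; rewrite e ?ltnn.
Qed.

Lemma dual_cauchy e D N d (x : nat -> F) : (d <= N)%N -> (N + d <= D)%N ->
  (forall i j, (i < N)%N -> (j < N)%N -> x i = x j -> i = j) ->
  (\prod_(i < N) gen_poly e D (x i))`_d =
  \sum_(nu <- parts d) schur nu N x * \det (beta_mx e nu N).
Proof.
move=> dN ND xinj; have a0 := alternant_delta_neq0 xinj.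
apply: (mulfI a0); rewrite dual_cauchy_alternant // mulr_sumr; apply: eq_bigr => nu _.
rewrite mulrA; congr (_ * _); rewrite /schur mulrC.
by rewrite -/(alternant x (fun j : 'I_N => (N - j.+1)%N)) divfK.
Qed.

End DualCauchy.

(** * Principal specializations *)

Section Determinants.
Variable F : fieldType.

(** The passage from powers to monic Newton polynomials is unitriangular. *)
Lemma det_newton N (y a : nat -> F) :
  \det (\matrix_(i < N, j < N) \prod_(m < N - j.+1) (y i - a m)) =
  \det (\matrix_(i < N, j < N) y i ^+ (N - j.+1)).
Proof.
pose H : 'M[F]_N := \matrix_(k, j) hsymB (rvars a (N - k.+1).+1) (N - j.+1) (N - k.+1).
have detH : \det H = 1.
  rewrite det_trig; last first.
    apply/is_trig_mxP => i j ij; rewrite mxE /hsymB ifN //.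
    by have := ltn_ord j; rewrite -ltnNge; lia.
  by apply: big1 => i _; rewrite mxE /hsymB leqnn subnn hsym0.
rewrite -[LHS]mulr1 -[X in _ * X]detH -det_mulmx; congr (\det _).
apply/matrixP => i j; rewrite !mxE (newton_interpolation a (y i) _ N).
rewrite [X in _ = _ + X](_ : _ = 0) ?addr0; last first.
  rewrite /hsymB ifN ?mulr0 // -ltnNge; have := ltn_ord j; lia.
rewrite [RHS](reindex_inj rev_ord_inj) /=.
by apply: eq_bigr => k _; rewrite !mxE.
Qed.

Lemma det_vandermonde_rev N (y : nat -> F) :
  \det (\matrix_(i < N, j < N) y i ^+ (N - j.+1)) =
  \prod_(i < N) \prod_(j < N | (i < j)%N) (y i - y j).
Proof.
pose p := perm (@rev_ord_inj N).
have -> : \matrix_(i < N, j < N) y i ^+ (N - j.+1) =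
    row_perm p (col_perm p (Vandermonde N (\row_(i < N) y (rev_ord i)))^T).
  by apply/matrixP => i j; rewrite !mxE !permE rev_ordK.
rewrite row_permE col_permE !det_mulmx !det_perm det_tr det_Vandermonde odd_permV.
rewrite mulrC -mulrA -expr2 sqrr_sign mulr1.
rewrite (exchange_big_dep predT) //= (reindex_inj rev_ord_inj) /=.
apply: eq_bigr => i _; rewrite (reindex_inj rev_ord_inj) /=.
apply: eq_big => [j|j _]; first by have := ltn_ord i; have := ltn_ord j; lia.
by rewrite !mxE /=; congr (y _ - y _); have := ltn_ord i; have := ltn_ord j; lia.
Qed.

Variable c : F.
Hypothesis c0 : c != 0.
Let u := c ^+ 2.
Hypothesis u_root : forall k, (0 < k)%N -> u ^+ k != 1.

Let u0 : u != 0. Proof. by rewrite expf_neq0. Qed.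

(* c stands for q^(-1/2): h_rho and e_rho are the complete and elementary
   symmetric functions at q^rho. *)
Definition qpoch (r : nat) : F := \prod_(k < r) (1 - u ^+ k.+1).
Definition h_rho (r : nat) : F := c ^+ r / qpoch r.
Definition e_rho (r : nat) : F := c ^+ (r ^ 2) / qpoch r.

Lemma one_subu k : (0 < k)%N -> 1 - u ^+ k != 0.
Proof. by move=> k0; rewrite subr_eq0 eq_sym u_root. Qed.

Lemma qpoch_neq0 r : qpoch r != 0.
Proof. by apply/prodf_neq0 => k _; apply: one_subu. Qed.

Lemma invu_sub a b : (b <= a)%N -> u^-1 ^+ b = u^-1 ^+ a * u ^+ (a - b).
Proof.
move=> ba; rewrite -[X in u^-1 ^+ X * _](subnK ba) exprD mulrAC -exprMn mulVf //.
by rewrite expr1n mul1r.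
Qed.

Lemma qpochB a d : (d <= a)%N -> qpoch a = qpoch (a - d) * \prod_(k < d) (1 - u ^+ (a - k)).
Proof.
elim: d => [|d IH] da; first by rewrite subn0 big_ord0 mulr1.
rewrite (IH (ltnW da)) big_ord_recr /= mulrCA mulrC; congr (_ * _).
by rewrite -(subnSK da) /qpoch big_ord_recr /= mulrC.
Qed.

(** Separates a from d: apart from a factor in a and a factor in d, the entry is a Newton polynomial
    of degree d in u^-a. That polynomial vanishes by itself when d > a, in agreement with the
    default 0 of [seqB]. *)
Lemma seqB_e_rho a d : seqB e_rho a d =
  c ^+ (a ^ 2) / qpoch a * c ^+ (d ^ 2) * \prod_(k < d) (u^-1 ^+ a - u^-1 ^+ k).
Proof.
rewrite /seqB; case: leqP => da; last first.
  by rewrite (bigD1 (Ordinal da)) //= subrr mul0r mulr0.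
rewrite /e_rho (qpochB da).
have -> : \prod_(k < d) (u^-1 ^+ a - u^-1 ^+ k) = (u^-1) ^+ (a * d) * \prod_(k < d) (1 - u ^+ (a - k)).
  have -> : (u^-1) ^+ (a * d) = \prod_(k < d) u^-1 ^+ a by rewrite prodr_const card_ord exprM.
  rewrite -big_split /=.
  apply: eq_bigr => k _; have ka : (k <= a)%N by apply: leq_trans da; apply: ltnW.
  rewrite mulrBr mulr1; congr (_ - _).
  exact: invu_sub.
have n1 := qpoch_neq0 (a - d).
have n2 : \prod_(k < d) (1 - u ^+ (a - k)) != 0.
  by apply/prodf_neq0 => k _; apply: one_subu; have := ltn_ord k; lia.
(* Since u = c^2, this is a^2 = (a - d)^2 + 2 a d - d^2. *)
have -> : c ^+ (a ^ 2) = c ^+ ((a - d) ^ 2) * u ^+ (a * d) / c ^+ (d ^ 2).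
  rewrite /u -exprM -exprD; apply: (mulIf (expf_neq0 (d ^ 2) c0)).
  by rewrite divfK ?expf_neq0 // -exprD; congr (_ ^+ _); rewrite !expnS !expn0 !muln1; nia.
rewrite exprVn; have n3 := expf_neq0 (d ^ 2) c0; have n4 := expf_neq0 (a * d) u0.
set A := qpoch _ in n1 *; set B := \prod_(k < d) _ in n2 *; set X := c ^+ _ in n3 *.
by set Y := u ^+ _ in n4 *; set Z := c ^+ _; field; rewrite n1 n2 n3 n4.
Qed.

Lemma seqB_h_rho a d : seqB h_rho a d =
  c ^+ a / qpoch a * (c ^- d * \prod_(k < d) (- u^-1 ^+ k)) * \prod_(k < d) (u ^+ a - u ^+ k).
Proof.
rewrite /seqB; case: leqP => da; last first.
  by rewrite [X in _ = _ * X](bigD1 (Ordinal da)) //= subrr mul0r mulr0.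
rewrite /h_rho (qpochB da) -[RHS]mulrA -[in RHS](mulrA (c ^- d)) -big_split /=.
have -> : \prod_(k < d) (- u^-1 ^+ k * (u ^+ a - u ^+ k)) = \prod_(k < d) (1 - u ^+ (a - k)).
  apply: eq_bigr => k _; have ka : (k <= a)%N by apply: leq_trans da; apply: ltnW.
  rewrite mulrBr !mulNr opprK addrC -exprMn mulVf // expr1n; congr (_ - _).
  by rewrite -{1}(subnK ka) exprD mulrCA -exprMn mulVf // expr1n mulr1.
have n1 := qpoch_neq0 (a - d).
have n2 : \prod_(k < d) (1 - u ^+ (a - k)) != 0.
  by apply/prodf_neq0 => k _; apply: one_subu; have := ltn_ord k; lia.
rewrite -[X in c ^+ X / (_ * _)](subnK da) exprD; have n3 := expf_neq0 d c0.
set A := qpoch _ in n1 *; set B := \prod_(k < d) _ in n2 *; set X := c ^+ d in n3 *.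
by set Z := c ^+ _; field; rewrite n1 n2 n3.
Qed.

(* The pairs s > t with s in the beta set and t outside it are the boxes of nu,
   and s - t is the hook length. *)
Definition hook_prod nu N : F :=
  \prod_(s <- betas nu N) \prod_(t < s | (t : nat) \notin betas nu N) (1 - u ^+ (s - t)).

Lemma hook_prod_neq0 nu N : hook_prod nu N != 0.
Proof.
rewrite /hook_prod prodf_seq_neq0; apply/allP => s _ /=; apply/prodf_neq0 => t _.
by apply: one_subu; rewrite subn_gt0.
Qed.

Lemma beta_ltE nu N i j : is_part nu -> (i < N)%N -> (j < N)%N ->
  (beta nu N j < beta nu N i)%N = (i < j)%N.
Proof.
move=> pnu iN jN; case: (ltngtP i j) => ij.
- by rewrite beta_lt // ij jN.
- by apply/negbTE; rewrite -leqNgt ltnW // beta_lt // ij iN.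
- by rewrite ij ltnn.
Qed.

Lemma mem_betas nu N t : reflect (exists2 i, (i < N)%N & t = beta nu N i) (t \in betas nu N).
Proof.
apply: (iffP mapP) => -[i h ->]; exists i => //; first by move: h; rewrite mem_iota.
by rewrite mem_iota.
Qed.

Lemma big_betas nu N (g : nat -> F) :
  \prod_(s <- betas nu N) g s = \prod_(i < N) g (beta nu N i).
Proof.
rewrite /betas /mkseq big_map -(big_mkord predT (fun i => g (beta nu N i))).
by rewrite /index_iota subn0.
Qed.

(** For t < beta_i the differences beta_i - t run over 1, ..., beta_i. Those with t outside the beta
    set are the hook lengths of row i, the others are the Vandermonde differences. *)
Lemma prod_qpoch_betas nu N : is_part nu ->
  \prod_(i < N) qpoch (beta nu N i) =
  hook_prod nu N * \prod_(i < N) \prod_(j < N | (i < j)%N) (1 - u ^+ (beta nu N i - beta nu N j)).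
Proof.
move=> pnu; rewrite /hook_prod big_betas -big_split /=; apply: eq_bigr => i _.
have -> : qpoch (beta nu N i) = \prod_(t < beta nu N i) (1 - u ^+ (beta nu N i - t)).
  rewrite /qpoch (reindex_inj rev_ord_inj) /=; apply: eq_bigr => t _.
  by congr (1 - u ^+ _); have := ltn_ord t; lia.
rewrite (bigID (fun t : 'I_(beta nu N i) => (t : nat) \notin betas nu N)) /=; congr (_ * _).
pose f t := 1 - u ^+ (beta nu N i - t).
rewrite -/(f _) (eq_bigl (fun t : 'I_(beta nu N i) => (t : nat) \in betas nu N)); last first.
  by move=> t; rewrite negbK.
rewrite -(big_mkord (fun t => t \in betas nu N) f) -big_filter.
transitivity (\prod_(t <- [seq beta nu N j | j <- [seq j <- iota 0 N | (i < j)%N]]) f t); last first.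
  rewrite big_map big_filter -{1}[N]subn0 -/(index_iota 0 N) big_mkord //.
apply: perm_big; apply: uniq_perm; first by rewrite filter_uniq ?iota_uniq.
  rewrite map_inj_in_uniq ?filter_uniq ?iota_uniq // => j k.
  by rewrite !mem_filter !mem_iota => /andP[_ jN] /andP[_ kN]; apply: beta_inj.
move=> t; rewrite mem_filter mem_index_iota /=.
apply/andP/mapP => [[/mem_betas[j jN ->]]|[j]].
  by rewrite beta_ltE // => ij; exists j; rewrite // mem_filter ij mem_iota.
rewrite mem_filter mem_iota /= => /andP[ij jN] ->; rewrite beta_ltE //; split=> //.
by apply/mem_betas; exists j.
Qed.

Lemma prod_lt_swap N (f : nat -> F) :
  \prod_(i < N) \prod_(j < N | (i < j)%N) f j = \prod_(j < N) f j ^+ j.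
Proof.
rewrite (exchange_big_dep predT) //=; apply: eq_bigr => j _.
rewrite prodr_const; congr (_ ^+ _).
have le : (j <= N)%N by apply: ltnW.
rewrite -[RHS]card_ord -(card_imset (f := widen_ord le)) => [|x y /(congr1 val) /= /val_inj //].
apply: eq_card => x; rewrite [LHS]unfold_in; apply/idP/imsetP => [xm|[y _ ->] /=].
  by exists (Ordinal xm) => //; apply: val_inj.
exact: ltn_ord.
Qed.

Lemma prod_lt_const N (f : nat -> F) :
  \prod_(i < N) \prod_(j < N | (i < j)%N) f i = \prod_(i < N) f i ^+ (N - i.+1).
Proof.
rewrite (reindex_inj rev_ord_inj) [RHS](reindex_inj rev_ord_inj) /=.
have := prod_lt_swap N (fun j => f (N - j.+1)%N).
rewrite (exchange_big_dep predT) //= => E.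
transitivity (\prod_(j < N) f (N - j.+1)%N ^+ j).
  rewrite -E; apply: eq_bigr => i _; rewrite (reindex_inj rev_ord_inj) /=.
  by apply: eq_bigl => j; have := ltn_ord i; have := ltn_ord j; lia.
by apply: eq_bigr => i _; congr (_ ^+ _); have := ltn_ord i; lia.
Qed.

(** Removing the row and column factors of the separated entries leaves a Vandermonde determinant in
    u^-beta_i, whose differences cancel against the product of the [qpoch] and leave the hook
    product. *)
Lemma det_e_rho nu N : is_part nu ->
  \det (beta_mx e_rho nu N) = \prod_(i < N) c ^+ (nth 0%N nu i ^ 2) / hook_prod nu N.
Proof.
move=> pnu; pose al := beta nu N.
pose A i := c ^+ (al i ^ 2) / qpoch (al i); pose B j := c ^+ ((N - j.+1) ^ 2).
have -> : \det (beta_mx e_rho nu N) = \prod_(i < N) A i * \prod_(i < N) B i *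
    \prod_(i < N) \prod_(j < N | (i < j)%N) (u^-1 ^+ al i - u^-1 ^+ al j).
  rewrite -(det_vandermonde_rev N (fun i => u^-1 ^+ al i)).
  rewrite -(det_newton N (fun i => u^-1 ^+ al i) (fun k => u^-1 ^+ k)).
  transitivity (\det (diag_mx (\row_(i < N) A i) *m
     (\matrix_(i < N, j < N) \prod_(m < N - j.+1) (u^-1 ^+ al i - u^-1 ^+ m)) *m
     diag_mx (\row_(j < N) B j))).
    congr (\det _); apply/matrixP => i j; rewrite mul_mx_diag mul_diag_mx !mxE seqB_e_rho.
    by rewrite mulrAC.
  rewrite !det_mulmx !det_diag mulrAC; congr (_ * _ * _).
    by apply: eq_bigr => i _; rewrite mxE.
  by apply: eq_bigr => i _; rewrite mxE.
have -> : \prod_(i < N) \prod_(j < N | (i < j)%N) (u^-1 ^+ al i - u^-1 ^+ al j) =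
   \prod_(i < N) (u^-1 ^+ al i) ^+ (N - i.+1) *
   \prod_(i < N) \prod_(j < N | (i < j)%N) (1 - u ^+ (al i - al j)).
  rewrite -(prod_lt_const N (fun i => u^-1 ^+ al i)) -big_split /=; apply: eq_bigr => i _.
  rewrite -big_split /=; apply: eq_bigr => j ij.
  have jl : (al j <= al i)%N by rewrite ltnW // /al beta_ltE.
  rewrite mulrBr mulr1; congr (_ - _).
  exact: invu_sub.
have := prod_qpoch_betas N pnu; rewrite -/al => E.
rewrite /A big_split /= prodfV E.
set P := \prod_(i < N) \prod_(j < N | (i < j)%N) _.
have P0 : P != 0.
  apply/prodf_neq0 => i _; apply/prodf_neq0 => j ij.
  by apply: one_subu; rewrite subn_gt0 /al beta_ltE.
(* With b = N - i - 1 the exponents at i are (nu_i + b)^2 + b^2 - 2 (nu_i + b) b = nu_i^2. *)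
have -> : \prod_(i < N) c ^+ (nth 0%N nu i ^ 2) =
   \prod_(i < N) c ^+ (al i ^ 2) * \prod_(i < N) B i * \prod_(i < N) (u^-1 ^+ al i) ^+ (N - i.+1).
  rewrite -!big_split /=; apply: eq_bigr => i _.
  rewrite /B -exprM exprVn /u -exprM -exprD; apply: (mulIf (expf_neq0 (2 * (al i * (N - i.+1))) c0)).
  rewrite divfK ?expf_neq0 // -exprD; congr (_ ^+ _).
  by rewrite /al /beta; move: (N - i.+1)%N (nth _ _ _) => a b; rewrite !expnS !expn0 !muln1; nia.
have H0 := hook_prod_neq0 nu N.
set X := \prod_(i < N) c ^+ _; set Y := \prod_(i < N) B i; set Z := \prod_(i < N) _ ^+ _.
by move: P0 H0; set H := hook_prod _ _ => P0 H0; field; rewrite P0 H0.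
Qed.

Lemma det_h_rho nu N : is_part nu ->
  \det (beta_mx h_rho nu N) = \prod_(i < N) c ^+ (i.*2.+1 * nth 0%N nu i) / hook_prod nu N.
Proof.
move=> pnu; pose al := beta nu N.
pose A i := c ^+ al i / qpoch (al i).
pose B j := c ^- (N - j.+1) * \prod_(k < N - j.+1) (- u^-1 ^+ k).
have -> : \det (beta_mx h_rho nu N) = \prod_(i < N) A i * \prod_(i < N) B i *
    \prod_(i < N) \prod_(j < N | (i < j)%N) (u ^+ al i - u ^+ al j).
  rewrite -(det_vandermonde_rev N (fun i => u ^+ al i)).
  rewrite -(det_newton N (fun i => u ^+ al i) (fun k => u ^+ k)).
  transitivity (\det (diag_mx (\row_(i < N) A i) *m
     (\matrix_(i < N, j < N) \prod_(m < N - j.+1) (u ^+ al i - u ^+ m)) *m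
     diag_mx (\row_(j < N) B j))).
    congr (\det _); apply/matrixP => i j; rewrite mul_mx_diag mul_diag_mx !mxE seqB_h_rho.
    by rewrite mulrAC.
  rewrite !det_mulmx !det_diag mulrAC; congr (_ * _ * _).
    by apply: eq_bigr => i _; rewrite mxE.
  by apply: eq_bigr => i _; rewrite mxE.
have -> : \prod_(i < N) \prod_(j < N | (i < j)%N) (u ^+ al i - u ^+ al j) =
   \prod_(i < N) (- u ^+ al i) ^+ i *
   \prod_(i < N) \prod_(j < N | (i < j)%N) (1 - u ^+ (al i - al j)).
  rewrite -(prod_lt_swap N (fun i => - u ^+ al i)) -big_split /=; apply: eq_bigr => i _.
  rewrite -big_split /=; apply: eq_bigr => j ij.
  have jl : (al j <= al i)%N by rewrite ltnW // /al beta_ltE.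
  by rewrite mulrBr mulr1 mulNr opprK -exprD subnKC // addrC.
have := prod_qpoch_betas N pnu; rewrite -/al => E.
rewrite /A big_split /= prodfV E.
set P := \prod_(i < N) \prod_(j < N | (i < j)%N) _.
have P0 : P != 0.
  apply/prodf_neq0 => i _; apply/prodf_neq0 => j ij.
  by apply: one_subu; rewrite subn_gt0 /al beta_ltE.
have EB : \prod_(i < N) B i = \prod_(i < N) (c ^- (N - i.+1) * (- u^-1 ^+ (N - i.+1)) ^+ i).
  rewrite /B big_split [RHS]big_split /=; congr (_ * _).
  rewrite -(prod_lt_swap N (fun j => - u^-1 ^+ (N - j.+1))); apply: eq_bigr => i _.
  rewrite -(big_mkord predT (fun k => - u^-1 ^+ k)).
  rewrite -(big_mkord (fun j => i < j)%N (fun j => - u^-1 ^+ (N - j.+1))).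
  rewrite [RHS](@big_cat_nat _ _ _ i.+1) //= [X in _ = X * _]big1_seq ?mul1r; last first.
    by move=> k /andP[ik]; rewrite mem_index_iota; lia.
  have := @big_addn F 1 *%R 0%N N i.+1 (fun j => i < j)%N (fun j => - u^-1 ^+ (N - j.+1)).
  rewrite add0n => ->; rewrite big_nat_rev /= add0n.
  rewrite big_nat_cond [RHS]big_nat_cond; apply: eq_big => [k|k /andP[/andP[_ kN] _]].
    by rewrite !andbT; lia.
  by congr (- _ ^+ _); lia.
(* With b = N - i - 1, the exponents at i are (nu_i + b) - b + 2 i nu_i: the powers u^(b i) and the
   signs cancel between the last two products. *)
have -> : \prod_(i < N) c ^+ (i.*2.+1 * nth 0%N nu i) =
   \prod_(i < N) c ^+ al i * \prod_(i < N) B i * \prod_(i < N) (- u ^+ al i) ^+ i.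
  rewrite EB -!big_split /=; apply: eq_bigr => i _.
  rewrite -[RHS]mulrA -[in RHS](mulrA (c ^- _)) -exprMn mulrNN -[u ^+ al i]/(u ^+ (nth 0%N nu i + (N - i.+1))) exprD.
  rewrite (mulrCA (u^-1 ^+ _)) -[u^-1 ^+ _ * _]exprMn mulVf // expr1n mulr1 /al /beta exprD -!exprM.
  have := expf_neq0 (N - i.+1) c0; set X := c ^+ (N - i.+1) => X0.
  rewrite mulrA mulfK // -exprD; congr (_ ^+ _); rewrite -mul2n; nia.
have H0 := hook_prod_neq0 nu N.
set X := \prod_(i < N) c ^+ _; set Y := \prod_(i < N) B i; set Z := \prod_(i < N) _ ^+ _.
by move: P0 H0; set H := hook_prod _ _ => P0 H0; field; rewrite P0 H0.
Qed.

End Determinants.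

(** * Conjugate partitions, beta sets and hook lengths *)

Section Conjugate.
Variable nu : seq nat.
Hypothesis nu_part : is_part nu.

Lemma nth_conj_part j : nth 0%N (conj_part nu) j = count (leq j.+1) nu.
Proof.
rewrite /conj_part; case: (ltnP j (head 0%N nu)) => h.
  by rewrite (nth_map 0%N) ?size_iota // nth_iota // add1n.
rewrite nth_default ?size_map ?size_iota //; apply/esym/eqP.
rewrite -leqn0 leqNgt -has_count; apply/hasPn => x xnu; rewrite -ltnNge ltnS.
apply: leq_trans h; rewrite -nth0.
by have := part_nth_le nu_part (leq0n (index x nu)); rewrite nth_index.
Qed.

Lemma lt_conj_part i j : (j < nth 0 nu i)%N = (i < nth 0 (conj_part nu) j)%N.
Proof.
rewrite nth_conj_part; case/andP: nu_part => + _; elim: nu i => [|x s IH] i ps.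
  by rewrite nth_nil.
have pss := path_sorted ps; have gt : transitive geq by move=> a b d /= h1 h2; apply: leq_trans h2 h1.
have := order_path_min gt ps => /allP xs /=.
case: (ltnP j x) => jx; first by case: i => [|i] /=; rewrite ?add1n ?ltnS ?jx // IH.
have -> : count (leq j.+1) s = 0%N.
  apply/eqP; rewrite -leqn0 leqNgt -has_count; apply/hasPn => y ys.
  by rewrite -ltnNge ltnS; apply: leq_trans jx; exact: xs.
rewrite ltn0; apply/negbTE; rewrite -leqNgt; case: i => [//|i] /=.
case: (ltnP i (size s)) => it; last by rewrite nth_default.
by apply: leq_trans jx; apply: xs; apply: mem_nth.
Qed.

Lemma size_conj_part : size (conj_part nu) = nth 0%N nu 0.
Proof. by rewrite size_map size_iota nth0. Qed.

Lemma conj_part_is_part : is_part (conj_part nu).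
Proof.
apply/andP; split.
  apply/(sortedP 0%N) => j _; rewrite !nth_conj_part /=.
  by apply: sub_count => x /= h; apply: ltnW.
apply/(all_nthP 0%N) => j; rewrite size_conj_part => h.
by have := lt_conj_part 0 j; rewrite h => <-.
Qed.

Lemma conj_part_le N j : (size nu <= N)%N -> (nth 0 (conj_part nu) j <= N)%N.
Proof. by move=> s; rewrite nth_conj_part; apply: leq_trans (count_size _ _) s. Qed.

Lemma part_le_conj M i : (size (conj_part nu) <= M)%N -> (nth 0 nu i <= M)%N.
Proof.
by rewrite size_conj_part; apply: leq_trans; apply: part_nth_le.
Qed.

Variables (N M : nat).
Hypotheses (nuN : (size nu <= N)%N) (nuM : (size (conj_part nu) <= M)%N).

(** nu_i^2 = 1 + 3 + ... + (2 nu_i - 1) puts the odd number 2 j + 1 into each box of column j; the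
    right side adds by columns. *)
Lemma sum_sq_conj : (\sum_(i < N) nth 0 nu i ^ 2 =
  \sum_(j < M) j.*2.+1 * nth 0 (conj_part nu) j)%N.
Proof.
transitivity (\sum_(i < N) \sum_(j < M | (j < nth 0 nu i)%N) j.*2.+1)%N.
  apply: eq_bigr => i _; have := part_le_conj i nuM; move: (nth _ _ _) => m mM.
  rewrite -(big_ord_widen_cond M predT (fun j => j.*2.+1) mM) /=.
  elim: m {mM} => [|m IH]; first by rewrite big_ord0.
  by rewrite big_ord_recr /= -IH -addnn; nia.
rewrite (exchange_big_dep predT) //=; apply: eq_bigr => j _.
have le := conj_part_le j nuN.
rewrite (eq_bigl (fun i : 'I_N => i < nth 0 (conj_part nu) j)%N) => [|i]; last first.
  exact: lt_conj_part.
rewrite -(big_ord_widen_cond N predT (fun=> j.*2.+1) le) /=.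
by rewrite sum_nat_const card_ord mulnC.
Qed.

Lemma card_betas mu K L : is_part mu -> (forall i, (i < K)%N -> (beta mu K i < L)%N) ->
  #|[set x : 'I_L | (x : nat) \in betas mu K]| = K.
Proof.
move=> pmu H; rewrite -[RHS]card_ord -(card_imset (f := fun i : 'I_K => Ordinal (H i (ltn_ord i)))).
  apply: eq_card => x; rewrite inE; apply/mem_betas/imsetP => [[i iK e]|[i _ ->]].
    by exists (Ordinal iK) => //; apply: ord_inj.
  by exists i.
by move=> i j /(congr1 val) /= /(beta_inj pmu (ltn_ord _) (ltn_ord _)) /ord_inj.
Qed.

(** The Maya diagram of the conjugate: in {0, ..., N + M - 1}, the beta set of nu and the reflected
    beta set of its conjugate are disjoint and have N and M elements, hence are complementary. *)
Lemma betas_conj (x : 'I_(N + M)) :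
  ((rev_ord x : nat) \in betas (conj_part nu) M) = ((x : nat) \notin betas nu N).
Proof.
pose A := [set x : 'I_(N + M) | (x : nat) \in betas nu N].
pose B0 := [set x : 'I_(N + M) | (x : nat) \in betas (conj_part nu) M].
pose B := (@rev_ord (N + M)) @^-1: B0.
have cA : #|A| = N.
  apply: card_betas => // i iN; have := part_le_conj i nuM; rewrite /beta; lia.
have cB : #|B| = M.
  rewrite on_card_preimset; last first.
    by exists (@rev_ord (N + M)) => y _; rewrite rev_ordK.
  apply: card_betas; first exact: conj_part_is_part.
  by move=> j jM; have := conj_part_le j nuN; rewrite /beta; lia.
(* A common element would give nu_i + nu^t_j = i + j + 1, whereas j < nu_i and i < nu^t_j hold
   together or fail together. *)
have dAB : [disjoint A & B].
  apply/pred0P => y /=; apply/negbTE/negP => /andP[]; rewrite !inE /=.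
  move=> /mem_betas[i iN e1] /mem_betas[j jM e2].
  have := lt_conj_part i j; have := ltn_ord y; move: e1 e2; rewrite /beta; lia.
have E : A :|: B = [set: 'I_(N + M)].
  apply/eqP; rewrite eqEcard finset.subsetT cardsT card_ord cardsU cA cB.
  by move: dAB; rewrite -finset.setI_eq0 => /eqP ->; rewrite cards0 subn0 leqnn.
have : x \in A :|: B by rewrite E inE.
have := pred0P dAB x; rewrite /= !inE /=.
by case: (_ \in _); case: (_ \in _).
Qed.

Variables (F : fieldType) (c : F).

Lemma hook_prodE mu K L : is_part mu -> (forall i, (i < K)%N -> (beta mu K i < L)%N) ->
  hook_prod c mu K = \prod_(s < L | (s : nat) \in betas mu K)
    \prod_(t < L | ((t : nat) \notin betas mu K) && (t < s)%N) (1 - (c ^+ 2) ^+ (s - t)).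
Proof.
move=> pmu H; rewrite /hook_prod.
pose g s := \prod_(t < s | (t : nat) \notin betas mu K) (1 - (c ^+ 2) ^+ (s - t)).
transitivity (\prod_(s <- betas mu K) g s); first by [].
transitivity (\prod_(s <- iota 0 L | s \in betas mu K) g s).
  rewrite -[RHS]big_filter; apply: perm_big; apply: uniq_perm.
  - exact: betas_uniq.
  - by rewrite filter_uniq ?iota_uniq.
  move=> s; rewrite mem_filter mem_iota /= add0n.
  by apply/idP/andP => [h|[]//]; split=> //; have /mem_betas[i iK ->] := h; apply: H.
have -> : iota 0 L = index_iota 0 L by rewrite /index_iota subn0.
rewrite big_mkord; apply: eq_bigr => s _; rewrite /g.
by rewrite (big_ord_widen_cond L (fun t => t \notin betas mu K) (fun t => 1 - (c ^+ 2) ^+ (s - t))) // ltnW.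
Qed.

(** The reflection exchanges membership with non-membership and reverses order, so it preserves the
    pairs s > t and their differences. *)
Lemma hook_prod_conj : hook_prod c nu N = hook_prod c (conj_part nu) M.
Proof.
rewrite (@hook_prodE nu N (N + M)) //; last first.
  by move=> i iN; have := part_le_conj i nuM; rewrite /beta; lia.
rewrite (@hook_prodE (conj_part nu) M (N + M)) ?conj_part_is_part //; last first.
  by move=> j jM; have := conj_part_le j nuN; rewrite /beta; lia.
rewrite (exchange_big_dep (fun t : 'I_(N + M) => (t : nat) \notin betas nu N)) /=; last first.
  by move=> s t _ /andP[].
rewrite (reindex_inj rev_ord_inj) /=; apply: eq_big => [t|t ht].
  by have := betas_conj (rev_ord t); rewrite rev_ordK => ->.
rewrite (reindex_inj rev_ord_inj) /=; apply: eq_big => [s|s _].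
  have e : ((rev_ord s : nat) \in betas nu N) = ((s : nat) \notin betas (conj_part nu) M).
    by rewrite -{2}(rev_ordK s) betas_conj negbK.
  rewrite -[(N + M - s.+1)%N]/(rev_ord s : nat) -[(N + M - t.+1)%N]/(rev_ord t : nat) in ht *.
  by rewrite e ht /=; congr (_ && _); have := ltn_ord s; have := ltn_ord t; lia.
by congr (1 - _ ^+ _); have := ltn_ord s; have := ltn_ord t; lia.
Qed.

Hypothesis c0 : c != 0.
Hypothesis u_root : forall k, (0 < k)%N -> (c ^+ 2) ^+ k != 1.

Lemma det_e_rho_conj :
  \det (beta_mx (e_rho c) nu N) = \det (beta_mx (h_rho c) (conj_part nu) M).
Proof.
rewrite det_e_rho // det_h_rho ?conj_part_is_part // hook_prod_conj; congr (_ / _).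
by rewrite !prodrXr sum_sq_conj.
Qed.

End Conjugate.

(** * The sum over nu as a coefficient of a generating function *)

Section GeneratingFunction.
Variable F : fieldType.

Definition eq_upto (D : nat) (p q : {poly F}) := forall r, (r <= D)%N -> p`_r = q`_r.

Lemma eq_upto_mul D p q p' q' : eq_upto D p p' -> eq_upto D q q' -> eq_upto D (p * q) (p' * q').
Proof.
move=> ep eq r rD; rewrite !coefM; apply: eq_bigr => i _.
by rewrite ep ?eq //; have := ltn_ord i; lia.
Qed.

Lemma eq_upto_prod D N (p q : nat -> {poly F}) : (forall i, eq_upto D (p i) (q i)) ->
  eq_upto D (\prod_(i < N) p i) (\prod_(i < N) q i).
Proof.
move=> e; elim: N => [|N IH]; first by rewrite !big_ord0.
by rewrite !big_ord_recr; apply: eq_upto_mul.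
Qed.

Variable c : F.
Hypothesis c0 : c != 0.
Let u := c ^+ 2.
Hypothesis u_root : forall k, (0 < k)%N -> u ^+ k != 1.
Let u0 : u != 0. Proof. by rewrite expf_neq0. Qed.

(** As power series, E(y T) is the product of 1 + y c u^i T over i >= 0, and y / u prepends the
    factor of index -1. The truncation of [gen_poly] restricts this to degrees up to D. *)
Lemma gen_poly_shift D y :
  eq_upto D (gen_poly (e_rho c) D (y / u))
            ((1 + (y * c / u) *: 'X) * gen_poly (e_rho c) D y).
Proof.
move=> r rD; rewrite mulrDl mul1r -scalerAl coefD coefZ coefXM !coef_poly !ltnS rD.
case: r rD => [|r] rD /=; first by rewrite mulr0 addr0 !expr0.
rewrite (ltnW rD); have n1 := qpoch_neq0 u_root r.
have n2 : 1 - u ^+ r.+1 != 0 by rewrite subr_eq0 eq_sym u_root.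
have n3 : u ^+ r != 0 by rewrite expf_neq0.
rewrite /e_rho /qpoch big_ord_recr /= -/(qpoch c r) -/u.
have -> : c ^+ (r.+1 ^ 2) = c ^+ (r ^ 2) * u ^+ r * c.
  by rewrite /u -exprM -exprD -exprSr; congr (_ ^+ _); rewrite !expnS !expn0; nia.
have -> : (y / u) ^+ r.+1 = y ^+ r.+1 / u ^+ r.+1 by rewrite exprMn exprVn.
have cu : c / u = c^-1 by rewrite /u expr2 invfM mulrA divff ?mul1r.
rewrite [u ^+ r.+1]exprS in n2 *; rewrite -(mulrA y c) cu [y ^+ r.+1]exprS.
set X := c ^+ _; set Y := y ^+ r.
move: n1 n2 n3; set A := qpoch c r; set V := u ^+ r => n1 n2 n3.
have uE : u = c ^+ 2 by [].
clearbody A V X Y u; subst u.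
by field; rewrite n1 n2 n3 c0.
Qed.

(* q^(mu + rho), with c = q^(-1/2) *)
Definition x_rho (mu : seq nat) (i : nat) : F := c * u ^+ i / u ^+ nth 0%N mu i.

Lemma x_rho_inj mu i j : is_part mu -> x_rho mu i = x_rho mu j -> i = j.
Proof.
move=> pmu; wlog ij : i j / (i <= j)%N.
  by move=> H e; case: (leqP i j) => [ij|/ltnW ij]; [apply: H|apply/esym/H].
rewrite /x_rho -!mulrA => /(mulfI c0) e; apply/eqP; rewrite eqn_leq ij leqNgt.
apply/negP => lt; have := part_nth_le pmu ij; set m := nth _ _ i; set k := nth _ _ j => km.
have /negP := u_root (k := j - i + (m - k)) ltac:(lia); apply.
move/eqP: e; rewrite eqr_div ?expf_neq0 // -!exprD => /eqP e.
apply/eqP; apply: (mulIf (expf_neq0 (i + k) u0)); rewrite mul1r -exprD e.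
by congr (_ ^+ _); lia.
Qed.

(** With u = 1 / q, the ratio u^i / u^k is q^content of the box in row i and column k. *)
Definition box_poly (mu : seq nat) (N : nat) : {poly F} :=
  \prod_(i < N) \prod_(k < nth 0%N mu i) (1 + (u ^+ i / u ^+ k) *: 'X).

Lemma box_poly_size mu N : (size mu <= N)%N -> box_poly mu N = box_poly mu (size mu).
Proof.
move=> sN; rewrite /box_poly.
rewrite (big_ord_widen_cond N predT (fun i => \prod_(k < nth 0%N mu i) (1 + (u ^+ i / u ^+ k) *: 'X)) sN).
rewrite [RHS]big_mkcond /=; apply: eq_bigr => i _.
by case: ltnP => // h; rewrite nth_default // big_ord0.
Qed.

(** mu_i shifts lead from the variable of the empty partition to that of mu, each contributing the
    factor of one box of row i. *)
Lemma gen_poly_x_rho D mu i :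
  eq_upto D (gen_poly (e_rho c) D (x_rho mu i))
    (\prod_(k < nth 0%N mu i) (1 + (u ^+ i / u ^+ k) *: 'X) * gen_poly (e_rho c) D (x_rho [::] i)).
Proof.
rewrite /x_rho nth_nil expr0 divr1; elim: (nth 0%N mu i) => [|m IH].
  by rewrite big_ord0 mul1r expr0 divr1.
rewrite exprSr invfM mulrA big_ord_recr /= => r rD.
rewrite gen_poly_shift // [\prod_(k < m) _ * _]mulrC -mulrA.
have cu : c / u = c^-1 by rewrite /u expr2 invfM mulrA divff ?mul1r.
have -> : c * u ^+ i / u ^+ m * (c / u) = u ^+ i / u ^+ m.
  have n3 : u ^+ m != 0 by rewrite expf_neq0.
  by rewrite cu; field; rewrite n3 c0.
rewrite -(mulrA (1 + (u ^+ i / u ^+ m) *: 'X)); exact: eq_upto_mul rD.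
Qed.

(* s_lam(q^rho), by Jacobi-Trudi. *)
Definition w_rho (lam : seq nat) : F := \det (beta_mx (h_rho c) lam (size lam)).

(** Valid already for N variables: dual Cauchy makes both sums coefficients of products of
    generating polynomials, which differ by the factor [box_poly]. *)
Lemma conifold_sum mu d N : is_part mu -> (size mu <= N)%N -> (d <= N)%N ->
  \sum_(nu <- parts d) schur nu N (x_rho mu) * w_rho (conj_part nu) =
  \sum_(j < d.+1) (box_poly mu (size mu))`_j *
     \sum_(nu <- parts (d - j)) schur nu N (x_rho [::]) * w_rho (conj_part nu).
Proof.
move=> pmu sN dN; pose D := (N + N)%N.
have key mu' d' : is_part mu' -> (d' <= N)%N ->
    \sum_(nu <- parts d') schur nu N (x_rho mu') * w_rho (conj_part nu) =
    (\prod_(i < N) gen_poly (e_rho c) D (x_rho mu' i))`_d'.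
  move=> pmu' dN'; rewrite dual_cauchy //; last 2 first.
  - by rewrite /D; lia.
  - by move=> i j _ _; apply: x_rho_inj.
  rewrite big_seq [RHS]big_seq; apply: eq_bigr => nu; rewrite mem_parts => /andP[pnu /eqP sd].
  congr (_ * _); rewrite /w_rho -(@det_e_rho_conj nu pnu N) //.
  by apply: leq_trans dN'; rewrite -sd part_size_le.
rewrite key //.
have E : eq_upto D (\prod_(i < N) gen_poly (e_rho c) D (x_rho mu i))
    (box_poly mu (size mu) * \prod_(i < N) gen_poly (e_rho c) D (x_rho [::] i)).
  rewrite -(box_poly_size sN) /box_poly -big_split /=.
  apply: (@eq_upto_prod D N (fun i => gen_poly (e_rho c) D (x_rho mu i))
    (fun i => \prod_(k < nth 0%N mu i) (1 + (u ^+ i / u ^+ k) *: 'X) *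
      gen_poly (e_rho c) D (x_rho [::] i))) => i.
  exact: gen_poly_x_rho.
rewrite E; last by rewrite /D; lia.
rewrite coefM; apply: eq_bigr => j _; rewrite key //.
by apply: leq_trans dN; rewrite leq_subr.
Qed.

Lemma gauss_binomial n (y : F) :
  \prod_(m < n) (1 + (u ^+ m * y) *: 'X) =
  \poly_(r < n.+1) (u ^+ 'C(r, 2) * qpoch c n / (qpoch c r * qpoch c (n - r)) * y ^+ r).
Proof.
have q0 := qpoch_neq0 u_root.
elim: n => [|n IH].
  rewrite big_ord0; apply/polyP => -[|r]; rewrite coef_poly coefC //= /qpoch !big_ord0.
  by rewrite (_ : 'C(0, 2) = 0%N) // !expr0 !mulr1 invr1 mulr1.
rewrite big_ord_recr /= IH; apply/polyP => r.
rewrite mulrDr mulr1 -scalerAr coefD coefZ coefMX !coef_poly.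
have qS k : qpoch c k.+1 = qpoch c k * (1 - u ^+ k.+1) by rewrite /qpoch big_ord_recr.
case: r => [|r] /=.
  have qp0 : qpoch c 0 = 1 by rewrite /qpoch big_ord0.
  by rewrite mulr0 addr0 !subn0 qp0 (_ : 'C(0, 2) = 0%N) // !expr0 !mulr1 !mul1r !divff.
rewrite !ltnS subSS binS bin1 exprD.
case: (ltngtP r n) => rn; last first.
- rewrite rn subnn add0r qS; have : qpoch c 0 = 1 by rewrite /qpoch big_ord0.
  move=> ->; have n1 := q0 n; have n2 := q0 n.+1; rewrite qS in n2.
  move: n2; rewrite mulf_eq0 !exprS => /norP[_ n3].
  by field; rewrite n1 n3.
- by rewrite mulr0 addr0.
rewrite !qS -(subnSK rn) !qS; have n1 := q0 n; have n2 := q0 r; have n3 := q0 (n - r.+1)%N.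
have n4 := q0 r.+1; have n5 := q0 (n - r.+1).+1; rewrite !qS !mulf_eq0 !negb_or in n4 n5.
have e : u ^+ n = u ^+ r * u ^+ (n - r.+1).+1 by rewrite -exprD; congr (_ ^+ _); lia.
have e' : u ^+ n.+1 = u ^+ r.+1 * u ^+ (n - r.+1).+1 by rewrite -exprD; congr (_ ^+ _); lia.
rewrite e e' !exprS in n4 n5 *; move: n4 n5 => /andP[_ n4] /andP[_ n5].
by field; rewrite n2 n3 n4 n5.
Qed.

End GeneratingFunction.

(** * Summation over hooks *)

Definition bracket (F : fieldType) (v : F) (m : int) : F := v ^ m - v^-1 ^ m.

Section HookSum.
Variables (F : fieldType) (c : F).
Hypothesis c0 : c != 0.
Let u := c ^+ 2.
Hypothesis u_root : forall k, (0 < k)%N -> u ^+ k != 1.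
Let u0 : u != 0. Proof. by rewrite expf_neq0. Qed.

Lemma size_hook a b : size (hook_part a b) = b.+1.
Proof. by rewrite /= size_nseq. Qed.

Lemma nth_hook a b i : nth 0%N (hook_part a b) i =
  if i == 0%N then a.+1 else if (i <= b)%N then 1%N else 0%N.
Proof. by case: i => //= i; rewrite nth_nseq. Qed.

Lemma kappa_hook a b : kappa (hook_part a b) = (a%:Z - b%:Z) * (a + b).+1%:Z.
Proof.
rewrite /kappa size_hook big_ord_recl nth_hook eqxx.
rewrite (eq_bigr (fun j : 'I_b => - (2%:Z * j.+1%:Z))) => [|j _]; last first.
  by rewrite nth_hook /= /bump /= add1n ltn_ord; lia.
rewrite sumrN -mulr_sumr.
have -> : 2%:Z * \sum_(j < b) (j.+1%:Z) = b%:Z * b.+1%:Z.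
  by elim: b => [|k IH]; rewrite ?big_ord0 // big_ord_recr mulrDr IH /=; nia.
rewrite /=; lia.
Qed.

(** The hook lengths are a + b + 1 at the corner, 1, ..., a along the arm and 1, ..., b down the
    leg. *)
Lemma hook_prod_hook a b :
  hook_prod c (hook_part a b) b.+1 = (1 - u ^+ (a + b).+1) * qpoch c a * qpoch c b.
Proof.
have mem t : (t \in betas (hook_part a b) b.+1) = (t == (a + b).+1) || (0 < t <= b)%N.
  apply/mem_betas/orP => [[i ib ->]|]; rewrite /beta.
    rewrite nth_hook; case: (eqVneq i 0%N) => [->|i0]; [left|right]; first by apply/eqP; lia.
    rewrite ifT; lia.
  case=> [/eqP ->|tb]; first by exists 0%N => //; rewrite nth_hook /=; lia.
  exists (b.+1 - t)%N; first by lia.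
  by rewrite nth_hook ifN ?ifT; lia.
rewrite /hook_prod big_betas big_ord_recl; congr (_ * _).
  have -> : beta (hook_part a b) b.+1 (ord0 : 'I_b.+1) = (a + b).+1.
    by rewrite /beta nth_hook /=; lia.
  rewrite big_mkcond big_ord_recl mem /= subn0; congr (_ * _).
  rewrite -(big_mkord predT (fun t => if t.+1 \notin betas (hook_part a b) b.+1 then
     1 - u ^+ ((a + b).+1 - t.+1) else 1)).
  rewrite (@big_cat_nat _ _ _ b) ?leq_addl //= big1_seq ?mul1r; last first.
    by move=> t /andP[_]; rewrite mem_index_iota mem => tb; rewrite ifF //; lia.
  have := @big_addn F 1 *%R 0%N (a + b) b predT
     (fun t => if t.+1 \notin betas (hook_part a b) b.+1 then 1 - u ^+ ((a + b).+1 - t.+1) else 1).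
  rewrite add0n addnK => ->; rewrite big_nat_rev big_mkord add0n /qpoch; apply: eq_bigr => t _.
  rewrite mem ifT; last by have := ltn_ord t; lia.
  by congr (1 - _ ^+ _); have := ltn_ord t; lia.
rewrite /qpoch (reindex_inj rev_ord_inj) /=; apply: eq_bigr => i _.
have ib := ltn_ord i.
have -> : beta (hook_part a b) b.+1 (bump 0 (b - i.+1)) = i.+1.
  by rewrite /beta nth_hook /bump /=; case: ifP; lia.
rewrite big_mkcond big_ord_recl mem /= subn0 big1 ?mulr1 // => t _.
have tb := ltn_ord t.
by rewrite mem ifF //; rewrite /bump /=; lia.
Qed.

Lemma w_rho_hook a b : w_rho c (hook_part a b) =
  c ^+ (a + b.+1 ^ 2) / ((1 - u ^+ (a + b).+1) * qpoch c a * qpoch c b).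
Proof.
rewrite /w_rho size_hook det_h_rho // ?hook_is_part // hook_prod_hook prodrXr.
congr (c ^+ _ / _); rewrite big_ord_recl nth_hook /=.
rewrite (eq_bigr (fun j : 'I_b => (2 * j + 3)%N)) => [|j _]; last first.
  rewrite /bump nth_nseq ltn_ord /=; lia.
have -> : (\sum_(j < b) (2 * j + 3) = b * (b + 2))%N.
  by elim: b => [|k IH]; rewrite ?big_ord0 // big_ord_recr /= IH; nia.
rewrite !expnS expn0; nia.
Qed.

(** The contents a, a - 1, ..., -b are consecutive, which puts the product in the form of the Gauss
    theorem. *)
Lemma box_poly_hook a b : box_poly c (hook_part a b) b.+1 =
  \prod_(m < (a + b).+1) (1 + (u ^+ m * u^-1 ^+ a) *: 'X).
Proof.
rewrite /box_poly big_ord_recl nth_hook /=.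
rewrite -(big_mkord predT (fun m => 1 + (u ^+ m * u^-1 ^+ a) *: 'X)).
rewrite (@big_cat_nat _ _ _ a.+1) ?ltnS ?leq_addr //=; congr (_ * _).
  rewrite big_mkord (reindex_inj rev_ord_inj) /=; apply: eq_bigr => k _.
  congr (1 + _ *: _); rewrite expr0 mul1r subSS.
  have ka : (k <= a)%N by rewrite -ltnS.
  by rewrite -exprVn (invu_sub c0 (leq_subr k a)) subKn // mulrC.
have := @big_addn {poly F} 1 *%R 0%N (a + b).+1 a.+1 predT
   (fun m => 1 + (u ^+ m * u^-1 ^+ a) *: 'X).
rewrite add0n => ->; have -> : ((a + b).+1 - a.+1 = b)%N by lia.
rewrite big_mkord; apply: eq_bigr => i _.
rewrite nth_nseq ltn_ord big_ord1 expr0 divr1 /bump /= add1n; congr (1 + _ *: _).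
have -> : (i + a.+1 = i.+1 + a)%N by lia.
by rewrite exprD -mulrA -exprMn divff // expr1n mulr1.
Qed.

Local Notation qbr := (bracket c^-1).

Lemma qbrE (m : int) : qbr m = c^-1 ^ m * (1 - u ^ m).
Proof.
rewrite /bracket invrK mulrBr mulr1; congr (_ - _).
by rewrite /u expr2 expfzMl mulrA -expfzMl mulVf // exp1rz mul1r.
Qed.

Lemma uZ (x : int) : u ^ x = c ^ (2 * x).
Proof. by rewrite /u exprnP exprz_exp. Qed.

Lemma uN (k : nat) : u ^+ k = c ^ (2 * k%:Z).
Proof. by rewrite exprnP uZ. Qed.

Lemma uV (k : nat) : u^-1 ^+ k = c ^ (- (2 * k%:Z)).
Proof. by rewrite exprVn uN invr_expz. Qed.

Lemma bin2_double k : ('C(k.+1, 2) * 2 = k * k.+1)%N.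
Proof. by elim: k => // k IH; rewrite binS bin1 mulnDl IH; nia. Qed.

Lemma prod_qbr_nat d : \prod_(1 <= k < d.+1) qbr k%:Z = c^-1 ^+ 'C(d.+1, 2) * qpoch c d.
Proof.
rewrite big_add1 /= big_mkord.
rewrite (eq_bigr (fun k : 'I_d => c^-1 ^+ k.+1 * (1 - u ^+ k.+1))) => [|k _]; last first.
  by rewrite qbrE -!exprnP.
rewrite big_split /=; congr (_ * _).
elim: d => [|d IH]; first by rewrite big_ord0.
by rewrite big_ord_recr /= IH -exprD; congr (_ ^+ _); rewrite [in RHS]binS bin1 addnC.
Qed.

Lemma prod_qbr_shift m (z : int) :
  \prod_(1 <= k < m.+1) qbr (z + k%:Z) =
  c^-1 ^ (m%:Z * z + 'C(m.+1, 2)%:Z) * \prod_(j < m) (1 - u ^ (z + j.+1%:Z)).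
Proof.
have ci0 : c^-1 != 0 by rewrite invr_eq0.
rewrite big_add1 /= big_mkord.
rewrite (eq_bigr (fun k : 'I_m => c^-1 ^ (z + k.+1%:Z) * (1 - u ^ (z + k.+1%:Z)))) => [|k _]; last first.
  by rewrite qbrE.
rewrite big_split /=; congr (_ * _).
elim: m => [|m IH]; first by rewrite big_ord0 mul0r.
rewrite big_ord_recr /= IH -expfzDr //; congr (_ ^ _).
by rewrite [in RHS]binS bin1; lia.
Qed.

(** In degree d the Gauss expansion of the boxes depends on b only through a power of u, so the sum
    over b is again of Gauss type. For d > n the coefficient vanishes, a hook of size n having n
    boxes. *)
Lemma hook_sum (a0 : int) n d : (0 < n)%N ->
  \sum_(b < n) (-1) ^+ b * c^-1 ^ (a0 * kappa (hook_part (n.-1 - b) b)) *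
     w_rho c (hook_part (n.-1 - b) b) * (box_poly c (hook_part (n.-1 - b) b) b.+1)`_d =
  if (d <= n)%N then
    \prod_(1 <= k < n) qbr (n%:Z * a0 + d%:Z + k%:Z) /
     (\prod_(1 <= k < d.+1) qbr k%:Z * \prod_(1 <= k < (n - d).+1) qbr k%:Z)
  else 0.
Proof.
case: n => // m _; rewrite [m.+1.-1]/=; have q0 := qpoch_neq0 u_root.
have box b : (b <= m)%N -> box_poly c (hook_part (m - b) b) b.+1 =
    \poly_(r < m.+2) (u ^+ 'C(r, 2) * qpoch c m.+1 / (qpoch c r * qpoch c (m.+1 - r)) *
      (u^-1 ^+ (m - b)) ^+ r).
  by move=> bm; rewrite box_poly_hook subnK // (gauss_binomial c0 u_root).
case: leqP => dm; last first.
  apply: big1 => b _; rewrite box; last by rewrite -ltnS.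
  by rewrite coef_poly ltnNge dm mulr0.
(* With m = n - 1, the powers of c depending on b combine to u^C(b,2) z^b, and E0 is the exponent
   that is left. *)
pose z : F := u ^ (m.+1%:Z * a0 + d%:Z + 1).
pose E0 : int := m.+1%:Z - a0 * m.+1%:Z * m%:Z + 2 * 'C(d, 2)%:Z - 2 * m%:Z * d%:Z.
transitivity (c ^ E0 / (qpoch c d * qpoch c (m.+1 - d)) *
   \sum_(b < m.+1) u ^+ 'C(b, 2) * qpoch c m / (qpoch c b * qpoch c (m - b)) * (- z) ^+ b).
  rewrite mulr_sumr; apply: eq_bigr => b _; have bm : (b <= m)%N by rewrite -ltnS.
  rewrite box // coef_poly ltnS dm w_rho_hook subnK // kappa_hook subnK //.
  have -> : qpoch c m.+1 = qpoch c m * (1 - u ^+ m.+1) by rewrite /qpoch big_ord_recr.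
  have nm : 1 - u ^+ m.+1 != 0 by rewrite subr_eq0 eq_sym u_root.
  rewrite [(- z) ^+ b]exprNn.
  have pw : c^-1 ^ (a0 * (((m - b)%N%:Z - b%:Z) * m.+1%:Z)) * c ^+ (m - b + b.+1 ^ 2) *
      (u ^+ 'C(d, 2) * u^-1 ^+ (m - b) ^+ d) = c ^ E0 * (u ^+ 'C(b, 2) * z ^+ b).
    rewrite /z -exprM uV !uN uZ !exprnP exprz_inv exprz_exp -!expfzDr //.
    congr (c ^ _); rewrite /E0.
    have e1 := bin2_double d; have e2 := bin2_double b; rewrite !binS !bin1 in e1 e2.
    rewrite -subzn //; nia.
  have n1 := q0 d; have n2 := q0 (m.+1 - d)%N; have n3 := q0 b; have n4 := q0 (m - b)%N.
  have n5 := q0 m.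
  set A := c^-1 ^ _ in pw *; set B := c ^+ _ in pw *; set D := u^-1 ^+ _ ^+ _ in pw *.
  set X := u ^+ 'C(d, 2) in pw *; set E := c ^ E0 in pw *; set Y := u ^+ 'C(b, 2) in pw *.
  set Z := z ^+ b in pw *; set s := (-1) ^+ b.
  transitivity (s * (A * B * (X * D)) * qpoch c m / (qpoch c b * qpoch c (m - b)) /
    (qpoch c d * qpoch c (m.+1 - d))).
    by clear pw; field; rewrite n1 n2 n3 n4 nm.
  by rewrite pw; field; rewrite n1 n2 n3 n4.
have -> : \sum_(b < m.+1) u ^+ 'C(b, 2) * qpoch c m / (qpoch c b * qpoch c (m - b)) * (- z) ^+ b
    = \prod_(j < m) (1 - u ^+ j * z).
  (* The Gauss theorem for y = -z, evaluated at 1. *)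
  have := congr1 (fun p : {poly F} => p.[1]) (gauss_binomial c0 u_root m (- z)).
  rewrite /= horner_prod horner_poly => H.
  transitivity (\prod_(j < m) (1 + (c ^+ 2 ^+ j * - z) *: 'X).[1]).
    by rewrite H; apply: eq_bigr => b _; rewrite expr1n mulr1.
  by apply: eq_bigr => j _; rewrite hornerD hornerC hornerZ hornerX mulr1 mulrN.
rewrite prod_qbr_shift !prod_qbr_nat.
have -> : \prod_(j < m) (1 - u ^+ j * z) =
   \prod_(j < m) (1 - u ^ (m.+1%:Z * a0 + d%:Z + j.+1%:Z)).
  apply: eq_bigr => j _; congr (1 - _); rewrite /z exprnP -expfzDr //; congr (u ^ _); lia.
set P := \prod_(j < m) _.
have n1 := q0 d; have n2 := q0 (m.+1 - d)%N.
have pw : c ^ E0 * (c^-1 ^+ 'C(d.+1, 2) * c^-1 ^+ 'C((m.+1 - d).+1, 2)) =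
    c^-1 ^ (m%:Z * (m.+1%:Z * a0 + d%:Z) + 'C(m.+1, 2)%:Z).
  rewrite !exprnP !exprz_inv -!expfzDr //; congr (c ^ _); rewrite /E0.
  have e1 := bin2_double d; have e2 := bin2_double (m.+1 - d); have e3 := bin2_double m.
  have e4 : 'C(d.+1, 2) = ('C(d, 2) + d)%N by rewrite binS bin1.
  have e5 : ((m.+1 - d)%N%:Z = m.+1%:Z - d%:Z) by rewrite subzn.
  move: e1 e2 e3 e4 e5; move: (m.+1 - d)%N 'C(d, 2) 'C(d.+1, 2) => k A B.
  move: 'C(k.+1, 2) 'C(m.+1, 2) => D E e1 e2 e3 e4 e5.
  have {}e5 : k = m.+1%:Z - d%:Z :> int by []. 
  nia.
have ci0 k : c^-1 ^+ k != 0 by rewrite expf_neq0 ?invr_eq0.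
rewrite -pw; set A := c^-1 ^+ _; set B := c^-1 ^+ _.
have A0 : A != 0 := ci0 _; have B0 : B != 0 := ci0 _.
by field; rewrite n1 n2 A0 B0.
Qed.

End HookSum.

(** * Rational functions and their values *)

Section Evaluation.
Variable R : realType.
Local Notation CC := (C R).
Local Notation "x %:F" := (FracField.tofrac x) : ring_scope.
Variable S : CC -> Prop.

(** The representative has a denominator without zeros on all of S, which is what [is_schur_q] and
    [genus_expansion] demand of theirs. *)
Definition evals (w : ratC R) (f : CC -> CC) :=
  exists P D : {poly CC}, w = P%:F / D%:F /\
    forall v, S v -> D.[v] != 0 /\ f v = P.[v] / D.[v].

Variable v0 : CC.
Hypothesis Sv0 : S v0.

Let den_neq0 (D : {poly CC}) : D.[v0] != 0 -> D%:F != 0 :> ratC R.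
Proof. by move=> D0; rewrite tofrac_eq0; apply: contraNneq D0 => ->; rewrite horner0. Qed.

Lemma evals_ext w f g : (forall v, S v -> f v = g v) -> evals w f -> evals w g.
Proof.
move=> fg [P [D [-> H]]]; exists P, D; split=> // v Sv; have [h1 h2] := H v Sv.
by split=> //; rewrite -fg.
Qed.

Lemma evals_poly (p : {poly CC}) : evals p%:F (fun v => p.[v]).
Proof.
exists p, 1; rewrite rmorph1 divr1; split=> // v _.
by rewrite hornerC oner_eq0 divr1.
Qed.

Lemma evals_const (z : CC) : evals (constC z) (fun=> z).
Proof. by apply: evals_ext (evals_poly z%:P) => v _; rewrite hornerC. Qed.

Lemma evals_qhalf : evals (qhalf R) id.
Proof. by apply: evals_ext (evals_poly 'X) => v _; rewrite hornerX. Qed.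

Lemma evals_add w f w' f' : evals w f -> evals w' f' ->
  evals (w + w') (fun v => f v + f' v).
Proof.
move=> [P [D [-> H]]] [P' [D' [-> H']]].
have D0 := den_neq0 (H v0 Sv0).1; have D0' := den_neq0 (H' v0 Sv0).1.
exists (P * D' + P' * D), (D * D'); split.
  by rewrite rmorphD !rmorphM addf_div.
move=> v Sv; have [h1 ->] := H v Sv; have [h1' ->] := H' v Sv.
by rewrite hornerD !hornerM mulf_neq0 // addf_div.
Qed.

Lemma evals_mul w f w' f' : evals w f -> evals w' f' ->
  evals (w * w') (fun v => f v * f' v).
Proof.
move=> [P [D [-> H]]] [P' [D' [-> H']]]; exists (P * P'), (D * D'); split.
  by rewrite !rmorphM mulf_div.
move=> v Sv; have [h1 ->] := H v Sv; have [h1' ->] := H' v Sv.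
by rewrite !hornerM mulf_neq0 // mulf_div.
Qed.

Lemma evals_opp w f : evals w f -> evals (- w) (fun v => - f v).
Proof.
move=> H; have := evals_mul (evals_const (-1)) H.
rewrite /constC rmorphN rmorph1 rmorphN rmorph1 mulN1r; apply: evals_ext => v _.
by rewrite mulN1r.
Qed.

Lemma evals_inv w f : (forall v, S v -> f v != 0) -> evals w f ->
  evals w^-1 (fun v => (f v)^-1).
Proof.
move=> f0 [P [D [-> H]]]; exists D, P; split; first by rewrite invf_div.
move=> v Sv; have := f0 v Sv; have [h1 ->] := H v Sv.
by rewrite mulf_eq0 invr_eq0 (negPf h1) orbF invf_div => ->.
Qed.

Lemma evals_sum (I : Type) (r : seq I) (P : pred I) (w : I -> ratC R) (f : I -> CC -> CC) :
  (forall i, P i -> evals (w i) (f i)) ->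
  evals (\sum_(i <- r | P i) w i) (fun v => \sum_(i <- r | P i) f i v).
Proof.
move=> H; elim: r => [|i r IH].
  rewrite big_nil; have := evals_const 0; rewrite /constC !rmorph0; apply: evals_ext => v _.
  by rewrite big_nil.
rewrite big_cons; case: ifP => Pi; last by apply: evals_ext IH => v _; rewrite big_cons Pi.
by apply: evals_ext (evals_add (H i Pi) IH) => v _; rewrite big_cons Pi.
Qed.

Lemma evals_prod (I : Type) (r : seq I) (P : pred I) (w : I -> ratC R) (f : I -> CC -> CC) :
  (forall i, P i -> evals (w i) (f i)) ->
  evals (\prod_(i <- r | P i) w i) (fun v => \prod_(i <- r | P i) f i v).
Proof.
move=> H; elim: r => [|i r IH].
  rewrite big_nil; have := evals_const 1; rewrite /constC !rmorph1; apply: evals_ext => v _.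
  by rewrite big_nil.
rewrite big_cons; case: ifP => Pi; last by apply: evals_ext IH => v _; rewrite big_cons Pi.
by apply: evals_ext (evals_mul (H i Pi) IH) => v _; rewrite big_cons Pi.
Qed.

Lemma evals_exprn w f (n : nat) : evals w f -> evals (w ^+ n) (fun v => f v ^+ n).
Proof.
move=> H; elim: n => [|n IH].
  by have := evals_const 1; rewrite /constC !rmorph1.
rewrite exprS; apply: evals_ext (evals_mul H IH) => v _; by rewrite exprS.
Qed.

Lemma evals_exprz w f (n : int) : (forall v, S v -> f v != 0) -> evals w f ->
  evals (w ^ n) (fun v => f v ^ n).
Proof.
move=> f0 H; case: n => n; first exact: evals_exprn.
by apply: evals_inv => [v Sv|]; [rewrite expf_neq0 ?f0|apply: evals_exprn].
Qed.

Lemma evals_det n (A : 'M[CC -> CC]_n) (B : 'M[ratC R]_n) :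
  (forall i j, evals (B i j) (A i j)) ->
  evals (\det B) (fun v => \det (\matrix_(i, j) A i j v)).
Proof.
move=> H; rewrite /determinant; apply: evals_sum => s _; apply: evals_mul.
  by apply: evals_exprn; have := evals_opp (evals_const 1); rewrite /constC !rmorph1.
apply: evals_ext (evals_prod _ (f := fun i => A i (s i)) _) => [v _|i _]; last exact: H.
by apply: eq_bigr => i _; rewrite mxE.
Qed.

Hypothesis S_inf : forall n, exists s : seq CC, [/\ uniq s, size s = n & forall v, v \in s -> S v].

(** After cross-multiplication the difference would have more roots in S than its size allows. *)
Lemma evals_inj w w' f : evals w f -> evals w' f -> w = w'.
Proof.
move=> [P [D [-> H]]] [P' [D' [-> H']]].
have D0 := den_neq0 (H v0 Sv0).1; have D0' := den_neq0 (H' v0 Sv0).1.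
apply/eqP; rewrite eqr_div // -!rmorphM tofrac_eq -subr_eq0; apply/eqP.
set q := _ - _; apply/eqP; apply: contraT => q0.
have [s [us ss Ss]] := S_inf (size q).
have := max_poly_roots q0 _ us; rewrite ss ltnn => -> //.
apply/allP => v /Ss Sv; rewrite /root /q hornerD hornerN !hornerM.
have [h1 e1] := H v Sv; have [h1' e1'] := H' v Sv.
have /eqP := etrans (esym e1) e1'; rewrite eqr_div // => /eqP ->.
by rewrite subrr.
Qed.

End Evaluation.

(** * Schur functions of infinitely many variables as limits *)

Section ComplexLimits.
Variable R : realType.
Local Notation CC := (C R).

Definition tends (f : nat -> CC) (l : CC) : Prop := (f n @[n --> \oo] --> l)%classic.

Lemma tends_cst l : tends (fun=> l) l.
Proof. exact: cvg_cst. Qed.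

Lemma tends_add f g a b : tends f a -> tends g b -> tends (fun n => f n + g n) (a + b).
Proof. exact: cvgD. Qed.

Lemma tends_mul f g a b : tends f a -> tends g b -> tends (fun n => f n * g n) (a * b).
Proof. exact: cvgM. Qed.

Lemma tends_ext f g l : f =1 g -> tends f l -> tends g l.
Proof. by move=> /funext ->. Qed.

Lemma tends_sum (I : Type) (r : seq I) (P : pred I) (f : I -> nat -> CC) (l : I -> CC) :
  (forall i, P i -> tends (f i) (l i)) ->
  tends (fun n => \sum_(i <- r | P i) f i n) (\sum_(i <- r | P i) l i).
Proof.
move=> H; elim: r => [|i r IH].
  rewrite (_ : (fun n => _) = fun=> \sum_(i <- [::] | P i) l i); first exact: tends_cst.
  by apply/funext => n; rewrite !big_nil.
rewrite big_cons; case: ifP => Pi; last by apply: tends_ext IH => n; rewrite big_cons Pi.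
by apply: tends_ext (tends_add (H i Pi) IH) => n; rewrite big_cons Pi.
Qed.

Lemma tends_prod (I : Type) (r : seq I) (P : pred I) (f : I -> nat -> CC) (l : I -> CC) :
  (forall i, P i -> tends (f i) (l i)) ->
  tends (fun n => \prod_(i <- r | P i) f i n) (\prod_(i <- r | P i) l i).
Proof.
move=> H; elim: r => [|i r IH].
  rewrite (_ : (fun n => _) = fun=> \prod_(i <- [::] | P i) l i); first exact: tends_cst.
  by apply/funext => n; rewrite !big_nil.
rewrite big_cons; case: ifP => Pi; last by apply: tends_ext IH => n; rewrite big_cons Pi.
by apply: tends_ext (tends_mul (H i Pi) IH) => n; rewrite big_cons Pi.
Qed.

Lemma tends_det k (A : nat -> 'M[CC]_k) (B : 'M[CC]_k) :
  (forall i j, tends (fun n => A n i j) (B i j)) -> tends (fun n => \det (A n)) (\det B).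
Proof.
move=> H; rewrite /determinant; apply: tends_sum => s _; apply: tends_mul.
  exact: tends_cst.
by apply: tends_prod => i _.
Qed.

Lemma tends_unique f a b : tends f a -> tends f b -> a = b.
Proof. by apply: cvg_unique; apply: norm_hausdorff. Qed.

Lemma tends_shift k f l : tends (fun n => f (n + k)%N) l <-> tends f l.
Proof. by rewrite /tends -[X in _ <-> X](cvg_shiftn k). Qed.

Lemma tends_eventually k f g l : (forall n, (k <= n)%N -> f n = g n) ->
  tends f l -> tends g l.
Proof.
move=> fg /(tends_shift k f l).2 H; apply/(tends_shift k g l); apply: tends_ext H => n.
by rewrite fg // leq_addl.
Qed.

Lemma tendsP f l : tends f l <->
  (forall e : R, 0 < e -> exists N, forall n, (N <= n)%N -> `|l - f n| < e%:C%C).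
Proof.
split=> [/cvgrPdist_lt H e e0|H].
  have /H [N _ HN] : 0 < (e%:C%C : CC) by rewrite ltcR.
  by exists N => n Nn; apply: HN.
apply/cvgrPdist_lt => e e0; have [|N HN] := H (complex.Re e).
  by rewrite -ltcR RRe_real // gtr0_real.
exists N => // n Nn /=; have := HN n Nn.
by rewrite RRe_real // gtr0_real.
Qed.

Lemma tends_geometric (u : CC) : `|u| < 1 -> tends (fun n => u ^+ n) 0.
Proof.
move=> u1; pose r := complex.Re `|u|.
have rE : r%:C%C = `|u| by rewrite RRe_real // normr_real.
have r0 : 0 <= r by rewrite -ler0c rE.
have r1 : `|r| < 1 by rewrite ger0_norm // -ltcR rE.
have /cvgrPdist_lt H := cvg_expr r1.
apply/tendsP => e e0; have [N _ HN] := H e e0; exists N => n Nn.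
have := HN n Nn; rewrite /= sub0r normrN ger0_norm ?exprn_ge0 // => h.
by rewrite sub0r normrN normrX -rE -rmorphXn /= ltcR.
Qed.

Lemma hsym_rvars_shift (x : nat -> CC) N k :
  hsym (rvars x N.+1) k = hsym (x 0%N :: rvars (fun i => x i.+1) N) k.
Proof.
suff -> : rvars x N.+1 = rcons (rvars (fun i => x i.+1) N) (x 0%N) by rewrite hsym_rcons.
by elim: N => //= N ->.
Qed.

Lemma rvars_map (c : CC) (x : nat -> CC) N : rvars (fun i => c * x i) N = [seq c * y | y <- rvars x N].
Proof. by elim: N => //= N ->. Qed.

(* The limit of the complete symmetric functions of the variables
   v^z_0, ..., v^z_(l-1), v^a, v^(a-2), v^(a-4), ... *)
Fixpoint hlim (zs : seq int) (a : int) (v : CC) : nat -> CC :=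
  if zs is z :: zs' then
    fix h k := if k is k'.+1 then hlim zs' a v k'.+1 + v ^ z * h k' else 1
  else fun k => (v ^ a) ^+ k / qpoch v^-1 k.

Section OutsideDisc.
Variable v : CC.
Hypothesis v1 : 1 < `|v|.

Lemma out_neq0 : v != 0.
Proof. by rewrite -normr_gt0; apply: lt_trans v1. Qed.

Lemma out_norm : `|v^-1 ^+ 2| < 1.
Proof.
have v0 : 0 < `|v| by apply: lt_trans v1.
by rewrite normrX normfV expr_lt1 ?invr_ge0 // invf_lt1.
Qed.

Lemma out_root k : (0 < k)%N -> (v^-1 ^+ 2) ^+ k != 1.
Proof.
move=> k0; apply: contraTneq isT => e; have := out_norm; have : `|(v^-1 ^+ 2) ^+ k| < 1.
  by rewrite normrX exprn_ilt1 ?out_norm // -lt0n.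
by rewrite e normr1 ltxx.
Qed.

Lemma hlim0 zs a : hlim zs a v 0 = 1.
Proof. by case: zs => //=; rewrite expr0 /qpoch big_ord0 divr1. Qed.

(** The exceptional variables are peeled off from the front, [hsym] being symmetric. The geometric
    tail is a Gaussian binomial, whose numerators 1 - u^(N+i) tend to 1. *)
Lemma tends_hlim (zs : seq int) (a : int) (x : nat -> CC) k :
  (forall i, (i < size zs)%N -> x i = v ^ nth 0 zs i) ->
  (forall i, x (size zs + i)%N = v ^ a * (v^-1 ^+ 2) ^+ i) ->
  tends (fun N => hsym (rvars x N) k) (hlim zs a v k).
Proof.
elim: zs x k => [|z zs IH] x k xz xt.
  have -> : x = fun i => v ^ a * (v^-1 ^+ 2) ^+ i by apply/funext => i; rewrite -xt.
  apply: (@tends_ext (fun N => (v ^ a) ^+ k * \prod_(i < k) ((1 - (v^-1 ^+ 2) ^+ (N + i)) / (1 - (v^-1 ^+ 2) ^+ i.+1)))).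
    by move=> N; rewrite rvars_map hsym_scale hsym_geometric //; apply: out_root.
  rewrite /= /qpoch; apply: tends_mul; first exact: tends_cst.
  rewrite -prodfV; apply: tends_prod => i _.
  rewrite -[X in tends _ X]mul1r; apply: tends_mul; last exact: tends_cst.
  apply: (@tends_ext (fun N => 1 + - 1 * ((v^-1 ^+ 2) ^+ N * (v^-1 ^+ 2) ^+ i))).
    by move=> N; rewrite exprD mulN1r.
  rewrite -[X in tends _ X]addr0 -(mulr0 (-1)) -(mul0r ((v^-1 ^+ 2) ^+ i)).
  apply: tends_add; first exact: tends_cst.
  apply: tends_mul; first exact: tends_cst.
  by apply: tends_mul; [apply: tends_geometric out_norm|exact: tends_cst].
have x0 : x 0%N = v ^ z by apply: (xz 0%N).
have {}IH k' : tends (fun N => hsym (rvars (fun i => x i.+1) N) k') (hlim zs a v k').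
  by apply: IH => i; [move=> iz; apply: (xz i.+1)|apply: xt].
apply/(tends_shift 1 _ _).1; apply: (@tends_ext (fun N => hsym (x 0%N :: rvars (fun i => x i.+1) N) k)).
  by move=> N; rewrite addn1 hsym_rvars_shift.
elim: k => [|k IHk].
  rewrite (_ : (fun N => _) = fun=> hlim (z :: zs) a v 0); first exact: tends_cst.
  by apply/funext => N; rewrite hsym0 hlim0.
rewrite -[hlim _ _ _ _]/(hlim zs a v k.+1 + v ^ z * hlim (z :: zs) a v k) -x0.
apply: (tends_ext (fun N => esym (hsymS (x 0%N) (rvars (fun i => x i.+1) N) k))).
apply: tends_add; first exact: IH.
by apply: tends_mul; [exact: tends_cst|exact: IHk].
Qed.

Definition rho_exponents (mu : seq nat) : seq int :=
  [seq 2 * ((nth 0%N mu j)%:Z - j%:Z) - 1 | j <- iota 0 (size mu)].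

Definition h_shift (mu : seq nat) : nat -> CC :=
  hlim (rho_exponents mu) (2 * (0 - (size mu)%:Z) - 1) v.

Lemma tends_h_shift mu k : tends (fun N => hsym (rvars (qrho mu v) N) k) (h_shift mu k).
Proof.
apply: tends_hlim => [i|i]; rewrite size_map size_iota.
  by move=> h; rewrite (nth_map 0%N) ?size_iota // nth_iota.
rewrite /qrho nth_default ?leq_addr // -exprM exprnP exprz_inv -expfzDr ?out_neq0 //.
by congr (v ^ _); lia.
Qed.

(** Jacobi-Trudi with limits of complete functions; the flag disappears because N - i tends to
    infinity with N. *)
Definition schur_lim (mu nu : seq nat) : CC :=
  \det (\matrix_(i < size nu, j < size nu)
    (if (j <= nth 0 nu j + i)%N then h_shift mu (nth 0 nu j + i - j)%N else 0)).

Lemma qrhoE mu i : qrho mu v i = x_rho v^-1 mu i.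
Proof.
rewrite /qrho /x_rho -!exprM -exprVn invrK -exprS !exprnP exprz_inv -expfzDr ?out_neq0 //.
by congr (v ^ _); lia.
Qed.

Lemma qrho_inj mu i j : is_part mu -> qrho mu v i = qrho mu v j -> i = j.
Proof.
rewrite !qrhoE => pmu; apply: x_rho_inj => //; first by rewrite invr_eq0 out_neq0.
exact: out_root.
Qed.

Lemma tends_schur mu (nu : seq nat) : is_part mu ->
  tends (fun N => schur nu N (qrho mu v)) (schur_lim mu nu).
Proof.
move=> pmu; set l := size nu.
apply: (@tends_eventually l (fun N => \det (jt_mx nu N l (qrho mu v)))).
  move=> N lN; rewrite -(subnKC lN) schur_jacobi_trudi //.
  by move=> i j _ _; apply: qrho_inj.
apply: tends_det => i j; rewrite mxE.
apply: (@tends_ext (fun N => hsymB (rvars (qrho mu v) (N - i)) (nth 0%N nu j + i) j)).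
  by move=> N; rewrite mxE.
rewrite /hsymB; case: leqP => _; last exact: tends_cst.
apply/(tends_shift i _ _).1; apply: (@tends_ext (fun N => hsym (rvars (qrho mu v) N) (nth 0%N nu j + i - j))).
  by move=> N; rewrite addnK.
exact: tends_h_shift.
Qed.

Lemma h_shift0 k : h_shift [::] k = h_rho v^-1 k.
Proof. by rewrite /h_shift /h_rho /= exprN1. Qed.

Lemma schur_lim0 nu : schur_lim [::] nu = w_rho v^-1 nu.
Proof.
rewrite /schur_lim /w_rho -det_tr; congr (\det _); apply/matrixP => i j; rewrite !mxE.
rewrite /seqB /beta; have := ltn_ord i; have := ltn_ord j => jl il.
have -> : (size nu - j.+1 <= nth 0 nu i + (size nu - i.+1))%N = (i <= nth 0 nu i + j)%N by lia.
case: ifP => // h; rewrite h_shift0; congr h_rho; lia.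
Qed.

(** The identity in N variables holds once N is at least d and the length of mu, so it passes to the
    limit. *)
Lemma conifold_sum_lim mu d : is_part mu ->
  \sum_(nu <- parts d) schur_lim mu nu * w_rho v^-1 (conj_part nu) =
  \sum_(j < d.+1) (box_poly v^-1 mu (size mu))`_j *
     \sum_(nu <- parts (d - j)) w_rho v^-1 nu * w_rho v^-1 (conj_part nu).
Proof.
move=> pmu; have c0 : v^-1 != 0 by rewrite invr_eq0 out_neq0.
apply: (@tends_unique (fun N => \sum_(nu <- parts d) schur nu N (qrho mu v) * w_rho v^-1 (conj_part nu))).
  apply: tends_sum => nu _; apply: tends_mul; last exact: tends_cst.
  exact: tends_schur.
apply: (@tends_eventually (maxn d (size mu)) (fun N => \sum_(j < d.+1) (box_poly v^-1 mu (size mu))`_j *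
     \sum_(nu <- parts (d - j)) schur nu N (qrho [::] v) * w_rho v^-1 (conj_part nu))).
  move=> N; rewrite geq_max => /andP[dN sN].
  have E mu' : qrho mu' v = x_rho v^-1 mu' by apply/funext => i; rewrite qrhoE.
  by rewrite !E -(@conifold_sum _ _ c0 out_root mu d N).
apply: tends_sum => j _; apply: tends_mul; first exact: tends_cst.
apply: tends_sum => nu _; apply: tends_mul; last exact: tends_cst.
by rewrite -schur_lim0; apply: tends_schur.
Qed.

End OutsideDisc.

Definition out (v : CC) : Prop := 1 < `|v|.

Lemma out2 : out 2.
Proof. by rewrite /out ger0_norm // ltr1n. Qed.

Lemma out_inf n : exists s : seq CC, [/\ uniq s, size s = n & forall v, v \in s -> out v].
Proof.
exists [seq (k%:R : CC) | k <- iota 2 n]; split.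
- rewrite map_inj_uniq ?iota_uniq // => i j /eqP; rewrite eqr_nat => /eqP //.
- by rewrite size_map size_iota.
move=> v /mapP[k]; rewrite mem_iota => /andP[k2 _] ->.
by rewrite /out ger0_norm ?ler0n // ltr1n.
Qed.

Lemma evals_qpoch k : exists w, evals out w (fun v => qpoch v^-1 k).
Proof.
have qi : evals out (qhalf R)^-1 (fun v => v^-1).
  apply: (evals_inv (f := id)); last exact: evals_qhalf.
  by move=> v; apply: out_neq0.
eexists; apply: evals_prod => i _.
apply: (evals_add out2); first exact: (evals_const _ 1).
apply: (evals_opp (S := out)).
apply: evals_exprn; apply: evals_exprn; exact: qi.
Qed.

Lemma evals_hlim zs a k : exists w, evals out w (fun v => hlim zs a v k).
Proof.
have qz (z : int) : evals out ((qhalf R) ^ z) (fun v => v ^ z).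
  apply: (evals_exprz (f := id)); last exact: evals_qhalf.
  by move=> v; apply: out_neq0.
elim: zs k => [|z zs IH] k.
  have [w Hw] := evals_qpoch k; exists (((qhalf R) ^ a) ^+ k / w); apply: evals_mul.
    exact: evals_exprn.
  by apply: evals_inv => // v Sv; apply: qpoch_neq0; exact: out_root.
elim: k => [|k [w Hw]]; first by exists (constC 1); exact: evals_const.
have [w' Hw'] := IH k.+1.
by eexists; apply: (evals_add out2 Hw'); apply: evals_mul Hw; exact: qz.
Qed.

Lemma evals_schur_lim mu nu : exists w, evals out w (fun v => schur_lim v mu nu).
Proof.
pose A : 'M[CC -> CC]_(size nu) := \matrix_(i, j) fun v =>
    (if (j <= nth 0 nu j + i)%N then h_shift v mu (nth 0 nu j + i - j)%N else 0).
have H i j : exists w, evals out w (A i j).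
  rewrite mxE; case: leqP => _; last by exists (constC 0); exact: evals_const.
  exact: evals_hlim.
pose B : 'M[ratC R]_(size nu) := \matrix_(i, j) xget 0 [set w | evals out w (A i j)]%classic.
exists (\det B); apply: evals_ext (evals_det out2 (A := A) _) => [v _|i j].
  by congr (\det _); apply/matrixP => i j; rewrite !mxE.
rewrite mxE; case: xgetP => [w -> //|no].
by have [w Hw] := H i j; case: (no w Hw).
Qed.

(** Whichever fraction [xget] selects, its values are the limits; a candidate exists because the
    limit determinant is rational in v. *)
Lemma schur_q_evals mu nu : is_part mu -> evals out (schur_q R mu nu) (fun v => schur_lim v mu nu).
Proof.
move=> pmu; rewrite /schur_q; case: xgetP => [w _ [P [D [-> H]]]|no].
  exists P, D; split=> // v v1; have [D0 L] := H v v1; split=> //.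
  exact: (tends_unique (tends_schur v1 pmu (nu := nu)) L).
have [w [P [D [wE H]]]] := evals_schur_lim mu nu; case: (no w); exists P, D; split=> // v v1.
by have [D0 <-] := H v v1; split=> //; exact: tends_schur.
Qed.

End ComplexLimits.

(** * The linear coefficient of the logarithm *)

Lemma parts0 : parts 0 = [:: [::]].
Proof.
apply: perm_small_eq => //; apply: uniq_perm; rewrite ?parts_uniq // => mu.
rewrite mem_parts inE; apply/andP/eqP => [[/andP[_ pmu] /eqP e]|->] //.
by case: mu pmu e => //= m s /andP[m0 _]; case: m m0.
Qed.

Section SeriesOnePoint.
Variable F : fieldType.
Implicit Types f g h : Defs.series F.

Lemma series_mul_nil f g d :
  series_mul f g d [::] = \sum_(i < d.+1) f i [::] * g (d - i)%N [::].
Proof.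
rewrite /series_mul; apply: eq_bigr => i _.
by rewrite big_ord_recl big_ord0 addr0 /= subnn parts0 big_seq1 big_cons big_nil /= addr0.
Qed.

Lemma part1_mem n : (0 < n)%N -> [:: n] \in parts n.
Proof. by move=> n0; rewrite mem_parts /is_part /= n0 addn0 eqxx. Qed.

(** If al ++ be has one part, then al or be is empty, so only k = 0 and k = n contribute. *)
Lemma series_mul_cycle f g d n : (0 < n)%N -> series_mul f g d [:: n] =
  \sum_(i < d.+1) (f i [:: n] * g (d - i)%N [::] + f i [::] * g (d - i)%N [:: n]).
Proof.
case: n => // n _; rewrite /series_mul; apply: eq_bigr => i _.
rewrite [sumn _]/= addn0 big_ord_recl big_ord_recr /= subn0 parts0 big_seq1.
rewrite [bump 0 n]/bump add1n subnn parts0 [X in _ + (X + _)]big1 ?add0r => [|k _]; last first.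
  rewrite big1_seq // => al /andP[_]; rewrite mem_parts => /andP[_ /eqP sal].
  rewrite big1_seq // => be /andP[pe]; rewrite mem_parts => /andP[_ /eqP sbe].
  have := ltn_ord k; move: sal sbe; rewrite /bump /= add1n => sal sbe kn.
  have := perm_size pe; rewrite size_cat /=; case: al sal {pe} => // x s _ /=.
  by case: be sbe => [|y t] //=; lia.
rewrite addrC; congr (_ + _).
  rewrite (bigD1_seq [:: n.+1]) ?parts_uniq ?part1_mem //= big_cons big_nil /= perm_refl addr0.
  rewrite big1 ?addr0 // => al nal; rewrite big_cons big_nil cats0.
  by case: ifP => // /perm_small_eq e; rewrite e ?eqxx in nal.
have U : uniq [seq be <- parts n.+1 | perm_eq ([::] ++ be) [:: n.+1]].
  exact: filter_uniq (parts_uniq _).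
have M : [:: n.+1] \in [seq be <- parts n.+1 | perm_eq ([::] ++ be) [:: n.+1]].
  by rewrite mem_filter perm_refl part1_mem.
rewrite -big_filter (bigD1_seq _ M U) /=.
rewrite big_filter_cond big1 ?addr0 // => be /andP[/perm_small_eq e nbe].
by rewrite e ?eqxx in nbe.
Qed.

Definition nil_poly f D : {poly F} := \poly_(i < D.+1) f i [::].

Lemma series_exp_nil f k d D : (d <= D)%N -> series_exp f k d [::] = (nil_poly f D ^+ k)`_d.
Proof.
elim: k d => [|k IH] d dD; first by rewrite expr0 coef1 /series_exp /= /series1 andbT.
rewrite exprS coefM -[LHS]/(series_mul f (series_exp f k) d [::]) series_mul_nil.
apply: eq_bigr => i _; have := ltn_ord i => id; rewrite coef_poly ifT; last by lia.
by rewrite IH //; lia.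
Qed.

Lemma coef_expr_low (p : {poly F}) k d : p`_0 = 0 -> (d < k)%N -> (p ^+ k)`_d = 0.
Proof.
move=> p0 dk; have -> : p = 'X * \poly_(i < (size p).-1) p`_i.+1.
  apply/polyP => -[|i]; rewrite coefXM // coef_poly /=; case: ltnP => // h.
  by rewrite nth_default //; lia.
by rewrite exprMn coefXnM dk.
Qed.

(** Truncated geometric series: (1 - G) times the sum of G^k is 1 - G^(d+1), and G has no constant
    term. *)
Lemma series_inv_nil f d : f 0%N [::] != 0 ->
  \sum_(i < d.+1) f i [::] * series_inv f (d - i)%N [::] = (d == 0%N)%:R.
Proof.
move=> c0; set c := f 0%N [::] in c0 *.
pose g : Defs.series F := fun e al => series1 F e al - c^-1 * f e al.
pose G := nil_poly g d.
have G0 : G`_0 = 0 by rewrite coef_poly /= /g /series1 /= mulVf // subrr.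
have invE e : (e <= d)%N -> series_inv f e [::] = c^-1 * (\sum_(k < d.+1) G ^+ k)`_e.
  move=> ed; rewrite /series_inv -/c -mulr_sumr coef_sum addn0; congr (_ * _).
  rewrite (big_ord_widen_cond d.+1 predT (fun k => series_exp g k e [::])) //= big_mkcond /=.
  apply: eq_bigr => k _; rewrite (series_exp_nil _ _ ed) ltnS.
  by case: leqP => // ek; rewrite coef_expr_low.
have fE i : (i <= d)%N -> f i [::] = c * (1 - G)`_i.
  move=> id; rewrite coefB coef1 coef_poly ltnS id /g /series1 andbT opprB addrC subrK.
  by rewrite mulVKf.
transitivity (((1 - G) * \sum_(k < d.+1) G ^+ k)`_d).
  rewrite coefM; apply: eq_bigr => i _; have id : (i <= d)%N by rewrite -ltnS.
  by rewrite fE // invE ?leq_subr // mulrACA divff // mul1r.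
have -> : (1 - G) * \sum_(k < d.+1) G ^+ k = 1 - G ^+ d.+1.
  by rewrite -[1 - G ^+ _]opprB subrX1 -mulNr opprB.
by rewrite coefB coef1 coef_expr_low // subr0.
Qed.

Lemma series_exp_cycle0 f k d n : (0 < n)%N -> (forall e, f e [:: n] = 0) ->
  series_exp f k d [:: n] = 0.
Proof.
move=> n0 f0; elim: k d => [|k IH] d; first by rewrite /series_exp /= /series1 andbF.
rewrite -[LHS]/(series_mul f (series_exp f k) d [:: n]) series_mul_cycle // big1 // => i _.
by rewrite f0 mul0r IH mulr0 addr0.
Qed.

Lemma series_exp_nil0 f k d : (forall e, f e [::] = 0) -> series_exp f k.+1 d [::] = 0.
Proof.
move=> f0; rewrite -[LHS]/(series_mul f (series_exp f k) d [::]) series_mul_nil big1 // => i _.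
by rewrite f0 mul0r.
Qed.

(** f - 1 has no terms free of p, so its powers beyond the first have none linear in p. *)
Lemma log_one_point f n d : (0 < n)%N -> (forall e, f e [::] = (e == 0%N)%:R) ->
  series_log f d [:: n] = f d [:: n].
Proof.
move=> n0 f1; set h : Defs.series F := fun e al => f e al - series1 F e al.
have h0 e : h e [::] = 0 by rewrite /h f1 /series1 andbT subrr.
have hn e : h e [:: n] = f e [:: n] by rewrite /h /series1 andbF subr0.
rewrite /series_log /= addn0 big_ltn ?ltnS ?addn_gt0 ?n0 ?orbT //.
rewrite [X in _ + X]big1_seq ?addr0; last first.
  move=> [|[|k]] /andP[_]; rewrite mem_index_iota // => _.
  rewrite -[series_exp _ _ _ _]/(series_mul h (series_exp h k.+1) d [:: n]) series_mul_cycle //.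
  by rewrite big1 ?mulr0 // => i _; rewrite series_exp_nil0 // h0 mulr0 mul0r addr0.
rewrite expr0 mul1r invr1 mul1r -[series_exp _ _ _ _]/(series_mul h (series1 F) d [:: n]).
rewrite series_mul_cycle // big_ord_recr /= subnn /series1 eqxx mulr1 h0 mul0r addr0.
rewrite big1 ?add0r ?hn // => i _; rewrite h0 mul0r addr0 andbT.
by rewrite subn_eq0 leqNgt ltn_ord mulr0.
Qed.

(** By hypothesis the coefficient of p_n in Z is the p-free part of Z times Fn. Division by that
    part leaves Fn and makes the p-free part equal to 1. *)
Lemma log_quotient_one_point (Z : Defs.series F) (Fn : nat -> F) n d : (0 < n)%N ->
  Z 0%N [::] != 0 ->
  (forall e, Z e [:: n] = \sum_(j < e.+1) Z (e - j)%N [::] * Fn j) ->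
  series_log (series_mul Z (series_inv (series_p0 Z))) d [:: n] = Fn d.
Proof.
move=> n0 Z0 ZF; set I := series_inv (series_p0 Z).
have p0n e : series_p0 Z e [:: n] = 0 by [].
have Inv e : \sum_(i < e.+1) Z i [::] * I (e - i)%N [::] = (e == 0%N)%:R.
  by apply: (@series_inv_nil (series_p0 Z)).
have In e : I e [:: n] = 0.
  rewrite /I /series_inv big1 // => k _; rewrite series_exp_cycle0 ?mulr0 // => e'.
  by rewrite p0n mulr0 /series1 andbF subr0.
rewrite log_one_point //; last by move=> e; rewrite series_mul_nil.
rewrite series_mul_cycle //.
under eq_bigr => i _ do rewrite In mulr0 addr0.
pose PZ := nil_poly Z d; pose PI := nil_poly I d; pose PF := \poly_(i < d.+1) Fn i.
transitivity ((PF * PZ * PI)`_d).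
  rewrite coefM; apply: eq_bigr => i _; have id := ltn_ord i.
  rewrite [PI`__]coef_poly ifT; last by lia.
  congr (_ * _); rewrite ZF coefM; apply: eq_bigr => j _; have ji := ltn_ord j.
  by rewrite !coef_poly !ifT 1?mulrC //; lia.
have ZI e : (e <= d)%N -> (PZ * PI)`_e = (e == 0%N)%:R.
  move=> ed; rewrite coefM -Inv; apply: eq_bigr => i _; have ie := ltn_ord i.
  by rewrite !coef_poly !ifT //; lia.
rewrite -mulrA coefM big_ord_recr /= subnn ZI // mulr1 coef_poly ltnSn.
rewrite big1 ?add0r // => i _; rewrite ZI ?leq_subr //.
by rewrite subn_eq0 leqNgt ltn_ord mulr0.
Qed.

End SeriesOnePoint.

Lemma sum_hooks (V : nmodType) (G : seq nat -> V) n : (0 < n)%N ->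
  (forall mu, mu \in parts n -> (1 < nth 0 mu 1)%N -> G mu = 0) ->
  \sum_(mu <- parts n) G mu = \sum_(b < n) G (hook_part (n.-1 - b) b).
Proof.
move=> n0 H; rewrite (bigID (fun mu => (nth 0 mu 1 <= 1)%N)) /= [X in _ + X]big1_seq ?addr0; last first.
  by move=> mu /andP[]; rewrite -ltnNge => h1 h2; apply: H.
rewrite -big_filter; transitivity (\sum_(mu <- [seq hook_part (n.-1 - b) b | b <- iota 0 n]) G mu).
  apply: perm_big; apply: uniq_perm.
  - by rewrite filter_uniq ?parts_uniq.
  - rewrite map_inj_uniq ?iota_uniq // => b b' /(congr1 size).
    by rewrite !size_hook => -[].
  move=> mu; rewrite mem_filter mem_parts; apply/andP/mapP => [[m1 /andP[pmu /eqP sm]]|[b]].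
    case: mu m1 pmu sm => [|x s]; first by move=> _ _ e; rewrite -e in n0.
    move=> m1 pmu sm; exists (size s).
      rewrite mem_iota /= add0n -sm; have := part_size_le pmu; by [].
    have sE : s = nseq (size s) 1%N.
      apply: (@eq_from_nth _ 0%N) => [|i is_]; first by rewrite size_nseq.
      rewrite nth_nseq is_.
      apply/eqP; rewrite eqn_leq; apply/andP; split.
        by apply: leq_trans m1; apply: (part_nth_le (i := 1) (j := i.+1) pmu).
      have := part_nth_gt0 i.+1 pmu; by rewrite /= ltnS is_ => ->.
    have x0 : (0 < x)%N by have := part_nth_gt0 0 pmu.
    rewrite /hook_part {1}sE; congr (_ :: _).
    have ss : sumn s = size s by rewrite {1}sE sumn_nseq mul1n.
    by rewrite -sm /= ss -{1 2}(prednK x0) addSn /= addnK.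
  rewrite mem_iota add0n => /andP[_ bn] ->; split.
    by rewrite nth_hook /=; case: ifP.
  by rewrite hook_is_part sumn_hook; apply/eqP; lia.
rewrite big_map -{1}[n]subn0 -/(index_iota 0 n) big_mkord //.
Qed.

Lemma zpart1 n : (0 < n)%N -> zpart [:: n] = n.
Proof.
case: n => // n _; rewrite /zpart /= addn0 big_nat_recr //= eqxx addn0 expn1 muln1.
rewrite big1_seq ?mul1n // => j /andP[_]; rewrite mem_index_iota => jn.
by have /negPf -> : n.+1 != j by lia.
Qed.

(** * The one-point function as a rational function *)

Section OnePoint.
Variables (R : realType) (a : int).
Local Notation CC := (C R).
Local Notation q := (qhalf R).

Definition one_point_frac (F : fieldType) (v : F) (n d : nat) : F :=
  if (d <= n)%N then
    \prod_(1 <= k < n) bracket v (n%:Z * a + d%:Z + k%:Z) /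
     (\prod_(1 <= k < d.+1) bracket v k%:Z * \prod_(1 <= k < (n - d).+1) bracket v k%:Z)
  else 0.

(** For eta = (n), the factor 1 / (z_eta i^l(eta)) is 1 / (n i). *)
Definition one_point_ratC (n d : nat) : ratC R :=
  constC (n%:R * 'i)^-1 * one_point_frac q n d.

(** Stated for a general S because it serves twice: outside the unit disc, where F_n is identified,
    and on a punctured arc of the unit circle, where it is expanded. *)
Lemma evals_one_point (S : CC -> Prop) (v0 : CC) n d : S v0 -> (forall v, S v -> v != 0) ->
  (forall v k, S v -> (0 < k <= n)%N -> bracket v k%:Z != 0) ->
  evals S (one_point_ratC n d) (fun v => (n%:R * 'i)^-1 * one_point_frac v n d).
Proof.
move=> Sv0 S0 Sb; apply: evals_mul; first exact: evals_const.
have br (m : int) : evals S (bracket q m) (fun v => bracket v m).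
  apply: (evals_add Sv0); first by apply: (evals_exprz (f := id)) => //; exact: evals_qhalf.
  apply: evals_opp; apply: (evals_exprz (f := fun v => v^-1)) => [v Sv|].
    by rewrite invr_eq0 S0.
  by apply: (evals_inv (f := id)) => //; exact: evals_qhalf.
rewrite /one_point_frac; case: ifP => dn; last first.
  by have := evals_const S 0; rewrite /constC !rmorph0.
apply: evals_mul; first by apply: evals_prod => k _.
have pr m : evals S (\prod_(1 <= k < m.+1) bracket q k%:Z) (fun v => \prod_(1 <= k < m.+1) bracket v k%:Z).
  by apply: evals_prod => k _.
apply: evals_inv => [v Sv|]; last by apply: evals_mul.
rewrite mulf_neq0 // prodf_seq_neq0; apply/allP => k; rewrite mem_index_iota ltnS => /andP[k0 kd];
  apply: Sb; rewrite // k0 /=; lia.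
Qed.

Definition conifold_coef (d : nat) (v : CC) : CC :=
  \sum_(nu <- parts d) w_rho v^-1 nu * w_rho v^-1 (conj_part nu).

Lemma parts_part n mu : mu \in parts n -> is_part mu.
Proof. by rewrite mem_parts => /andP[]. Qed.

Lemma evals_qz (z : int) : evals (@out R) (q ^ z) (fun v => v ^ z).
Proof.
apply: (evals_exprz (f := id)); last exact: evals_qhalf.
by move=> v; apply: out_neq0.
Qed.

Lemma evals_Zopen eta d : evals (@out R) (Zopen R a d eta)
  (fun v => \sum_(mu <- parts (sumn eta) | mu \in parts (sumn eta)) \sum_(nu <- parts d | nu \in parts d)
    v ^ (a * kappa mu) * (w_rho v^-1 mu * schur_lim v mu nu) * w_rho v^-1 (conj_part nu) *
    (chi CC mu eta / ((zpart eta)%:R * 'i ^+ size eta))).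
Proof.
have o2 := @out2 R; rewrite /Zopen big_seq; apply: (evals_sum o2) => mu /parts_part pmu.
rewrite big_seq; apply: (evals_sum o2) => nu /parts_part pnu.
have W mu' : evals (@out R) (schur_q R [::] mu') (fun v => w_rho v^-1 mu').
  by apply: evals_ext (@schur_q_evals R [::] mu' isT) => v Sv; rewrite schur_lim0.
apply: evals_mul; last exact: evals_const.
apply: evals_mul; last exact: W.
apply: evals_mul; first exact: evals_qz.
by apply: evals_mul; [exact: W|apply: schur_q_evals].
Qed.

Lemma evals_Zopen_nil d : evals (@out R) (Zopen R a d [::]) (conifold_coef d).
Proof.
apply: evals_ext (evals_Zopen [::] d) => v Sv; rewrite -big_seq.
rewrite parts0 big_seq1 -big_seq; apply: eq_bigr => nu _.
have -> : kappa [::] = 0 by rewrite /kappa big_ord0.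
have -> : zpart [::] = 1%N by rewrite /zpart big_geq.
have -> : w_rho v^-1 [::] = 1 by rewrite /w_rho det_mx00.
have -> : chi CC [::] [::] / (1%:R * 'i ^+ size (nil : seq nat)) = 1.
  by rewrite chi_nil /= expr0 mulr1 divr1.
by rewrite mulr0 expr0z !mul1r mulr1 schur_lim0.
Qed.

Lemma evals_Zopen_cycle n d : (0 < n)%N -> evals (@out R) (Zopen R a d [:: n])
  (fun v => \sum_(j < d.+1) conifold_coef (d - j) v * ((n%:R * 'i)^-1 * one_point_frac v n j)).
Proof.
move=> n0; apply: evals_ext (evals_Zopen [:: n] d) => v Sv; rewrite -big_seq /= addn0 zpart1 // expr1.
have v0 : v != 0 := out_neq0 Sv; have c0 : v^-1 != 0 by rewrite invr_eq0.
pose G mu : CC := v ^ (a * kappa mu) * w_rho v^-1 mu * (chi CC mu [:: n] / (n%:R * 'i)).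
transitivity (\sum_(mu <- parts n) \sum_(j < d.+1)
    conifold_coef (d - j) v * (G mu * (box_poly v^-1 mu (size mu))`_j)).
  rewrite big_seq [RHS]big_seq; apply: eq_bigr => mu /parts_part pmu.
  rewrite -big_seq; transitivity (G mu * \sum_(nu <- parts d) schur_lim v mu nu * w_rho v^-1 (conj_part nu)).
    by rewrite mulr_sumr; apply: eq_bigr => nu _; rewrite /G; ring.
  rewrite conifold_sum_lim // mulr_sumr; apply: eq_bigr => j _.
  by rewrite /conifold_coef; ring.
rewrite exchange_big /=; apply: eq_bigr => j _; rewrite -mulr_sumr; congr (_ * _).
rewrite (sum_hooks (G := fun mu => G mu * (box_poly v^-1 mu (size mu))`_j)) //; last first.
  move=> mu; rewrite mem_parts => /andP[pmu /eqP sm] h.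
  by have := chi_cycle_nonhook pmu CC h; rewrite sm /G => ->; rewrite mul0r mulr0 mul0r.
have := hook_sum c0 (out_root Sv) a j n0; rewrite invrK => E.
rewrite /one_point_frac -E mulr_sumr; apply: eq_bigr => b _; rewrite /G size_hook.
have e : n = sumn (hook_part (n.-1 - b) b) by rewrite sumn_hook; have := ltn_ord b; lia.
have X : chi CC (hook_part (n.-1 - b) b) [:: n] = (-1) ^+ b.
  by have := chi_cycle_hook (n.-1 - b) b CC; rewrite -e.
by rewrite X; ring.
Qed.

Lemma Zopen_cycle n d : (0 < n)%N ->
  Zopen R a d [:: n] = \sum_(j < d.+1) Zopen R a (d - j)%N [::] * one_point_ratC n j.
Proof.
move=> n0; have o2 := @out2 R.
apply: (evals_inj o2 (@out_inf R) (evals_Zopen_cycle d n0)).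
apply: (evals_sum o2) => j _; apply: evals_mul; first exact: evals_Zopen_nil.
apply: (@evals_one_point (@out R) 2 n j o2) => [v|v k Sv /andP[k0 _]]; first exact: out_neq0.
(* A zero of the bracket would make v^-2 a root of unity. *)
rewrite /bracket subr_eq0 -!exprnP; apply: contraNneq (out_root Sv k0) => e.
by rewrite exprAC expr2 -{1}e -exprMn divff ?expr1n ?out_neq0.
Qed.

(** In degree 0 only empty partitions contribute, so the value at the sample point v = 2 is 1. *)
Lemma Zopen0_neq0 : Zopen R a 0 [::] != 0.
Proof.
have [P [D [-> H]]] := evals_Zopen_nil 0; have [D0 e] := H _ (@out2 R).
have c1 : conifold_coef 0 2 = 1.
  have w1 : w_rho (2 : CC)^-1 [::] = 1 by rewrite /w_rho det_mx00.
  by rewrite /conifold_coef parts0 big_seq1 [conj_part _]/= w1 mulr1.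
have P0 : P.[2] != 0 by apply: contraTneq isT => p0; move: e; rewrite c1 p0 mul0r => /eqP; rewrite oner_eq0.
have nz (p : {poly CC}) : p.[2] != 0 -> FracField.tofrac p != 0.
  by move=> p0; rewrite tofrac_eq0; apply: contraNneq p0 => ->; rewrite horner0.
by rewrite mulf_neq0 ?invr_neq0 ?nz.
Qed.

Lemma Fone_eq n d : (0 < n)%N -> Fone R a n d = one_point_ratC n d.
Proof.
move=> n0; apply: log_quotient_one_point => //; first exact: Zopen0_neq0.
by move=> e; apply: Zopen_cycle.
Qed.

End OnePoint.

(** * Expansion at lambda = 0 *)

Section EvenExpansion.
Variable R : realType.
Implicit Types (f g : R -> R) (a b c e : nat -> R).

Lemma le_of_eq (x y : R) : x = y -> x <= y.
Proof. by move=> ->. Qed.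

Definition psum c (y : R) N := \sum_(k < N) c k * y ^+ k.

Definition cauchy_coef a b (k : nat) : R := \sum_(i < k.+1) a i * b (k - i)%N.

(* f(l) = sum of c_k l^(2k) for l <> 0 near 0, with geometric control of the
   coefficients and of the remainders. *)
Definition even_expansion f c := exists2 M : R, 0 < M &
  (forall k, `|c k| <= M * M ^+ k) /\
  forall N l, l != 0 -> l ^+ 2 * M < 1 ->
    `|f l - psum c (l ^+ 2) N| <= M * (M * l ^+ 2) ^+ N.

Lemma psumS c y N : psum c y N.+1 = psum c y N + c N * y ^+ N.
Proof. by rewrite /psum big_ord_recr. Qed.

Lemma psum0 c y : psum c y 0 = 0.
Proof. by rewrite /psum big_ord0. Qed.

Lemma psum_cauchy a b y N :
  psum (cauchy_coef a b) y N = \sum_(i < N) a i * y ^+ i * psum b y (N - i).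
Proof.
elim: N => [|N IH]; first by rewrite psum0 big_ord0.
rewrite psumS IH [RHS](eq_bigr (fun i : 'I_N.+1 => a i * y ^+ i * psum b y (N - i)%N + a i * b (N - i)%N * y ^+ N)).
  rewrite big_split /= big_ord_recr /= subnn psum0 mulr0 addr0; congr (_ + _).
  by rewrite /cauchy_coef mulr_suml.
move=> i _; have iN : (i <= N)%N by rewrite -ltnS.
rewrite subSn // psumS mulrDr; congr (_ + _).
have -> : y ^+ N = y ^+ i * y ^+ (N - i) by rewrite -exprD subnKC.
ring.
Qed.

Lemma natr_le_exp2 N : N.+1%:R <= 2 ^+ N :> R.
Proof. by rewrite -natrX ler_nat ltn_expl. Qed.

Lemma expansion_le (M M' : R) f c : 0 < M -> M <= M' ->
  (forall k, `|c k| <= M * M ^+ k) /\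
  (forall N l, l != 0 -> l ^+ 2 * M < 1 -> `|f l - psum c (l ^+ 2) N| <= M * (M * l ^+ 2) ^+ N) ->
  (forall k, `|c k| <= M' * M' ^+ k) /\
  (forall N l, l != 0 -> l ^+ 2 * M' < 1 -> `|f l - psum c (l ^+ 2) N| <= M' * (M' * l ^+ 2) ^+ N).
Proof.
move=> M0 MM [Hc Hf]; have M0' : 0 <= M' := le_trans (ltW M0) MM.
split=> [k|N l l0 lM].
  by apply: le_trans (Hc k) _; rewrite -!exprS lerXn2r // nnegrE ltW.
have y0 : 0 <= l ^+ 2 by apply: sqr_ge0.
apply: le_trans (Hf N l l0 _) _; first by apply: le_lt_trans lM; apply: ler_wpM2l.
apply: ler_pM => //; first exact: ltW.
  by rewrite exprn_ge0 // mulr_ge0 // ltW.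
by apply: lerXn2r; rewrite ?nnegrE; [apply: mulr_ge0 => //; apply: ltW|exact: mulr_ge0|exact: ler_wpM2r].
Qed.

Lemma expansion_cst z : even_expansion (fun=> z) (fun k => if k is 0 then z else 0).
Proof.
exists (`|z| + 1); first by rewrite ltr_wpDl.
have M0 : 0 <= `|z| + 1 by rewrite addr_ge0.
split=> [[|k]|[|N] l l0 _].
- by rewrite expr0 mulr1 lerDl.
- by rewrite normr0 mulr_ge0 ?exprn_ge0.
- by rewrite psum0 subr0 expr0 mulr1 lerDl.
rewrite /psum big_ord_recl big1 => [|i _]; last by rewrite /= mul0r.
by rewrite /= expr0 mulr1 addr0 subrr normr0 mulr_ge0 // exprn_ge0 // mulr_ge0 // sqr_ge0.
Qed.

(** The Cauchy product has k + 1 terms, each at most M^2 M^k, and k + 1 <= 2^k; this explains M' = 2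
    M + M^2. The remainder is the remainder of f times g plus the a_i y^i times remainders of g. *)
Lemma expansion_mul f g a b : even_expansion f a -> even_expansion g b ->
  even_expansion (fun l => f l * g l) (cauchy_coef a b).
Proof.
move=> [M1 M10 H1] [M2 M20 H2]; pose M := M1 + M2.
have M0 : 0 < M by rewrite addr_gt0.
have MM1 : M1 <= M by rewrite lerDl ltW.
have MM2 : M2 <= M by rewrite lerDr ltW.
have [Ha Hf] := expansion_le M10 MM1 H1.
have [Hb Hg] := expansion_le M20 MM2 H2.
have M2M : 0 < M ^+ 2 by rewrite exprn_gt0.
pose M' := 2 * M + M ^+ 2; have M'0 : 0 < M' by rewrite addr_gt0 ?mulr_gt0.
have le1 : M ^+ 2 <= M' by rewrite lerDr mulr_ge0 // ltW.
have le2 : 2 * M <= M' by rewrite lerDl ltW.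
exists M' => //; split=> [k|N l l0 lM].
  apply: (@le_trans _ _ (M ^+ 2 * (2 * M) ^+ k)); last first.
    by apply: ler_pM; rewrite ?lerXn2r ?nnegrE ?exprn_ge0 ?mulr_ge0 // ltW.
  apply: le_trans (ler_norm_sum _ _ _) _.
  apply: (@le_trans _ _ (\sum_(i < k.+1) M ^+ 2 * M ^+ k)).
    apply: ler_sum => i _; have ik : (i <= k)%N by rewrite -ltnS.
    rewrite normrM; apply: le_trans (ler_pM _ _ (Ha i) (Hb (k - i)%N)) _ => //.
    by rewrite -[in leRHS](subnKC ik) exprD expr2; apply: le_of_eq; ring.
  rewrite sumr_const card_ord -[leLHS]mulr_natl [X in _ <= _ * X]exprMn mulrCA ler_wpM2l ?(ltW M2M) //.
  by rewrite ler_wpM2r ?natr_le_exp2 ?exprn_ge0 // ltW.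
set y := l ^+ 2; have y0 : 0 <= y := sqr_ge0 l.
have lM1 : y * M < 1.
  by apply: le_lt_trans lM; apply: ler_wpM2l => //; apply: le_trans le2; rewrite ler_peMl ?ler1n // ltW.
have My0 : 0 <= M * y by rewrite mulr_ge0 // ltW.
have -> : f l * g l - psum (cauchy_coef a b) y N =
   (f l - psum a y N) * g l + \sum_(i < N) a i * y ^+ i * (g l - psum b y (N - i)).
  rewrite psum_cauchy [X in _ = _ + X](eq_bigr (fun i : 'I_N => a i * y ^+ i * g l - a i * y ^+ i * psum b y (N - i))) => [|i _]; last by rewrite mulrBr.
  rewrite sumrB -mulr_suml -/(psum a y N); ring.
apply: (@le_trans _ _ (M ^+ 2 * (2 * (M * y)) ^+ N)); last first.
  apply: ler_pM => //; [exact: ltW|by rewrite exprn_ge0 // mulr_ge0|].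
  apply: lerXn2r; rewrite ?nnegrE; [exact: mulr_ge0| |by rewrite mulrA ler_wpM2r].
  by apply: mulr_ge0 => //; apply: ltW.
apply: (@le_trans _ _ (N.+1%:R * (M ^+ 2 * (M * y) ^+ N))); last first.
  by rewrite [X in _ <= _ * X]exprMn mulrCA ler_wpM2l ?(ltW M2M) // ler_wpM2r ?natr_le_exp2 ?exprn_ge0.
rewrite mulr_natl mulrS; apply: le_trans (ler_normD _ _) _; apply: lerD.
  rewrite normrM; have := Hg 0%N l l0 lM1; rewrite psum0 subr0 expr0 mulr1 => hg.
  by apply: le_trans (ler_pM _ _ (Hf N l l0 lM1) hg) _ => //; apply: le_of_eq; ring.
apply: le_trans (ler_norm_sum _ _ _) _.
have -> : M ^+ 2 * (M * y) ^+ N *+ N = \sum_(i < N) M ^+ 2 * (M * y) ^+ N.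
  by rewrite sumr_const card_ord.
apply: ler_sum => i _.
have iN : (i <= N)%N by apply: ltnW.
rewrite !normrM normrX (ger0_norm y0).
apply: le_trans (ler_pM _ _ (ler_wpM2r _ (Ha i)) (Hg (N - i)%N l l0 lM1)) _ => //.
- by apply: mulr_ge0 => //; apply: exprn_ge0.
- by rewrite exprn_ge0.
by rewrite -[in leRHS](subnKC iN) exprD !exprMn expr2 -/y; apply: le_of_eq; ring.
Qed.

(* The reciprocal of a power series is the part of series_inv without p. *)
Lemma cauchy_inverse c : c 0%N != 0 -> exists e, forall k, cauchy_coef c e k = (k == 0%N)%:R.
Proof.
move=> c0; exists (fun k => series_inv (fun d _ => c d) k [::]) => k.
exact: (@series_inv_nil R (fun d _ => c d)).
Qed.

(** L is chosen with L - M = M^2 / |c_0|: the recursion for e then telescopes to a difference of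
    powers of L and M. *)
Lemma cauchy_inverse_bound c e (M : R) : 0 < M -> c 0%N != 0 ->
  (forall k, `|c k| <= M * M ^+ k) -> (forall k, cauchy_coef c e k = (k == 0%N)%:R) ->
  let L := M * (1 + M / `|c 0%N|) in forall k, `|e k| <= `|c 0%N|^-1 * L ^+ k.
Proof.
move=> M0 c0 Hc He L; set E := `|c 0%N|^-1.
have E0 : 0 < E by rewrite invr_gt0 normr_gt0.
have L0 : 0 < L by rewrite mulr_gt0 // addr_gt0 // mulr_gt0.
have geo k : E * M * \sum_(i < k) M ^+ i.+1 * L ^+ (k.-1 - i) <= L ^+ k.
  have LM : L - M = E * M * M by rewrite /L -/E; ring.
  have Mn : M != 0 by rewrite gt_eqF.
  have -> : E * M * \sum_(i < k) M ^+ i.+1 * L ^+ (k.-1 - i) = (L - M) * \sum_(i < k) L ^+ (k.-1 - i) * M ^+ i.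
    by rewrite LM !mulr_sumr; apply: eq_bigr => i _; rewrite exprS; ring.
  by rewrite -subrXX lerBlDr lerDl exprn_ge0 // ltW.
elim/ltn_ind => -[|k] IH.
  have := He 0%N; rewrite /cauchy_coef big_ord_recl big_ord0 addr0 /= => e0.
  by rewrite expr0 mulr1 -(mulKf c0 (e 0%N)) e0 mulr1 normfV.
have ek : e k.+1 = - (c 0%N)^-1 * \sum_(i < k.+1) c i.+1 * e (k - i)%N.
  have := He k.+1; rewrite /cauchy_coef big_ord_recl /= subn0 => /eqP; rewrite addr_eq0 => /eqP h.
  by rewrite -(mulKf c0 (e k.+1)) h mulrN mulNr.
rewrite ek normrM normrN normfV -/E; apply: ler_wpM2l; first exact: ltW.
apply: le_trans (ler_norm_sum _ _ _) _; apply: le_trans (geo k.+1).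
rewrite mulr_sumr; apply: ler_sum => i _; rewrite normrM /=.
apply: le_trans (ler_pM _ _ (Hc i.+1) (IH (k - i)%N _)) _ => //.
  by rewrite ltnS leq_subr.
by apply: le_of_eq; ring.
Qed.

Lemma expansion_inv f c : c 0%N != 0 -> even_expansion f c ->
  exists e, e 0%N = (c 0%N)^-1 /\ even_expansion (fun l => (f l)^-1) e.
Proof.
move=> c0 [M M0 [Hc Hf]]; have [e He] := cauchy_inverse c0; exists e.
have e0 : e 0%N = (c 0%N)^-1.
  have := He 0%N; rewrite /cauchy_coef big_ord_recl big_ord0 addr0 /= => h.
  by rewrite -(mulKf c0 (e 0%N)) h mulr1.
split=> //; have /= := cauchy_inverse_bound M0 c0 Hc He.
set E := `|c 0%N|^-1; set L := M * _ => Hb.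
have E0 : 0 < E by rewrite invr_gt0 normr_gt0.
have ML : M <= L by rewrite ler_peMr ?(ltW M0) // lerDl mulr_ge0 // ltW.
have L0 : 0 < L := lt_le_trans M0 ML.
(* 2 L is the ratio for the remainders, 2 E bounds 1 / f, 2 M^2 E forces |f| >= |c_0| / 2, and 2 E^2
   M is the factor in front of the remainder. *)
pose M' := M + 2 * L + (2 * E + (2 * E ^+ 2 * M + 2 * M ^+ 2 * E)).
have p1 : 0 < 2 * E ^+ 2 * M by rewrite !mulr_gt0 // exprn_gt0.
have p2 : 0 < 2 * M ^+ 2 * E by rewrite !mulr_gt0 // exprn_gt0.
have [le1 le2 le3 le4 le5] : [/\ M <= M', 2 * L <= M', 2 * E <= M', 2 * E ^+ 2 * M <= M' & 2 * M ^+ 2 * E <= M'].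
  by rewrite /M'; split; lra.
have M'0 : 0 < M' := lt_le_trans M0 le1.
exists M' => //; split=> [k|N l l0 lM].
  apply: le_trans (Hb k) _; apply: ler_pM; rewrite ?exprn_ge0 ?(ltW E0) ?(ltW L0) //; first lra.
  by rewrite lerXn2r ?nnegrE ?(ltW L0) ?(ltW M'0) //; lra.
set y := l ^+ 2 in lM *; have y0 : 0 <= y := sqr_ge0 l.
have Ly0 : 0 <= L * y by rewrite mulr_ge0 // ltW.
have lM1 : y * M < 1 by apply: le_lt_trans lM; apply: ler_wpM2l.
have small : `|f l - c 0%N| <= `|c 0%N| / 2.
  have := Hf 1%N l l0 lM1; rewrite psumS psum0 add0r expr0 mulr1 expr1 => h.
  apply: le_trans h _; have : y * (2 * M ^+ 2 * E) <= 1.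
    by apply: le_trans (ltW lM); apply: ler_wpM2l.
  rewrite ler_pdivlMr // /E mulrA ler_pdivrMr ?normr_gt0 // mul1r -/y => h.
  by apply: le_trans h; apply: le_of_eq; ring.
have fbig : `|c 0%N| / 2 <= `|f l|.
  have := ler_normB (f l) (f l - c 0%N); rewrite subKr; move: small.
  by move: (`|_ - _|) (`|c 0%N|) (`|f l|) => u v w; lra.
have c00 : 0 < `|c 0%N| by rewrite normr_gt0.
have f0 : 0 < `|f l| by apply: lt_le_trans fbig; rewrite divr_gt0.
have fi : `|(f l)^-1| <= 2 * E.
  rewrite normfV -[2 * E]invrK lef_pV2 ?posrE ?invr_gt0 ?mulr_gt0 //.
  by rewrite invfM invrK mulrC.
case: N => [|N]; first by rewrite psum0 subr0 expr0 mulr1; apply: le_trans fi _.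
have fn : f l != 0 by rewrite -normr_gt0.
(* The Cauchy product of e and c is 1, so only the remainders of f survive. *)
have key : (f l)^-1 - psum e y N.+1 =
    - (f l)^-1 * \sum_(j < N.+1) e j * y ^+ j * (f l - psum c y (N.+1 - j)).
  rewrite (eq_bigr (fun i : 'I_N.+1 => e i * y ^+ i * f l - e i * y ^+ i * psum c y (N.+1 - i))) => [|i _]; last by rewrite mulrBr.
  rewrite sumrB -mulr_suml -/(psum e y N.+1) -psum_cauchy.
  have -> : psum (cauchy_coef e c) y N.+1 = 1.
    rewrite /psum big_ord_recl big1 => [|i _].
      by rewrite expr0 mulr1 addr0 /cauchy_coef big_ord_recl big_ord0 addr0 e0 mulVf.
    rewrite [X in X * _](_ : _ = 0) ?mul0r //.
    rewrite -[RHS](He (lift ord0 i)) /cauchy_coef (reindex_inj rev_ord_inj) /=.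
    apply: eq_bigr => j _; rewrite mulrC subSS; congr (_ * e _).
    by rewrite subKn // -ltnS ltn_ord.
  by field.
rewrite key normrM normrN.
apply: (@le_trans _ _ (2 * E * (N.+2%:R * (E * M * (L * y) ^+ N.+1)))); last first.
  apply: (@le_trans _ _ (2 * E ^+ 2 * M * (2 * (L * y)) ^+ N.+1)); last first.
    apply: ler_pM => //; [exact: ltW|by rewrite exprn_ge0 // mulr_ge0|].
    apply: lerXn2r; rewrite ?nnegrE; [exact: mulr_ge0| |by rewrite mulrA ler_wpM2r].
    by apply: mulr_ge0 => //; apply: ltW.
  rewrite [X in _ <= _ * X]exprMn.
  apply: (@le_trans _ _ (2 * E ^+ 2 * M * (N.+2%:R * (L * y) ^+ N.+1))).
    by apply: le_of_eq; ring.
  by rewrite ler_wpM2l ?(ltW p1) // ler_wpM2r ?natr_le_exp2 ?exprn_ge0.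
apply: ler_pM => //; apply: le_trans (ler_norm_sum _ _ _) _.
apply: (@le_trans _ _ (\sum_(j < N.+1) E * M * (L * y) ^+ N.+1)); last first.
  rewrite sumr_const card_ord -[leLHS]mulr_natl ler_wpM2r ?ler_nat //.
  by rewrite !mulr_ge0 ?exprn_ge0 // ltW.
apply: ler_sum => i _; have iN : (i <= N.+1)%N by apply: ltnW.
rewrite !normrM normrX (ger0_norm y0).
apply: le_trans (ler_pM _ _ (ler_wpM2r _ (Hb i)) (Hf (N.+1 - i)%N l l0 lM1)) _ => //.
- by apply: mulr_ge0 => //; apply: exprn_ge0.
- by rewrite exprn_ge0.
rewrite -/y -[in leRHS](subnKC iN) [in leRHS]exprD.
have -> : E * L ^+ i * y ^+ i * (M * (M * y) ^+ (N.+1 - i)) = E * M * ((L * y) ^+ i * (M * y) ^+ (N.+1 - i)).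
  by rewrite [(L * y) ^+ i]exprMn; ring.
rewrite ler_wpM2l ?mulr_ge0 ?(ltW E0) ?(ltW M0) // ler_wpM2l ?exprn_ge0 //.
by apply: lerXn2r; rewrite ?nnegrE ?ler_wpM2r //; apply: mulr_ge0 => //; apply: ltW.
Qed.

End EvenExpansion.

(** * Constant terms of even expansions and their uniqueness *)

Section LeadingTerm.
Variable R : realType.
Implicit Types (f g : R -> R) (c : nat -> R).

Lemma sum_geometric_le (K t : R) m : 0 <= K -> 0 <= t <= 2^-1 ->
  \sum_(i < m) K * t ^+ i <= 2 * K.
Proof.
move=> K0 /andP[t0 t1]; rewrite -mulr_sumr mulrC; apply: ler_wpM2r => //.
have := subrX1 t m; have : 0 <= t ^+ m by rewrite exprn_ge0.
have : 0 <= \sum_(i < m) t ^+ i by apply: sumr_ge0 => i _; rewrite exprn_ge0.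
move: (t ^+ m) (\sum_(i < m) _) => u s; nra.
Qed.

(** The choice of M forces B y <= 1/2 for y = l^2, so the tail from N on is at most 2 A (B y)^N by
    comparison with a geometric series. *)
Lemma even_expansion_of_cvg f c (A B : R) : 0 <= A -> 0 <= B ->
  (forall k, `|c k| <= A * B ^+ k) ->
  (forall l, l != 0 -> (series (fun k => c k * (l ^+ 2) ^+ k) n @[n --> \oo] --> f l)%classic) ->
  even_expansion f c.
Proof.
move=> A0 B0 Hc Hf; pose M := 1 + 2 * A + 2 * B.
have M0 : 0 < M by rewrite /M; lra.
exists M => //; split=> [k|N l l0 lM].
  apply: le_trans (Hc k) _; apply: ler_pM => //; first by rewrite exprn_ge0.
    by rewrite /M; lra.
  by apply: lerXn2r; rewrite ?nnegrE ?(ltW M0) // /M; lra.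
set y := l ^+ 2 in lM *; have y0 : 0 <= y := sqr_ge0 l.
have By0 : 0 <= B * y by rewrite mulr_ge0.
have By1 : B * y <= 2^-1 by move: lM; rewrite /M; nra.
apply: (@le_trans _ _ (2 * A * (B * y) ^+ N)); last first.
  apply: ler_pM; rewrite ?exprn_ge0 //; [by rewrite mulr_ge0|by rewrite /M; lra|].
  apply: lerXn2r; rewrite ?nnegrE //; first by rewrite mulr_ge0 // ltW.
  by rewrite ler_wpM2r // /M; lra.
apply/ler_addgt0Pr => eps eps0.
have /cvgrPdist_lt/(_ eps eps0)[n0 _ Hn0] := Hf l l0.
have /= := Hn0 (N + n0)%N (leq_addl _ _); rewrite /series /= big_mkord -/y -/(psum c y (N + n0)) => h.
have tail m : `|psum c y (N + m) - psum c y N| <= 2 * A * (B * y) ^+ N.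
  have -> : psum c y (N + m) - psum c y N = \sum_(i < m) c (N + i)%N * y ^+ (N + i).
    have E : psum c y (N + m) = psum c y N + \sum_(i < m) c (N + i)%N * y ^+ (N + i).
      by rewrite /psum big_split_ord.
    by rewrite E [LHS]addrC addKr.
  apply: le_trans (ler_norm_sum _ _ _) _.
  apply: (@le_trans _ _ (\sum_(i < m) A * (B * y) ^+ N * (B * y) ^+ i)).
    apply: ler_sum => i _; rewrite normrM normrX (ger0_norm y0).
    apply: le_trans (ler_wpM2r (exprn_ge0 _ y0) (Hc (N + i)%N)) _.
    by rewrite -[leLHS]mulrA -[in leLHS]exprMn exprD mulrA.
  rewrite -mulrA; apply: sum_geometric_le; last by rewrite By0.
  by apply: mulr_ge0 => //; apply: exprn_ge0.
have -> : f l - psum c y N = (f l - psum c y (N + n0)) + (psum c y (N + n0) - psum c y N) by ring.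
apply: le_trans (ler_normD _ _) _; rewrite addrC; apply: lerD; [exact: tail|exact: ltW].
Qed.

Definition leading f (z : R) := exists2 c, c 0%N = z & even_expansion f c.

Lemma leading_cst z : leading (fun=> z) z.
Proof. by exists (fun k => if k is 0 then z else 0) => //; exact: expansion_cst. Qed.

Lemma leading_mul f g x y : leading f x -> leading g y -> leading (fun l => f l * g l) (x * y).
Proof.
move=> [a <- Ha] [b <- Hb]; exists (cauchy_coef a b); last exact: expansion_mul.
by rewrite /cauchy_coef big_ord_recl big_ord0 addr0.
Qed.

Lemma leading_inv f x : x != 0 -> leading f x -> leading (fun l => (f l)^-1) x^-1.
Proof.
by move=> x0 [c cx Hc]; rewrite -cx in x0 *; have [e [e0 He]] := expansion_inv x0 Hc; exists e.
Qed.

Lemma leading_prod (I : Type) (r : seq I) (f : I -> R -> R) (x : I -> R) :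
  (forall i, leading (f i) (x i)) ->
  leading (fun l => \prod_(i <- r) f i l) (\prod_(i <- r) x i).
Proof.
move=> H; elim: r => [|i r IH].
  have -> : (fun l : R => \prod_(i <- [::]) f i l) = fun=> 1 by apply/funext => l; rewrite big_nil.
  by rewrite big_nil; apply: leading_cst.
have -> : (fun l => \prod_(j <- i :: r) f j l) = fun l => f i l * \prod_(j <- r) f j l.
  by apply/funext => l; rewrite big_cons.
by rewrite big_cons; apply: leading_mul.
Qed.

Lemma leading_sin (m : R) : leading (fun l => 2 * sin (m * (l / 2)) / l) m.
Proof.
pose B := (m / 2) ^+ 2; pose c k : R := (-1) ^+ k * (m * B ^+ k) / k.*2.+1`!%:R.
exists c; first by rewrite /c !expr0 mul1r mulr1 divr1.
have B0 : 0 <= B := sqr_ge0 _.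
apply: (@even_expansion_of_cvg _ _ `|m| B) => // [k|l l0].
  rewrite /c !normrM normrX normrN normr1 expr1n mul1r (ger0_norm (exprn_ge0 _ B0)).
  apply: ler_piMr; first by apply: mulr_ge0 => //; apply: exprn_ge0.
  by rewrite normfV ger0_norm ?ler0n // invf_le1 ?ler1n ?ltr0n ?fact_gt0.
rewrite (_ : (fun n => _) = (fun n => (2 / l) * series (sin_coeff' (m * (l / 2))) n)).
  have -> : 2 * sin (m * (l / 2)) / l = (2 / l) * sin (m * (l / 2)) by rewrite mulrAC.
  by apply: cvgMr; exact: cvg_sin_coeff'.
apply/funext => n; rewrite /series /= mulr_sumr; apply: eq_bigr => k _.
set x := m * (l / 2).
have x2 : x ^+ 2 = B * l ^+ 2 by rewrite /x /B; field.
have xk : x ^+ k.*2.+1 = x * (B ^+ k * (l ^+ 2) ^+ k).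
  by rewrite [LHS]exprS -mul2n exprM x2 exprMn.
rewrite /c /sin_coeff' -exprnP -/x xk /x; move: (l ^+ 2 ^+ k) => z.
by field; rewrite l0 pnatr_eq0 -lt0n fact_gt0.
Qed.

Lemma even_expansion_cvg f c : even_expansion f c -> exists2 r : R, 0 < r &
  forall l, 0 < `|l| < r -> forall eps, 0 < eps ->
    exists n0, forall n, (n0 <= n)%N -> `|f l - psum c (l ^+ 2) n| < eps.
Proof.
move=> [M M0 [_ Hf]]; exists (M + 1)^-1; first by rewrite invr_gt0; lra.
move=> l /andP[l0 lr] eps eps0.
have {}lr : `|l| * (M + 1) < 1 by rewrite -ltr_pdivlMr ?mul1r //; lra.
have lM : l ^+ 2 * M < 1 by rewrite -real_normK ?num_real //; nra.
have My0 : 0 <= M * l ^+ 2 by rewrite mulr_ge0 ?sqr_ge0 // ltW.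
have My1 : `|M * l ^+ 2| < 1 by rewrite ger0_norm // mulrC.
have e0 : 0 < eps / M by rewrite divr_gt0.
have /cvgrPdist_lt/(_ _ e0)[n0 _ Hn0] := cvg_expr My1.
exists n0 => n n0n; apply: le_lt_trans (Hf n l _ lM) _; first by rewrite -normr_gt0.
have := Hn0 n n0n; rewrite /= sub0r normrN ger0_norm ?exprn_ge0 //.
by rewrite ltr_pdivlMr // mulrC.
Qed.

(** Nothing is known of u beyond the limits. At l0 = r / 2 they bound the terms by some K; at s l0
    the terms after the first add up to at most 2 K s, and s is chosen to make this smaller than a
    nonzero |u_0|. *)
Lemma constant_term_unique (u : nat -> R) (r : R) : 0 < r ->
  (forall l, 0 < `|l| < r -> forall eps, 0 < eps ->
    exists n0, forall n, (n0 <= n)%N -> `|psum u (l ^+ 2) n| < eps) -> u 0%N = 0.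
Proof.
move=> r0 H; pose l0 := r / 2; pose y0 := l0 ^+ 2.
have l00 : 0 < l0 by rewrite divr_gt0.
have l0r : l0 < r by rewrite /l0; lra.
have y00 : 0 < y0 by rewrite exprn_gt0.
have [K K0 HK] : exists2 K, 0 < K & forall k, `|u k * y0 ^+ k| <= K.
  have [|n0 Hn0] := H l0 _ 1 ltr01; first by rewrite gtr0_norm // l00.
  exists (2 + \sum_(k < n0) `|u k * y0 ^+ k|).
    by rewrite ltr_wpDr // sumr_ge0.
  move=> k; case: (ltnP k n0) => kn.
    rewrite (bigD1 (Ordinal kn)) //= addrCA lerDl addr_ge0 // sumr_ge0 //.
  apply: (@le_trans _ _ 2); last by rewrite lerDl sumr_ge0.
  have -> : u k * y0 ^+ k = psum u y0 k.+1 - psum u y0 k by rewrite psumS addrC addKr.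
  have h1 := Hn0 k kn; have h2 := Hn0 k.+1 (leqW kn).
  apply: le_trans (ler_normB _ _) _; rewrite -/y0 in h1 h2; move: h1 h2.
  by move: (`|psum _ _ k|) (`|psum _ _ k.+1|) => p1 p2; lra.
apply/eqP; apply: contraT; rewrite -normr_gt0 => u0.
pose s := `|u 0%N| / (2 * K + 2 * `|u 0%N|).
have den : 0 < 2 * K + 2 * `|u 0%N| by lra.
have s0 : 0 < s by rewrite divr_gt0.
have s1 : s <= 2^-1 by rewrite ler_pdivrMr //; lra.
have s2 : 2 * K * s < `|u 0%N|.
  by rewrite mulrA ltr_pdivrMr //; nra.
have s3 : s ^+ 2 <= s by rewrite expr2; nra.
have eps0 : 0 < `|u 0%N| - 2 * K * s by rewrite subr_gt0.
have [|n0 Hn0] := H (s * l0) _ _ eps0.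
  have sl : 0 < s * l0 by apply: mulr_gt0.
  rewrite (gtr0_norm sl) sl /=; apply: le_lt_trans l0r; apply: ler_piMl; [exact: ltW|lra].
have := Hn0 n0.+1 (leqnSn _); rewrite ltNge => /negP[].
rewrite /psum big_ord_recl expr0 mulr1 lerBlDr.
set X := \sum_(i < n0) _.
have hX : `|X| <= 2 * K * s.
  apply: le_trans (ler_norm_sum _ _ _) _.
  apply: (@le_trans _ _ (\sum_(i < n0) K * s * (s ^+ 2) ^+ i)).
    apply: ler_sum => i _; 
    have -> : (s * l0) ^+ 2 ^+ lift ord0 i = y0 ^+ i.+1 * (s ^+ 2) ^+ i.+1.
      by rewrite -[RHS]exprMn; congr (_ ^+ _); rewrite /y0; ring.
    rewrite mulrA normrM -[K * s * _]mulrA; apply: ler_pM => //.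
    rewrite ger0_norm; last by apply: exprn_ge0; apply: sqr_ge0.
    by rewrite [leLHS]exprS; apply: ler_wpM2r => //; apply: exprn_ge0; apply: sqr_ge0.
  rewrite -mulrA; apply: sum_geometric_le; first by rewrite mulr_ge0 // ltW.
  by rewrite sqr_ge0 (le_trans s3).
have := ler_normB (u 0%N + X) X; rewrite addrK; move: hX.
by move: (`|X|) (`|u 0%N + X|) => p1 p2; lra.
Qed.

End LeadingTerm.

(** * Values on the unit circle and the genus zero coefficient *)

Section GenusZero.
Variable R : realType.
Local Notation CC := (C R).

Definition expi (x : R) : CC := (cos x +i* sin x)%C.

Lemma expiD x y : expi (x + y) = expi x * expi y.
Proof.
by rewrite /expi cosD sinD; apply/eqP; rewrite eq_complex /= eqxx /= addrC [X in X + _]mulrC [X in _ + X]mulrC.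
Qed.

Lemma expi0 : expi 0 = 1.
Proof. by rewrite /expi cos0 sin0. Qed.

Lemma expiV x : (expi x)^-1 = expi (- x).
Proof.
have e : expi x * expi (- x) = 1 by rewrite -expiD subrr expi0.
have n0 : expi x != 0.
  by apply: contraTneq isT => h; move/eqP: e; rewrite h mul0r eq_sym oner_eq0.
by rewrite -[LHS]mulr1 -e mulKf.
Qed.

Lemma expi_exprz x (m : int) : expi x ^ m = expi (m%:~R * x).
Proof.
have nat_case k : expi x ^+ k = expi (k%:R * x).
  elim: k => [|k IH]; first by rewrite expr0 mul0r expi0.
  by rewrite exprS IH -expiD -{1}[x]mul1r -mulrDl -natr1 addrC.
case: m => k; first by rewrite -exprnP nat_case.
by rewrite -[LHS]/((expi x ^+ k.+1)^-1) nat_case expiV NegzE mulrNz mulNr.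
Qed.

Lemma bracket_expi x (m : int) :
  bracket (expi x) m = 'i * (2 * sin (m%:~R * x))%:C%C.
Proof.
rewrite /bracket expiV !expi_exprz mulrN /expi cosN sinN -complexiE.
apply/eqP; rewrite eq_complex /=; apply/andP; split; apply/eqP; ring.
Qed.

Definition sin_quotient (m : int) (l : R) : R := 2 * sin (m%:~R * (l / 2)) / l.

Lemma bracket_expi_half l (m : int) : l != 0 ->
  bracket (expi_half l) m = 'i * l%:C%C * (sin_quotient m l)%:C%C.
Proof.
move=> l0; rewrite -[expi_half l]/(expi (l / 2)) bracket_expi /sin_quotient -mulrA -rmorphM.
by congr (_ * _%:C%C); field.
Qed.

Lemma expi_half_neq0 l : expi_half l != 0 :> CC.
Proof.
by rewrite -invr_eq0 -[expi_half l]/(expi (l / 2)); apply: contraTneq isT => h; have := expiD (l / 2) (- (l / 2)); rewrite subrr expi0 -expiV h mulr0 => /eqP; rewrite oner_eq0.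
Qed.

Definition one_point_real (a : int) (n d : nat) (l : R) : R :=
  if (d <= n)%N then
    - n%:R^-1 * (\prod_(1 <= k < n) sin_quotient (n%:Z * a + d%:Z + k%:Z) l *
     ((\prod_(1 <= k < d.+1) sin_quotient k%:Z l) * (\prod_(1 <= k < (n - d).+1) sin_quotient k%:Z l))^-1)
  else 0.

(** n - 1 brackets over n brackets leave a factor 1 / (i l); together with 1 / (n i) it is the real
    number -1 / (n l). *)
Lemma one_point_frac_expi a n d l : (0 < n)%N -> l != 0 ->
  (n%:R * 'i)^-1 * one_point_frac a (expi_half l) n d = (l^-1 * one_point_real a n d l)%:C%C.
Proof.
move=> n0 l0; rewrite /one_point_frac /one_point_real; case: ifP => dn; last by rewrite !mulr0.
set u : CC := 'i * l%:C%C.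
have split m (k : nat -> int) : \prod_(1 <= i < m) bracket (expi_half l) (k i) =
    u ^+ m.-1 * (\prod_(1 <= i < m) sin_quotient (k i) l)%:C%C.
  rewrite rmorph_prod -subn1 -prodr_const_nat -big_split /=; apply: eq_bigr => i _.
  exact: bracket_expi_half.
rewrite !split /=; set P := \prod_(1 <= k < n) _; set D1 := \prod_(1 <= k < d.+1) _.
set D2 := \prod_(1 <= k < _) _; rewrite [X in _ / X]mulrACA -exprD subnKC //.
have i0 : 'i != 0 :> CC := neq0Ci _.
have l0' : l%:C%C != 0 :> CC by rewrite fmorph_eq0.
have u0 : u ^+ n.-1 != 0 by rewrite expf_neq0 // mulf_neq0.
have -> : u ^+ n = u ^+ n.-1 * u by rewrite -exprSr prednK.
have -> : (l^-1 * (- n%:R^-1 * (P / (D1 * D2))))%:C%C =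
    l%:C%C^-1 * - n%:R^-1 * (P%:C%C / (D1%:C%C * D2%:C%C)).
  by rewrite 2!rmorphM /= rmorphN 2!fmorphV rmorph_nat fmorph_div rmorphM mulrA.
rewrite -(mulrA _ u) -mulf_div divff // mul1r [(u * _)^-1]invfM [X in _ * X]mulrCA [LHS]mulrA; congr (_ * _).
have -> : (n%:R * 'i)^-1 / u = (l%:C%C)^-1 * (n%:R^-1 * ('i * 'i)^-1).
  by rewrite /u !invfM; ring.
by rewrite -expr2 sqrCi invrN1 mulrN1.
Qed.

Definition one_point_value (a : int) (n d : nat) : R :=
  if (d <= n)%N then
    - n%:R^-1 * ((\prod_(1 <= k < n) (n%:Z * a + d%:Z + k%:Z)%:~R) * (d`!%:R * (n - d)`!%:R)^-1)
  else 0.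

Lemma leading_one_point a n d : leading (one_point_real a n d) (one_point_value a n d).
Proof.
rewrite /one_point_real /one_point_value; case: leqP => _; last exact: leading_cst.
apply: leading_mul; first exact: leading_cst.
have pr m (k : nat -> int) : leading (fun l => \prod_(1 <= i < m) sin_quotient (k i) l)
    (\prod_(1 <= i < m) (k i)%:~R).
  by apply: leading_prod => i; apply: leading_sin.
have fa m : \prod_(1 <= i < m.+1) (i%:Z)%:~R = m`!%:R :> R by rewrite fact_prod natr_prod.
apply: leading_mul; first exact: pr.
rewrite -!fa; apply: leading_inv; last by apply: leading_mul; apply: pr.
by rewrite !fa mulf_neq0 // pnatr_eq0 -lt0n fact_gt0.
Qed.

Lemma Re_mul_real (x : R) (z : CC) : complex.Re (x%:C%C * z) = x * complex.Re z.
Proof. by case: z => p q /=; rewrite mul0r subr0. Qed.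

Lemma Re_sum (I : Type) (r : seq I) (f : I -> CC) :
  complex.Re (\sum_(i <- r) f i) = \sum_(i <- r) complex.Re (f i).
Proof.
elim: r => [|i r IH]; first by rewrite !big_nil.
by rewrite !big_cons -IH; case: (f i) (\sum_(j <- r) f j) => p q [s t].
Qed.

Lemma genus_sumE (l : R) (c : nat -> CC) N : l != 0 ->
  \sum_(g < N) (l%:C%C : CC) ^ (2 * g%:Z - 1) * c g =
  (l^-1)%:C%C * \sum_(g < N) ((l ^+ 2) ^+ g)%:C%C * c g.
Proof.
move=> l0; rewrite mulr_sumr; apply: eq_bigr => g _; rewrite mulrA -rmorphM; congr (_ * _).
have l0' : l%:C%C != 0 :> CC by rewrite fmorph_eq0.
by rewrite expfzDr // -exprM rmorphM fmorphV rmorphXn /= mulrC exprnP PoszM.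
Qed.

(** Multiplication by l and passage to real parts turn the genus expansion into a real power series
    in l^2. *)
Lemma genus_sum_tends_Re (c : nat -> CC) (l : R) (w : CC) : l != 0 ->
  tends (fun N => \sum_(g < N) (l%:C%C : CC) ^ (2 * g%:Z - 1) * c g) w ->
  forall eps, 0 < eps -> exists n0, forall n, (n0 <= n)%N ->
    `|l * complex.Re w - psum (fun g => complex.Re (c g)) (l ^+ 2) n| < eps.
Proof.
move=> l0 /tendsP H eps eps0; have e0 : 0 < eps / `|l| by rewrite divr_gt0 ?normr_gt0.
have [n0 Hn0] := H _ e0; exists n0 => n n0n.
have := le_lt_trans (normc_ge_Re _) (Hn0 n n0n); rewrite ltcR ltr_pdivlMr ?normr_gt0 // -normrM.
congr (_ < _); congr (`|_|); rewrite genus_sumE //.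
have -> : psum (fun g => complex.Re (c g)) (l ^+ 2) n =
    complex.Re (\sum_(g < n) ((l ^+ 2) ^+ g)%:C%C * c g).
  rewrite Re_sum /psum; apply: eq_bigr => g _.
  by rewrite Re_mul_real mulrC.
case: w {H Hn0} => w1 w2; set z : CC := \sum_(g < n) _.
have -> : complex.Re ((w1 +i* w2)%C - (l^-1)%:C%C * z) = w1 - l^-1 * complex.Re z.
  by rewrite -Re_mul_real; case: (_ * _).
by rewrite /=; field.
Qed.

(** [xget] may select any expansion. The expansion of h shows that one exists, and uniqueness of
    constant terms, applied to real and imaginary parts, fixes the coefficient for g = 0. *)
Lemma genus_zero_coef (w : ratC R) (h : R -> R) (z r : R) : leading h z -> 0 < r ->
  (exists P D : {poly CC}, w = FracField.tofrac P / FracField.tofrac D /\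
    forall l, 0 < `|l| < r -> D.[expi_half l] != 0 /\
      (l^-1 * h l)%:C%C = P.[expi_half l] / D.[expi_half l]) ->
  xget (fun=> 0) [set c | genus_expansion w c]%classic 0%N = z%:C%C.
Proof.
move=> [e e0 /even_expansion_cvg[r1 r10 He]] r0 [P [D [wE HPD]]].
have posm (x y : R) : 0 < x -> 0 < y -> 0 < Num.min x y by move=> x0 y0; rewrite lt_min x0.
have nz (x s : R) : 0 < `|x| < s -> x != 0 by move=> /andP[x0 _]; rewrite -normr_gt0.
case: xgetP => [c cE [P' [D' [wE' [r2 r20 Hc]]]]|no]; last first.
  case: (no (fun g => (e g)%:C%C)); exists P, D; split=> //.
  exists (Num.min r r1); first exact: posm.
  move=> l /andP[l0]; rewrite lt_min => /andP[lr lr1].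
  have [D0 <-] := HPD l (introT andP (conj l0 lr)); split=> //.
  have ln : l != 0 by rewrite -normr_gt0.
  apply/tendsP => eps eps0.
  have eps1 : 0 < eps * `|l| by rewrite mulr_gt0.
  have [|n0 Hn0] := He l _ _ eps1; first by rewrite l0.
  exists n0 => n n0n; rewrite (genus_sumE (fun g => (e g)%:C%C) n ln).
  have -> : \sum_(g < n) ((l ^+ 2) ^+ g)%:C%C * (e g)%:C%C = (psum e (l ^+ 2) n)%:C%C :> CC.
    by rewrite /psum rmorph_sum; apply: eq_bigr => g _; rewrite mulrC rmorphM.
  rewrite -rmorphM -rmorphB -mulrBr normc_def /= expr0n addr0 sqrtr_sqr ltcR normrM normfV.
  by rewrite mulrC ltr_pdivrMr // Hn0.
pose r3 := Num.min r (Num.min r1 r2); have r30 : 0 < r3 by rewrite !posm.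
have lim l : 0 < `|l| < r3 ->
    tends (fun N => \sum_(g < N) (l%:C%C : CC) ^ (2 * g%:Z - 1) * c g) (l^-1 * h l)%:C%C.
  move=> /andP[l0]; rewrite !lt_min => /and3P[lr lr1 lr2].
  have [D0 ->] := HPD l (introT andP (conj l0 lr)).
  have [D0' L] := Hc l (introT andP (conj l0 lr2)).
  (* Two representatives of w agree wherever both denominators are nonzero. *)
  suff -> : P.[expi_half l] / D.[expi_half l] = P'.[expi_half l] / D'.[expi_half l] by [].
  have pn (p : {poly CC}) : p.[expi_half l] != 0 -> FracField.tofrac p != 0.
    by move=> p0; rewrite tofrac_eq0; apply: contraNneq p0 => ->; rewrite horner0.
  have /eqP := etrans (esym wE) wE'; rewrite eqr_div ?pn // -!rmorphM tofrac_eq => /eqP E.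
  by apply/eqP; rewrite eqr_div // -!hornerM E.
have ReE : complex.Re (c 0%N) = z.
  apply/eqP; rewrite -subr_eq0 -e0; apply/eqP.
  apply: (@constant_term_unique _ (fun g => complex.Re (c g) - e g) _ r30) => l lr eps eps0.
  have l0 := nz _ _ lr; have eps2 : 0 < eps / 2 by rewrite divr_gt0.
  have [n1 H1] := genus_sum_tends_Re l0 (lim l lr) eps2.
  have [|n2 H2] := He l _ _ eps2.
    by move: lr => /andP[-> ]; rewrite !lt_min => /and3P[].
  exists (maxn n1 n2) => n; rewrite geq_max => /andP[/H1 + /H2].
  rewrite /= mulVKf //.
  have -> : psum (fun g => complex.Re (c g) - e g) (l ^+ 2) n =
      psum (fun g => complex.Re (c g)) (l ^+ 2) n - psum e (l ^+ 2) n.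
    by rewrite /psum -sumrB; apply: eq_bigr => g _; rewrite mulrBl.
  move: (psum _ _ _) (psum _ _ _) => x y; rewrite !ltr_norml => /andP[? ?] /andP[? ?].
  by apply/andP; split; lra.
(* After multiplication of the coefficients by i, the imaginary part becomes minus a real part, and
   the limit has real part 0. *)
have ImE : complex.Im (c 0%N) = 0.
  apply/eqP; rewrite -oppr_eq0 -ReiNIm; apply/eqP.
  apply: (@constant_term_unique _ (fun g => complex.Re (c g * 'i%C)) _ r30) => l lr eps eps0.
  have l0 := nz _ _ lr.
  have E N : (\sum_(g < N) (l%:C%C : CC) ^ (2 * g%:Z - 1) * c g) * 'i%C =
      \sum_(g < N) (l%:C%C : CC) ^ (2 * g%:Z - 1) * (c g * 'i%C).
    by rewrite mulr_suml; apply: eq_bigr => g _; rewrite mulrA.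
  have L := tends_ext E (tends_mul (lim l lr) (@tends_cst R 'i%C)).
  have [n1 H1] := genus_sum_tends_Re (c := fun g => c g * 'i%C) l0 L eps0; exists n1 => n /H1.
  by rewrite ReiNIm /= oppr0 mulr0 sub0r normrN.
by case: (c 0%N) ReE ImE => x y /= -> ->.
Qed.

Lemma Fgn0_eq a n d : (0 < n)%N -> Fgn R a 0 n d = (one_point_value a n d)%:C%C.
Proof.
(* For 0 < |l| < 1 / n and 0 < k <= n, the angle k l / 2 is nonzero and below 1/2 in absolute value,
   so the brackets of the denominator do not vanish. *)
move=> n0; rewrite /Fgn Fone_eq //; pose r : R := n%:R^-1.
have nR : 0 < n%:R :> R by rewrite ltr0n.
have r0 : 0 < r by rewrite invr_gt0.
apply: (genus_zero_coef (leading_one_point a n d) r0).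
pose S (v : CC) := exists2 l, 0 < `|l| < r & v = expi_half l.
have Sr : S (expi_half (r / 2)).
  by exists (r / 2) => //; rewrite gtr0_norm ?divr_gt0 //=; lra.
have [|v k [l /andP[l0 lr] ->] /andP[k0 kn]|P [D [-> H]]] := @evals_one_point R a S _ n d Sr.
- by move=> v [l _ ->]; apply: expi_half_neq0.
- have ln : l != 0 by rewrite -normr_gt0.
  rewrite bracket_expi_half // !mulf_neq0 ?neq0Ci ?fmorph_eq0 // /sin_quotient.
  rewrite mulf_neq0 ?invr_neq0 // mulf_neq0 ?pnatr_eq0 //.
  have kR : 0 < k%:R :> R by rewrite ltr0n.
  have kn' : k%:R <= n%:R :> R by rewrite ler_nat.
  have lt2 : `|l| * n%:R < 1 by move: lr; rewrite /r -(ltr_pM2r nR) mulVf ?gt_eqF.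
  have sn x : 0 < x -> x * n%:R < 1 -> sin ((k%:Z)%:~R * (x / 2)) != 0 :> R.
    move=> x0 x1; rewrite gt_eqF // sin2_gt0 //; apply/andP; split.
      by rewrite mulr_gt0 ?divr_gt0.
    by rewrite -[_%:~R]/(k%:R); nra.
  move: lt2; case: (ltrP 0 l) => h; first by rewrite gtr0_norm // => ?; apply: sn.
  have h' : 0 < - l by rewrite oppr_gt0 lt_neqAle ln.
  rewrite ler0_norm // => /(sn _ h'); rewrite mulNr mulrN sinN oppr_eq0 //.
exists P, D; split=> // l lr; have ln : l != 0 by case/andP: lr; rewrite normr_gt0.
have [D0 E] := H (expi_half l) (ex_intro2 _ _ l lr erefl); split=> //.
by rewrite -E one_point_frac_expi.
Qed.

End GenusZero.

Theorem theorem4p1 (R : realType) (a : int) (ha : a <> -1) (n d : nat) :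
  Psi R a 0 n d =
    if n == 0%N then 0 else
      (- ((n%:R : C R)^-1 *:
          \sum_(j < n.+1)
            ((\prod_(1 <= k < n) (n%:Z * a + j%:Z + k%:Z)%:~R) /
               ((j`!)%:R * ((n - j)`!)%:R)) *: 'X^j))`_d.
Proof.
rewrite /Psi; case: ifP => // n0; rewrite Fgn0_eq ?lt0n ?n0 //.
pose G j : C R := (\prod_(1 <= k < n) (n%:Z * a + j%:Z + k%:Z)%:~R) / (j`!%:R * (n - j)`!%:R).
rewrite -(poly_def n.+1 G) coefN coefZ coef_poly ltnS /one_point_value.
case: ifP => _; last by rewrite mulr0 oppr0.
rewrite -mulNr /G rmorphM rmorphN fmorphV rmorph_nat; congr (_ * _).
rewrite fmorph_div rmorphM !rmorph_nat rmorph_prod; congr (_ / _).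
by apply: eq_bigr => k _; rewrite rmorph_int.
Qed.
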